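(* Let $b$ be a prime, $s,m\in\mathbb N$, $R\in\mathbb N$ odd, $\beta>0$, and let $\mathcal S$ be an $s$-dimensional generalized Niederreiter sequence in base $b$ that is $(\log n)^{1+\beta}$-reduced. Let $\mathcal M_{m,R,\mathcal S}(f)$ be the median of $R$ independent coarsely scrambled estimates, each based on the first $b^m$ points of $\mathcal S$. Then for every $f\in L^2((0,1)^s)$, $$\mathbb E\left[\left|\mathcal M_{m,R,\mathcal S}(f)-I(f)\right|^2\right]\le\frac{2C_\beta}{b^m}\,\sigma_{MC}^2(f),$$ where $C_\beta=\exp\left(2+\frac{1}{2(\log 2)^{1+\beta}}+\frac{1}{\beta(\log 2)^\beta}\right)$.
   Context: Functions are real valued on $(0,1)^s$; $I(f)=\int_{(0,1)^s}f(\boldsymbol x)\,d\boldsymbol x$ and $\sigma_{MC}^2(f)=\int_{(0,1)^s}f(\boldsymbol x)^2d\boldsymbol x-I(f)^2$. $\log$ is the natural logarithm. The field $\mathbb F_b$ is identified with $\{0,\dots,b-1\}$ with arithmetic modulo $b$. Generalized Niederreiter sequence (GNS): let $p_1,\dots,p_s\in\mathbb F_b[x]$ be monic pairwise coprime polynomials (the base polynomials), $e_j=\deg p_j$. For $1\le j\le s$ and $k\in\mathbb N$ put $k_j=\lfloor (k-1)/e_j\rfloor$, and let $y_k^{(j)}\in\mathbb F_b[x]$ be such that, for each $t\ge1$, the residues $y_k^{(j)}\bmod p_j$ for $(t-1)e_j\le k-1<te_j$ are linearly independent over $\mathbb F_b$. Expand $y_k^{(j)}(x)/p_j(x)^t=\sum_{r\ge1}a^{(j)}(t,k,r)x^{-r}$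 in $\mathbb F_b((x^{-1}))$. The GNS $\mathcal S$ is the digital sequence with generating matrices $C_j=(c^{(j)}_{k,r})_{k,r\in\mathbb N}$, $c^{(j)}_{k,r}=a^{(j)}(k_j+1,k,r)$: for $n\in\mathbb N_0$ with base-$b$ digits $n=\eta_0+\eta_1b+\cdots$ and $\vec n=(\eta_0,\eta_1,\dots)^\top$, the $n$-th point has $j$-th coordinate $\phi_b(C_j\vec n)$, where $\phi_b(\vec z)=\sum_{r\ge1}z_rb^{-r}$ for $\vec z\in\mathbb F_b^{\mathbb N}$. Reduced GNS: for a positive sequence $a(n)$, $n\ge2$, a GNS is $a(n)$-reduced if its base polynomials are irreducible and, for each degree $n\ge2$, at most $\lfloor (b^n-1)/(n\,a(n))\rfloor$ monic irreducible polynomials of degree $n$ are used as base polynomials. Coarse scrambling: let $D_j\in\mathbb F_b^{\mathbb N}$ and $M_j\in\mathbb F_b^{\mathbb N\times\mathbb N}$, $j=1,\dots,s$, be independent; $D_j$ has i.i.d. uniform entries; $M_j$ is block lower triangular with $e_j\times e_j$ blocks, its diagonal blocks uniform on $\mathrm{GL}(e_j,\mathbb F_b)$ and its blocks below the diagonal uniform on $\mathbb F_b^{e_j\times e_j}$, all blocks independent. The scrambled points are $\widetilde{\boldsymbol x}_n=(\phi_b(M_1C_1\vec n+D_1),\dots,\phi_b(M_sC_s\vec n+D_s))$. The estimator is $\mathcal I_{m,\mathcal S}(f)=b^{-m}\sum_{n=0}^{b^m-1}f(\widetilde{\boldsymbol x}_n)$, and $\mathcal M_{m,R,\mathcal S}(f)$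 is the median of $R$ independent realizations of $\mathcal I_{m,\mathcal S}(f)$. *)

(* Defs.v *)
From HB Require Import structures.
From mathcomp Require Import all_boot all_order all_algebra.
From mathcomp Require Import all_classical all_reals all_analysis.

Set Implicit Arguments.
Unset Strict Implicit.
Unset Printing Implicit Defensive.
Import Order.TTheory GRing.Theory Num.Theory.
Import numFieldNormedType.Exports.

Local Open Scope classical_set_scope.
Local Open Scope ring_scope.

(** Rows and columns of infinite matrices, coordinates of infinite vectors and
    the numerators y_k of the sequence are all indexed from 0 instead of 1. *)

Section lebesgue_measure_tuple.
Context {R : realType}.

Definition tuple_cons n (x : measurableTypeR R * n.-tuple R) : n.+1.-tuple R :=
  [tuple of x.1 :: x.2].

Definition tuple_uncons n (x : n.+1.-tuple R) :
    measurableTypeR R * n.-tuple R :=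
  (thead x, [tuple of behead x]).

Lemma tuple_consK n : cancel (@tuple_cons n) (@tuple_uncons n).
Proof. by move=> [x t]; congr pair; apply: val_inj. Qed.

Lemma measurable_tuple_cons n : measurable_fun setT (@tuple_cons n).
Proof. exact: measurable_cons. Qed.

Lemma measurable_tuple_uncons n : measurable_fun setT (@tuple_uncons n).
Proof.
apply/measurable_fun_pairP; split; first exact: measurable_tnth.
exact: measurable_behead.
Qed.

Section lebesgue_tuple_step.
Context n (mu : {sigma_finite_measure set (n.-tuple R) -> \bar R}).

Definition lebesgue_tuple_step : set (n.+1.-tuple R) -> \bar R :=
  pushforward (lebesgue_measure \x mu)%E (@tuple_cons n).

Let step0 : lebesgue_tuple_step set0 = 0%E.
Proof. by rewrite /lebesgue_tuple_step /pushforward preimage_set0 measure0. Qed.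

Let step_ge0 A : (0 <= lebesgue_tuple_step A)%E.
Proof. by rewrite /lebesgue_tuple_step /pushforward. Qed.

Let step_sigma_additive : semi_sigma_additive lebesgue_tuple_step.
Proof.
move=> F mF tF mUF; rewrite /lebesgue_tuple_step /pushforward preimage_bigcup.
apply: measure_semi_sigma_additive.
- by move=> k; rewrite -[X in measurable X]setTI; exact: measurable_tuple_cons.
- apply/trivIsetP => /= i j _ _ ij; rewrite -preimage_setI.
  by move/trivIsetP : tF => /(_ _ _ _ _ ij) ->//; rewrite preimage_set0.
- rewrite -preimage_bigcup -[X in measurable X]setTI.
  exact: measurable_tuple_cons.
Qed.

HB.instance Definition _ := isMeasure.Build _ _ _ lebesgue_tuple_step
  step0 step_ge0 step_sigma_additive.

Let step_sigma_finite : sigma_finite setT lebesgue_tuple_step.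
Proof.
have /sigma_finiteP[F [TF ndF Foo]] := sigma_finiteT (@lebesgue_measure R).
have /sigma_finiteP[G [TG ndG Goo]] := sigma_finiteT mu.
exists (fun k => @tuple_uncons n @^-1` (F k `*` G k)).
  rewrite -preimage_bigcup; apply/esym; rewrite -subTset => x _ /=.
  have [k _ Fk] : (\bigcup_k F k) (tuple_uncons x).1 by rewrite -TF.
  have [l _ Gl] : (\bigcup_k G k) (tuple_uncons x).2 by rewrite -TG.
  exists (maxn k l) => //; split.
  - by move: Fk; exact/subsetPset/ndF/leq_maxl.
  - by move: Gl; exact/subsetPset/ndG/leq_maxr.
move=> k; have [mF Fk] := Foo k; have [mG Gk] := Goo k; split.
  rewrite -[X in measurable X]setTI.
  by apply: measurable_tuple_uncons => //; exact: measurableX.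
rewrite /lebesgue_tuple_step /pushforward -comp_preimage.
rewrite (_ : _ \o _ = id) ?preimage_id; last first.
  by apply/funext => x; exact: tuple_consK.
by rewrite product_measure1E// lte_mul_pinfty// ge0_fin_numE.
Qed.

HB.instance Definition _ := Measure_isSigmaFinite.Build _ _ _
  lebesgue_tuple_step step_sigma_finite.

End lebesgue_tuple_step.

(** Lebesgue measure on [R^n], as an iterated product measure. *)
Fixpoint lebesgue_tuple n : {sigma_finite_measure set (n.-tuple R) -> \bar R} :=
  match n with
  | 0%N => [the {sigma_finite_measure set (0.-tuple R) -> \bar R} of
            \d_([tuple of [::]] : 0.-tuple R)]
  | k.+1 => [the {sigma_finite_measure set (k.+1.-tuple R) -> \bar R} of
             lebesgue_tuple_step (lebesgue_tuple k)]
  end.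

Definition unit_cube s : set (s.-tuple R) :=
  [set x | forall i, 0 < tnth x i < 1].

(** [f] is only relevant on the open cube: it is extended by 0 outside. *)
Definition cube_L2 s (f : s.-tuple R -> R) : Prop :=
  f \_ (@unit_cube s) \in Lfun (lebesgue_tuple s) 2%:E.

Definition cube_integral s (f : s.-tuple R -> R) : R :=
  \int[lebesgue_tuple s]_(x in @unit_cube s) f x.

Definition sigma2_MC s (f : s.-tuple R -> R) : R :=
  cube_integral (fun x => f x ^+ 2) - cube_integral f ^+ 2.

End lebesgue_measure_tuple.
Arguments unit_cube {R} s.

(** [L : int -> F] stands for the element [\sum_i L i x^i] of F((x^-1)); the
    predicate says that it equals [y / q], i.e. that [q * L = y]. *)
Definition laurent_expansion (F : fieldType) (y q : {poly F}) (L : int -> F) :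
    Prop :=
  (exists N : int, forall i, N < i -> L i = 0) /\
  forall i : int, \sum_(d < size q) (q`_d * L (i - d%:Z)) =
                  if i is Posz n then y`_n else 0.

(** [gns_num j k] is y_(k+1)^(j), and [gns_exp j t k] is the expansion of
    [y_(k+1)^(j) / p_j^t]. *)
Record gns (b s : nat) := GNS {
  gns_base : 'I_s -> {poly 'F_b};
  gns_deg := fun j => (size (gns_base j)).-1;
  gns_num : 'I_s -> nat -> {poly 'F_b};
  gns_exp : 'I_s -> nat -> nat -> int -> 'F_b;
  gns_base_nonconstant : forall j, (1 < size (gns_base j))%N;
  gns_base_monic : forall j, gns_base j \is monic;
  gns_base_coprime :
    forall i j, i != j -> coprimep (gns_base i) (gns_base j);
  gns_num_free : forall j (t : nat) (c : 'I_(gns_deg j) -> 'F_b),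
    \sum_(i < gns_deg j)
      c i *: (gns_num j (t * gns_deg j + i)%N %% gns_base j) = 0 ->
    forall i, c i = 0;
  gns_exp_spec : forall j t k, (0 < t)%N ->
    laurent_expansion (gns_num j k) (gns_base j ^+ t) (gns_exp j t k)
}.

Section digital_sequence.
Context (b s : nat) (S : gns b s).

Definition gns_matrix (j : 'I_s) (k r : nat) : 'F_b :=
  gns_exp S j (k %/ gns_deg S j).+1 k (- (r.+1)%:Z).

Definition digit (n r : nat) : 'F_b := ((n %/ b ^ r) %% b)%:R.

(** The digits of [n] of index [r >= n] vanish, as [n < b ^ n]. *)
Definition gns_vec (n : nat) (j : 'I_s) (k : nat) : 'F_b :=
  \sum_(r < n) gns_matrix j k r * digit n r.

End digital_sequence.

Definition phi {R : realType} b (z : nat -> 'F_b) : R :=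
  limn [series (z r : nat)%:R / b%:R ^+ r.+1 : R]_r.

Definition reduced {R : realType} (a : nat -> R) b s (S : gns b s) : Prop :=
  (forall j, irreducible_poly (gns_base S j)) /\
  forall n, (2 <= n)%N ->
    (size (undup [seq gns_base S j | j <- enum 'I_s & gns_deg S j == n]))%:Z <=
    Num.floor ((b%:R ^+ n - 1) / (n%:R * a n)).

Section scrambling.
Context d (W : measurableType d) (R : realType) (P : probability W R).

Definition uniform_on (T : finType) (A : {set T}) (X : W -> T) : Prop :=
  forall x, measurable (X @^-1` [set x]) /\
    P (X @^-1` [set x]) = if x \in A then (#|A|%:R^-1)%:E else 0%E.

Definition independent_classes (I : eqType) (E : I -> set (set W)) : Prop :=
  forall (J : seq I) (A : I -> set W), uniq J ->
    (forall i, i \in J -> E i (A i)) ->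
    P (\bigcap_(i in [set` J]) A i) = (\prod_(i <- J) P (A i))%E.

Definition events_of (T : Type) (X : W -> T) : set (set W) :=
  [set X @^-1` A | A in [set: set T]].

Definition mxblock_of (F : Type) e (A : nat -> nat -> F) (k l : nat) :
    'M[F]_e :=
  \matrix_(i < e, i' < e) A (k * e + i)%N (l * e + i')%N.

Context (b s N : nat) (e : 'I_s -> nat).
Variables (D : 'I_N -> 'I_s -> W -> nat -> 'F_b)
          (M : 'I_N -> 'I_s -> W -> nat -> nat -> 'F_b).

Definition scrambling_events (i : 'I_N * 'I_s * (nat + nat * nat)) :
    set (set W) :=
  let: (q, j, x) := i in
  match x with
  | inl k => events_of (fun w => D q j w k)
  | inr (k, l) => events_of (fun w => mxblock_of (e j) (M q j w) k l)
  end.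

(** [N] independent coarse scramblings with block sizes [e]. Blocks above the
    diagonal are constant, hence harmless in the independence condition. *)
Record coarse_scrambling : Prop := CoarseScrambling {
  cs_shift : forall q j k, uniform_on [set: 'F_b] (fun w => D q j w k);
  cs_diag : forall q j k,
    uniform_on [set A : 'M['F_b]_(e j) | A \in unitmx]
      (fun w => mxblock_of (e j) (M q j w) k k);
  cs_below : forall q j k l, (l < k)%N ->
    uniform_on [set: 'M['F_b]_(e j)]
      (fun w => mxblock_of (e j) (M q j w) k l);
  cs_above : forall q j k l w, (k < l)%N ->
    mxblock_of (e j) (M q j w) k l = 0;
  cs_indep : independent_classes scrambling_events
}.

End scrambling.

Section estimator.
Context {R : realType} (b s : nat) (S : gns b s).

(** [M] is block lower triangular: its row [k] is supported on the column
    blocks of index at most [k %/ e]. *)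
Definition scramble (e : nat) (M : nat -> nat -> 'F_b) (D v : nat -> 'F_b)
    (k : nat) : 'F_b :=
  (\sum_(l < (k %/ e).+1 * e) M k l * v l) + D k.

Definition scrambled_point (M : 'I_s -> nat -> nat -> 'F_b)
    (D : 'I_s -> nat -> 'F_b) (n : nat) : s.-tuple R :=
  [tuple phi (scramble (gns_deg S j) (M j) (D j) (gns_vec S n j)) | j < s].

(** A scrambled point may leave the open cube (on a null event), where [f] is
    taken to be 0. *)
Definition estimate (m : nat) (f : s.-tuple R -> R)
    (M : 'I_s -> nat -> nat -> 'F_b) (D : 'I_s -> nat -> 'F_b) : R :=
  (b%:R ^+ m)^-1 *
  \sum_(n < b ^ m) (f \_ (unit_cube s)) (scrambled_point M D n).

End estimator.

(** The middle order statistic, for sequences of odd size. *)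
Definition median {R : realType} (x : seq R) : R :=
  nth 0 (sort <=%R x) (size x)./2.

Definition median_estimate {R : realType} b s (S : gns b s) (N m : nat)
    (W : Type) (D : 'I_N -> 'I_s -> W -> nat -> 'F_b)
    (M : 'I_N -> 'I_s -> W -> nat -> nat -> 'F_b) (f : s.-tuple R -> R)
    (w : W) : R :=
  median [seq estimate S m f (M q ^~ w) (D q ^~ w) | q : 'I_N].

Definition C_const {R : realType} (beta : R) : R :=
  expR (2 + 1 / (2 * (ln 2 `^ (1 + beta))) + 1 / (beta * (ln 2 `^ beta))).

(* Main.v *)
From HB Require Import structures.
Require Import Defs.
From mathcomp Require Import all_boot all_order all_algebra.
From mathcomp Require Import all_classical all_reals all_analysis.
From mathcomp Require Import measurable_realfun.
From mathcomp Require Import ring lra zify.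

Set Implicit Arguments.
Unset Strict Implicit.
Unset Printing Implicit Defensive.
Import Order.TTheory GRing.Theory Num.Theory.
Import numFieldNormedType.Exports.

Local Open Scope ring_scope.

(** Let [F] be [f] extended by 0 outside the open cube, [I] its integral and
    [g = F - I].  Two facts combine into the bound.

    Medians.  Among [N = 2 k + 1] estimates at least [k + 1] lie at least as far
    from [I] as their median, all on the same side of it.  Hence [k + 1] times
    the squared error of the median is at most the sum of the [N] squared
    errors ([median_sqr_le]), and its expectation is at most
    [N / (k + 1) <= 2] times a bound for a single scrambled estimate.

    A single estimate ([second_moment_le]).  Every scrambled point is uniform on
    the cube, since its digits are ([sdigit_uniform], [phi_tuple_law]).  Split
    the digits of every coordinate after its first [m] blocks.  The leading
    digits, a vector over F_b, put the point in a cell, which is an affine copy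
    of the cube; let [gbar] be the function on cells whose values are the means
    of [g].  Two distinct points among the first [b ^ m] differ, in each
    coordinate, within the first [m] blocks ([gns_vec_separates]); the uniform
    blocks of the scrambling matrix below the diagonal then make the later
    digits of the two points jointly uniform, whatever the leading ones
    ([tail_digits_uniform]).  So the expectation of [g X_n * g X_n'] is that of
    [gbar] at the two cells.  The diagonal terms differ from those of [gbar] by
    a quantity that Jensen's inequality makes nonnegative, and the problem
    becomes a finite one for the function [gbar] of mean zero.

    The finite problem ([finite_gain]).  For fixed scrambling matrices and a
    uniform shift, the second moment is a sum of correlations of [gbar] along a
    linear code.  Poisson summation turns it into the sum of nonnegative
    spectral weights over the dual code, and Plancherel's identity gives the sum
    of all weights ([real_poisson], [real_plancherel]).  So it suffices that a
    nonzero vector is dual to the scrambled code with probability at most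
    [b ^- m] times a constant ([dual_probability]).  The transposed scrambling
    maps the vector uniformly onto the vectors with the same last nonzero block
    in every coordinate.  If these live on [T] rows, there are at least
    [b ^ T * \prod_j (1 - b ^- e_j)] of them, while at most [b ^ (T - m)] vectors
    on these rows are orthogonal to the code ([card_gns_kernel]): such a vector
    is the numerator of a fraction with denominator [\prod_j p_j ^ ell_j], of
    degree [T], whose first [m] Laurent coefficients vanish.

    The constant [\prod_j (1 - b ^- e_j)^-1] is at most [C_const beta]
    ([gain_constant_le]): base polynomials of degree 1 contribute at most
    [expR 2], and those of degree [n >= 2] at most
    [expR (1 / (n * (ln n) ^ (1 + beta)))]. *)

(** * Poisson summation over linear codes, without characters *)

Section dot_product.
Variables (F : finFieldType) (I : finType).
Implicit Types x y z k : {ffun I -> F}.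

Definition dot x y : F := \sum_i x i * y i.

Lemma dotDr k x y : dot k (x + y) = dot k x + dot k y.
Proof. by rewrite /dot -big_split; apply: eq_bigr => i _; rewrite ffunE mulrDr. Qed.

Lemma dotC x y : dot x y = dot y x.
Proof. by apply: eq_bigr => i _; rewrite mulrC. Qed.

Lemma dotDl k x y : dot (x + y) k = dot x k + dot y k.
Proof. by rewrite dotC dotDr !(dotC k). Qed.

Lemma dotNr k x : dot k (- x) = - dot k x.
Proof. by rewrite /dot -sumrN; apply: eq_bigr => i _; rewrite ffunE mulrN. Qed.

Lemma dotBr k x y : dot k (x - y) = dot k x - dot k y.
Proof. by rewrite dotDr dotNr. Qed.

Lemma dot0r k : dot k 0 = 0.
Proof. by rewrite /dot big1 // => i _; rewrite ffunE mulr0. Qed.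

Lemma dot0l k : dot 0 k = 0.
Proof. by rewrite dotC dot0r. Qed.

Lemma dot_surj z c : z != 0 -> exists k, dot k z = c.
Proof.
move=> nz; have [i zi] : exists i, z i != 0.
  apply/existsP; apply: contra_neqT nz => /existsPn zE.
  by apply/ffunP => i; rewrite ffunE; apply/eqP; rewrite -[_ == _]negbK.
exists [ffun i' => if i' == i then c / z i else 0]; rewrite /dot (bigD1 i) //=.
rewrite ffunE eqxx divfK // big1 ?addr0 // => i' ne.
by rewrite ffunE (negbTE ne) mul0r.
Qed.

Lemma card_hyperplane z c : z != 0 ->
  (#|[set k | dot k z == c]| * #|F|)%N = #|{ffun I -> F}|.
Proof.
move=> nz.
have cE c' : #|[set k | dot k z == c']| = #|[set k | dot k z == c]|.
  have [h hE] := dot_surj (c - c') nz.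
  rewrite -[LHS](card_imset _ (addIr h)); apply: eq_card => k.
  rewrite inE; apply/imsetP/eqP => [[k' + ->]|kE].
    by rewrite inE dotDl hE => /eqP ->; rewrite addrC subrK.
  exists (k - h); last by rewrite subrK.
  by rewrite inE -(inj_eq (addIr (dot h z))) -dotDl subrK kE hE addrC subrK.
rewrite -[RHS]sum1_card (partition_big (dot^~ z) predT) //=.
rewrite (eq_bigr (fun=> #|[set k | dot k z == c]|)) => [|c' _].
  by rewrite sum_nat_const mulnC cardT.
rewrite sum1_card -(cE c'); apply: eq_card => k; by rewrite !inE.
Qed.

End dot_product.

(** Characters of [F] are replaced by the real function [centered_indicator],
    whose sum over one argument vanishes unless the other argument is 0, because
    a hyperplane contains one point out of [#|F|].  The map [Phi] stands for the
    scrambled generating matrices. *)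
Section real_fourier.
Variables (R : realFieldType) (F : finFieldType) (I J : finType).
Variables (Phi : {ffun J -> F} -> {ffun I -> F}).
Variables (adj : {ffun I -> F} -> {ffun J -> F}).
Hypothesis adjP : forall k n, dot k (Phi n) = dot (adj k) n.
Variable g : {ffun I -> F} -> R.
Hypothesis g0 : \sum_x g x = 0.

Let q : R := #|F|%:R.
Let G : R := #|{ffun I -> F}|%:R.
Let V : R := #|{ffun J -> F}|%:R.

(** Up to a factor [#|F|], the sum of the squared Fourier coefficients of [g] at
    the multiples of [k]. *)
Definition spectral (k : {ffun I -> F}) : R :=
  \sum_c (\sum_(x | dot k x == c) g x) ^+ 2.

Lemma spectral_ge0 k : 0 <= spectral k.
Proof. by apply: sumr_ge0 => c _; apply: sqr_ge0. Qed.

Lemma spectral0 : spectral 0 = 0.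
Proof.
apply: big1 => c _; case: (eqVneq c 0) => [->|nc].
  rewrite (eq_bigl predT) ?g0 ?expr0n // => x.
  by rewrite dot0l eqxx.
by rewrite big_pred0 ?expr0n // => x; rewrite dot0l eq_sym (negbTE nc).
Qed.

Lemma card_fin_field_neq0 : q != 0.
Proof. by rewrite pnatr_eq0 -lt0n; apply/card_gt0P; exists 0. Qed.

Definition centered_indicator (k z : {ffun I -> F}) : R := (dot k z == 0)%:R - q^-1.

Lemma sum_indicator (T : finType) (P : pred T) : \sum_x (P x)%:R = #|[set x | P x]|%:R :> R.
Proof.
rewrite -sum1_card natr_sum big_mkcond [RHS]big_mkcond; apply: eq_bigr => x _.
by rewrite inE; case: (P x).
Qed.

Lemma sum_centered_indicator z : \sum_k centered_indicator k z = (z == 0)%:R * G * (1 - q^-1).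
Proof.
have qn := card_fin_field_neq0.
rewrite /centered_indicator big_split /= sum_indicator sumr_const -[- q^-1 *+ _]mulr_natr.
rewrite -[#|xpredT|%:R]/G.
case: (eqVneq z 0) => [->|nz] /=.
  rewrite (_ : [set k | _] = finset.setT) ?cardsT; first by rewrite -/G; ring.
  by apply/finset.setP=> k; rewrite !inE dot0r eqxx.
have GE : G = #|[set k | dot k z == 0]|%:R * q.
  by rewrite -natrM card_hyperplane.
by rewrite GE; field.
Qed.

Lemma sum_centered_indicator_code k w :
  \sum_n centered_indicator k (w - Phi n) = if adj k == 0 then V * centered_indicator k w else 0.
Proof.
have qn := card_fin_field_neq0.
case: ifP => [/eqP a0|/negbT a0].
  rewrite (eq_bigr (fun=> centered_indicator k w)) ?sumr_const ?mulr_natl // => n _.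
  by rewrite /centered_indicator dotBr adjP a0 dot0l subr0.
rewrite /centered_indicator big_split /= sum_indicator sumr_const.
rewrite (_ : [set _ | _] = [set n | dot n (adj k) == dot k w]); last first.
  by apply/finset.setP => n; rewrite !inE dotBr adjP subr_eq0 eq_sym dotC.
have VE : V = #|[set n | dot n (adj k) == dot k w]|%:R * q.
  by rewrite -natrM card_hyperplane.
by rewrite -[- q^-1 *+ _]mulr_natr -[#|xpredT|%:R]/V VE; field.
Qed.

Lemma sum_pair_centered_indicator k : \sum_x \sum_y g x * g y * centered_indicator k (y - x) =
  spectral k.
Proof.
transitivity (\sum_x \sum_y g x * g y * (dot k y == dot k x)%:R).
  apply: eq_bigr => x _; have h : \sum_y g x * q^-1 * g y = 0.
    by rewrite -mulr_sumr g0 mulr0.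
  rewrite -[RHS]subr0 -[X in _ - X]h -sumrB; apply: eq_bigr => y _.
  by rewrite /centered_indicator dotBr subr_eq0; ring.
rewrite /spectral (partition_big (dot k) predT) //=; apply: eq_bigr => c _.
rewrite expr2 mulr_suml; apply: eq_bigr => x /eqP xc.
rewrite mulr_sumr [RHS]big_mkcond; apply: eq_bigr => y _.
by rewrite xc; case: ifP; rewrite ?mulr1 ?mulr0.
Qed.

(** Detect [y = x + Phi n] by summing [centered_indicator k (y - x - Phi n)] over
    [k], then sum over [n] first: only the [k] orthogonal to the code survive. *)
Lemma real_poisson :
  (\sum_n \sum_x g x * g (x + Phi n)) * (G * (1 - q^-1)) =
  V * \sum_(k | adj k == 0) spectral k.
Proof.
transitivity (\sum_k \sum_n \sum_x \sum_y g x * g y * centered_indicator k (y - x - Phi n)).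
  rewrite mulr_suml exchange_big; apply: eq_bigr => n _ /=.
  rewrite mulr_suml exchange_big; apply: eq_bigr => x _ /=.
  rewrite exchange_big /= (bigD1 (x + Phi n)) //= [X in _ = _ + X]big1 => [|y ny].
    rewrite addr0 -mulr_sumr sum_centered_indicator.
    by rewrite (addrC x) addrK subrr eqxx mul1r.
  rewrite -mulr_sumr sum_centered_indicator subr_eq0 subr_eq addrC (negbTE ny).
  by rewrite !mul0r mulr0.
rewrite mulr_sumr [RHS]big_mkcond; apply: eq_bigr => k _ /=.
transitivity (\sum_x \sum_y g x * g y * \sum_n centered_indicator k (y - x - Phi n)).
  rewrite exchange_big; apply: eq_bigr => x _ /=.
  by rewrite exchange_big; apply: eq_bigr => y _ /=; rewrite mulr_sumr.
rewrite -sum_pair_centered_indicator;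
  under eq_bigr do under eq_bigr do rewrite sum_centered_indicator_code.
case: ifP => _.
  rewrite mulr_sumr; apply: eq_bigr => x _; rewrite mulr_sumr.
  by apply: eq_bigr => y _; ring.
by rewrite big1 // => x _; rewrite big1 // => y _; rewrite mulr0.
Qed.

End real_fourier.

Section plancherel.
Variables (R : realFieldType) (F : finFieldType) (I : finType).
Variable g : {ffun I -> F} -> R.
Hypothesis g0 : \sum_x g x = 0.

(** Poisson summation for the trivial code. *)
Lemma real_plancherel :
  (\sum_x g x ^+ 2) * (#|{ffun I -> F}|%:R * (1 - #|F|%:R^-1)) = \sum_k spectral g k.
Proof.
pose Phi (n : {ffun 'I_0 -> F}) : {ffun I -> F} := 0.
pose adj (k : {ffun I -> F}) : {ffun 'I_0 -> F} := 0.
have adjP k n : dot k (Phi n) = dot (adj k) n by rewrite dot0r dot0l.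
have := real_poisson adjP g0; rewrite (_ : #|{ffun 'I_0 -> F}| = 1)%N.
  rewrite mul1r /adj; under [in RHS]eq_bigl do rewrite eqxx.
  move=> <-; congr (_ * _); rewrite (bigD1 (0 : {ffun 'I_0 -> F})) //= [X in _ + X]big1 ?addr0.
    by apply: eq_bigr => x _; rewrite /Phi addr0 expr2.
  by move=> n /negP[]; apply/eqP/ffunP => -[].
by rewrite card_ffun card_ord expn0.
Qed.

End plancherel.

(** Rows of the generating matrices: coordinate [j] contributes [ell j] blocks of
    [e j] rows.  All vectors of leading digits are functions on this type. *)
Definition blk_idx s (e ell : 'I_s -> nat) := {j : 'I_s & ('I_(ell j) * 'I_(e j))%type}.

Section block_index.
Variables (s : nat) (e ell : 'I_s -> nat).

Definition blk_mk (j : 'I_s) (k : 'I_(ell j)) (i : 'I_(e j)) : blk_idx e ell :=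
  Tagged (fun j => ('I_(ell j) * 'I_(e j))%type) (k, i).

Definition blk_row (x : blk_idx e ell) : nat := ((tagged x).1 * e (tag x) + (tagged x).2)%N.

Lemma sum_blk (V : nmodType) (f : blk_idx e ell -> V) :
  \sum_x f x = \sum_j \sum_k \sum_i f (@blk_mk j k i).
Proof.
under [RHS]eq_bigr => j _ do rewrite pair_bigA /=.
rewrite (sig_big_dep xpredT (fun j => predT) (fun j p => f (blk_mk p.1 p.2))) /=.
by apply: eq_bigr => -[j [k i]] _.
Qed.

End block_index.

(** * The kernel of the generating matrices *)

Section laurent_action.
Variable F : fieldType.
Implicit Types (p q y : {poly F}) (L : int -> F).

(** Product of a polynomial and a series, possibly infinite in both directions,
    so that no side condition is attached to the module laws below. *)
Definition lact p L (i : int) : F := \sum_(d < size p) p`_d * L (i - d%:Z).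

Definition laurent_of_poly y (i : int) : F := if i is Posz n then y`_n else 0.

Lemma lact_widen p L i n : (size p <= n)%N ->
  lact p L i = \sum_(d < n) p`_d * L (i - d%:Z).
Proof.
move=> pn; rewrite /lact (big_ord_widen n (fun d => p`_d * L (i - d%:Z)) pn).
rewrite big_mkcond; apply: eq_bigr => d _; case: ltnP => // pd.
by rewrite nth_default ?mul0r.
Qed.

Lemma lactD p q L i : lact (p + q) L i = lact p L i + lact q L i.
Proof.
have h := leq_maxl (size p) (size q); have h' := leq_maxr (size p) (size q).
rewrite (lact_widen _ _ h) (lact_widen _ _ h') (lact_widen _ _ (size_polyD p q)).
by rewrite -big_split; apply: eq_bigr => d _; rewrite coefD mulrDl.
Qed.

Lemma lact_cons p c L i :
  lact (p * 'X + c%:P) L i = lact p L (i - 1) + c * L i.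
Proof.
have sz : (size (p * 'X + c%:P)%R <= (size p).+1)%N.
  rewrite (leq_trans (size_polyD _ _)) // geq_max (leq_trans (size_polyMleq _ _)).
    by rewrite (leq_trans (size_polyC_leq1 c)).
  by rewrite size_polyX addn2.
rewrite (lact_widen _ _ sz) big_ord_recl addrC; congr (_ + _).
  apply: eq_bigr => d _; rewrite coefD coefMX coefC /= addr0 /bump /= add1n.
  by congr (_ * L _); lia.
by rewrite coefD coefMX coefC /= add0r subr0.
Qed.

Lemma lact_eqfun p L L' : L =1 L' -> lact p L =1 lact p L'.
Proof. by move=> e i; apply: eq_bigr => d _; rewrite e. Qed.

Lemma lact_sum p (T : finType) (c : T -> F) (Ls : T -> int -> F) i :
  lact p (fun i => \sum_t c t * Ls t i) i = \sum_t c t * lact p (Ls t) i.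
Proof.
rewrite /lact; under eq_bigr do rewrite mulr_sumr.
rewrite exchange_big; apply: eq_bigr => t _; rewrite mulr_sumr.
by apply: eq_bigr => d _; rewrite mulrCA.
Qed.

Lemma lactZ c p L i : lact (c *: p) L i = c * lact p L i.
Proof.
rewrite (lact_widen _ _ (size_scale_leq c p)) /lact mulr_sumr.
by apply: eq_bigr => d _; rewrite coefZ mulrA.
Qed.

Lemma lact0 L i : lact 0 L i = 0.
Proof. by rewrite /lact size_poly0 big_ord0. Qed.

Lemma lactM p q L i : lact (p * q) L i = lact p (lact q L) i.
Proof.
elim/poly_ind: p i => [|p c IH] i; first by rewrite mul0r !lact0.
rewrite lact_cons -IH mulrDl mulrAC -[p * q * 'X]addr0 -(polyC0 F) lactD.
by rewrite lact_cons mul0r addr0 mul_polyC lactZ.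
Qed.

Lemma lact_poly p y i : lact p (laurent_of_poly y) i = laurent_of_poly (p * y) i.
Proof.
elim/poly_ind: p i => [|p c IH] i.
  by rewrite lact0 mul0r /laurent_of_poly; case: i => // n; rewrite coef0.
rewrite lact_cons IH mulrDl mulrAC mul_polyC.
case: i => [[|n]|n]; rewrite /laurent_of_poly ?subr0.
- by rewrite sub0r /= coefD coefMX coefZ /= add0r.
- by rewrite (_ : n.+1%:Z - 1 = n); [rewrite coefD coefMX coefZ | lia].
- by rewrite (_ : Negz n - 1 = Negz n.+1); [rewrite mulr0 addr0 | lia].
Qed.

Lemma lactBr p L L' i : lact p (fun i => L i - L' i) i = lact p L i - lact p L' i.
Proof. by rewrite /lact -sumrB; apply: eq_bigr => d _; rewrite mulrBr. Qed.

Definition bounded_above L := exists N : int, forall i, N < i -> L i = 0.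

Lemma bounded_above_sum (T : finType) (c : T -> F) (Ls : T -> int -> F) :
  (forall t, bounded_above (Ls t)) -> bounded_above (fun i => \sum_t c t * Ls t i).
Proof.
move=> bL; suff [N NP] : exists N : int, forall t i, N < i -> Ls t i = 0.
  by exists N => i Ni; rewrite big1 // => t _; rewrite NP ?mulr0.
suff [N NP] : exists N : int, forall t, t \in enum T -> forall i, N < i -> Ls t i = 0.
  by exists N => t; apply: NP; rewrite mem_enum.
elim: (enum T) => [|t s [N NP]]; first by exists 0.
have [N' NP'] := bL t; exists (Num.max N N') => t'.
rewrite inE => /predU1P[-> i|ts i]; rewrite gt_max => /andP[Ni N'i].
  exact: NP'.
exact: NP.
Qed.

(** Remove the polynomial part [a] of [L = y / p].  What remains starts below
    [x ^- m], so [y - p * a], its product with [p], has degree below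
    [deg p - m]: it is the remainder of [y] modulo [p]. *)
Lemma size_modp_laurent p y L m : (0 < size p)%N -> bounded_above L ->
  (forall i, lact p L i = laurent_of_poly y i) ->
  (forall r, (r < m)%N -> L (- (r.+1)%:Z) = 0) ->
  (size (y %% p)%R <= (size p).-1 - m)%N.
Proof.
move=> p0 [N NP] pL L0.
pose a := \poly_(n < `|N|.+1) L n%:Z.
pose L' i := L i - laurent_of_poly a i.
have L'0 i : - m%:Z <= i -> L' i = 0.
  case: i => [n|n] hi; rewrite /L' /laurent_of_poly.
    rewrite coef_poly; case: ltnP => h; first by rewrite subrr.
    by rewrite subr0 NP //; lia.
  by rewrite subr0 (_ : Negz n = - (n.+1)%:Z) ?L0 //; lia.
pose h := y - p * a.
have hE i : lact p L' i = laurent_of_poly h i.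
  rewrite lactBr pL lact_poly /laurent_of_poly; case: i => [n|_]; last by rewrite subr0.
  by rewrite coefB.
have szh : (size h <= (size p).-1 - m)%N.
  apply/leq_sizeP => n hn; have := hE n; rewrite /laurent_of_poly => <-.
  rewrite /lact big1 // => d _; rewrite L'0 ?mulr0 //.
  by have := ltn_ord d; lia.
suff -> : y %% p = h by [].
rewrite (_ : y %% p = (h + p * a) %% p); last by rewrite subrK.
rewrite modpD modp_mulr addr0 modp_small //; apply: leq_ltn_trans szh _.
by case: (size p) p0 => // n _; rewrite ltnS leq_subr.
Qed.

(** Uniqueness of base-[p] digits: reduce modulo [p] to kill the last digit, and
    divide by [p]. *)
Lemma base_expansion_inj p (w : nat -> {poly F}) n : p != 0 ->
  (forall t, p %| w t -> w t = 0) ->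
  p ^+ n %| \sum_(t < n) w t * p ^+ (n - t.+1) -> forall t, (t < n)%N -> w t = 0.
Proof.
move=> pn wP; elim: n => [|n IH] //.
rewrite big_ord_recr /= subnn expr0 mulr1.
have sE : \sum_(t < n) w t * p ^+ (n.+1 - t.+1) = p * \sum_(t < n) w t * p ^+ (n - t.+1).
  rewrite mulr_sumr; apply: eq_bigr => t _; rewrite subSS mulrCA -exprS.
  by congr (_ * _ ^+ _); have := ltn_ord t; lia.
rewrite sE => dv; have wn : w n = 0.
  apply: wP; rewrite -(dvdp_addr _ (dvdp_mulr (\sum_(t < n) w t * p ^+ (n - t.+1)) (dvdpp p))).
  by apply: dvdp_trans dv; rewrite exprS dvdp_mulr.
move: dv; rewrite wn addr0 exprS dvdp_mul2l // => /IH hw t.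
by rewrite ltnS leq_eqVlt => /predU1P[->|/hw].
Qed.

End laurent_action.

Lemma dvdp_sum (F : fieldType) (T : finType) (P : pred T) (d : {poly F}) f :
  (forall t, P t -> d %| f t) -> d %| \sum_(t | P t) f t.
Proof.
move=> h; apply: (big_ind (fun q => d %| q)) => [||t Pt]; [exact: dvdp0| |exact: h].
by move=> x y; apply: dvdp_add.
Qed.

Section gns_kernel.
Variables (b s : nat) (S : gns b s) (ell : 'I_s -> nat) (m : nat).
Hypothesis b_prime : prime b.

Local Notation e := (gns_deg S).
Local Notation p := (gns_base S).
Local Notation I := (blk_idx e ell).

Definition gns_matrix_row (x : I) (r : nat) : 'F_b := gns_matrix S (tag x) (blk_row x) r.

Let P := \prod_j p j ^+ ell j.
Let T := (\sum_j ell j * e j)%N.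

(* [cofac j k] is [P / p_j ^ k.+1], so [num a / P] is the combination, with
   coefficients [a], of the fractions whose expansions are the matrix rows. *)
Let cofac (j : 'I_s) (k : nat) := p j ^+ (ell j - k.+1) * \prod_(i | i != j) p i ^+ ell i.
Let num (a : {ffun I -> 'F_b}) :=
  \sum_x a x *: (cofac (tag x) (tagged x).1 * gns_num S (tag x) (blk_row x)).

Lemma gns_deg_gt0 j : (0 < e j)%N.
Proof. by rewrite /gns_deg -subn1 subn_gt0 gns_base_nonconstant. Qed.

Lemma gns_base_neq0 j : p j != 0.
Proof. exact/monic_neq0/gns_base_monic. Qed.

Let cofacP j (k : 'I_(ell j)) : P = cofac j k * p j ^+ k.+1.
Proof.
rewrite /P (bigD1 j) //= /cofac mulrAC -exprD; congr (_ ^+ _ * _).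
by rewrite subnK.
Qed.

Let size_P : size P = T.+1.
Proof.
have P0 : P != 0.
  by rewrite /P prodf_seq_neq0; apply/allP => j _; rewrite expf_neq0 ?gns_base_neq0.
suff : (size P).-1 = T by rewrite -size_poly_gt0 in P0; move=> <-; rewrite prednK.
rewrite /P size_prod => [|j _]; last by rewrite expf_neq0 // gns_base_neq0.
rewrite (eq_bigr (fun j => (1 + ell j * e j)%N)) => [|j _].
  by rewrite big_split /= sum1_card -addnS addKn.
rewrite add1n mulnC -size_exp prednK // lt0n size_poly_eq0.
by rewrite expf_neq0 // gns_base_neq0.
Qed.

Let num_small (a : {ffun I -> 'F_b}) : (forall r, (r < m)%N -> \sum_x a x * gns_matrix_row x r = 0) ->
  (size (num a %% P)%R <= T - m)%N.
Proof.
move=> a0; rewrite -[T]/(T.+1.-1) -size_P.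
pose L (x : I) := gns_exp S (tag x) (tagged x).1.+1 (blk_row x).
apply: (@size_modp_laurent _ _ _ (fun i => \sum_x a x * L x i)).
- by rewrite size_P.
- apply: bounded_above_sum => x.
  by have [] := @gns_exp_spec _ _ S (tag x) (tagged x).1.+1 (blk_row x) isT.
- move=> i; rewrite lact_sum.
  transitivity (\sum_x a x * laurent_of_poly
      (cofac (tag x) (tagged x).1 * gns_num S (tag x) (blk_row x)) i).
    apply: eq_bigr => x _; rewrite (cofacP (tagged x).1) lactM -lact_poly.
    congr (_ * _); apply: lact_eqfun => i'.
    have [_ h] := @gns_exp_spec _ _ S (tag x) (tagged x).1.+1 (blk_row x) isT. exact: h.
  rewrite /laurent_of_poly /num; case: i => [n|n]; last by rewrite big1 // => x _; rewrite mulr0.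
  by rewrite coef_sum; apply: eq_bigr => x _; rewrite coefZ.
- move=> r rm; rewrite -[RHS](a0 r rm); apply: eq_bigr => x _.
  rewrite /L /gns_matrix_row /gns_matrix; congr (_ * gns_exp S _ _.+1 _ _).
  by rewrite /blk_row divnMDl ?gns_deg_gt0 // divn_small ?addn0.
Qed.

(* Modulo [p_j ^ ell_j] only coordinate [j] survives; its combinations of the
   numerators are base-[p_j] digits, and these are free modulo [p_j]. *)
Let num_inj (a : {ffun I -> 'F_b}) : P %| num a -> a = 0.
Proof.
move=> dv.
have key j (k : 'I_(ell j)) i : a (blk_mk k i) = 0.
  pose w t := if insub t is Some k then
     \sum_i a (@blk_mk _ e ell j k i) *: gns_num S j (t * e j + i)%N else 0.
  have wP t : p j %| w t -> w t = 0 /\ forall k : 'I_(ell j), val k = t -> forall i, a (blk_mk k i) = 0.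
    rewrite /w; case: insubP => [k' _ <-|/negP nk _]; last first.
      by split=> [|k' kt]; [|case: nk; rewrite -kt ltn_ord].
    move=> dvw; suff h i' : a (blk_mk k' i') = 0.
      split=> [|k'' /val_inj-> //]; by apply: big1 => i' _; rewrite h scale0r.
    apply: (@gns_num_free _ _ S j k' (fun i => a (blk_mk k' i))).
    move: dvw => /eqP h; rewrite -[RHS]h.
    rewrite (big_morph (fun q => q %% p j) (fun x y => modpD (p j) x y) (mod0p _)).
    by apply: eq_bigr => i'' _; rewrite modpZl.
  have dw : p j ^+ ell j %| \sum_(t < ell j) w t * p j ^+ (ell j - t.+1).
    have cp : coprimep (p j ^+ ell j) (\prod_(i | i != j) p i ^+ ell i).
      apply: (big_ind (coprimep (p j ^+ ell j))); rewrite ?coprimep1 //.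
        by move=> x y hx hy; rewrite coprimepMr hx.
      by move=> i' ne; rewrite coprimep_expl ?coprimep_expr // gns_base_coprime // eq_sym.
    rewrite -(Gauss_dvdpl _ cp).
    have dP : p j ^+ ell j %| P by rewrite /P (bigD1 j) //= dvdp_mulr.
    have := dvdp_trans dP dv; rewrite /num sum_blk (bigD1 j) //=.
    rewrite dvdp_addl; last first.
      apply: dvdp_sum => j' ne; apply: dvdp_sum => k' _; apply: dvdp_sum => i' _.
      rewrite -mul_polyC dvdp_mull // dvdp_mulr // /cofac dvdp_mull //.
      by rewrite (bigD1 j) 1?eq_sym //= dvdp_mulr.
    rewrite mulr_suml; congr (_ %| _); apply: eq_bigr => k' _.
    rewrite /w valK mulr_suml mulr_suml; apply: eq_bigr => i' _.
    by rewrite /cofac /blk_row /= -!scalerAl; congr (_ *: _); rewrite mulrC mulrA.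
  have w0 := base_expansion_inj (gns_base_neq0 j) (fun t h => (wP t h).1) dw.
  by apply: (wP k _).2 => //; rewrite w0 // dvdp0.
apply/ffunP => -[j [k i]]; rewrite ffunE; exact: key.
Qed.

(** If the combination [a] of rows vanishes in its first [m] columns, then
    [num a] modulo [P] has at most [T - m] coefficients; and [a] is determined by
    [num a] modulo [P].  Subtraction is truncated, so the kernel is trivial when
    [T <= m]. *)
Lemma card_gns_kernel :
  (#|[set a : {ffun I -> 'F_b} |
      [forall r : 'I_m, (\sum_x a x * gns_matrix_row x r == 0)%R]]| <= b ^ (T - m))%N.
Proof.
set K := [set a | _].
pose h (a : {ffun I -> 'F_b}) : {ffun 'I_(T - m) -> 'F_b} :=
  [ffun n : 'I_(T - m) => (num a %% P)`_n].
have K0 a : a \in K -> (size (num a %% P)%R <= T - m)%N.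
  rewrite inE => /forallP a0; apply: num_small => r rm.
  exact: (eqP (a0 (Ordinal rm))).
have numB a a' : num (a - a') = num a - num a'.
  by rewrite /num -sumrB; apply: eq_bigr => x _; rewrite !ffunE scalerBl.
have hK : {in K &, injective h}.
  move=> a a' aK a'K /ffunP hE; apply/eqP; rewrite -subr_eq0; apply/eqP/num_inj.
  rewrite numB /dvdp modpD modpN subr_eq0; apply/eqP/polyP => n.
  case: (ltnP n (T - m)) => nT; last first.
    by rewrite !nth_default // (leq_trans _ nT) // K0.
  by have := hE (Ordinal nT); rewrite !ffunE.
rewrite -(card_in_imset hK) (leq_trans (max_card _)) //.
by rewrite card_ffun card_Fp // card_ord.
Qed.

End gns_kernel.

(** * Scrambling finitely many digits *)

Section level.
Variables (F : finFieldType) (e K : nat).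
Implicit Types a : 'I_K -> 'rV[F]_e.

(** One plus the index of the last nonzero block, and 0 for the zero vector: the
    block form of the Niederreiter-Rosenbloom-Tsfasman weight. *)
Definition level a : nat := \max_(k | a k != 0) k.+1.

Lemma level_gt a k : a k != 0 -> (k < level a)%N.
Proof. exact: (@leq_bigmax_cond _ (fun k => a k != 0) (fun k : 'I_K => k.+1)). Qed.

Lemma level_le a n : reflect (forall k : 'I_K, (n <= k)%N -> a k = 0) (level a <= n)%N.
Proof.
apply: (iffP idP) => [an k nk|h].
  apply/eqP; apply: contraTT (nk) => /level_gt; rewrite -ltnNge => h.
  exact: leq_trans h an.
apply/bigmax_leqP => k ak; rewrite ltnNge; apply: contra ak => nk.
exact/eqP/h.
Qed.

Lemma level_max a : (level a <= K)%N.
Proof. by apply/level_le => k Kk; have := ltn_ord k; rewrite ltnNge Kk. Qed.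

Lemma level_top a : (0 < level a)%N -> exists k, a k != 0 /\ k.+1 = level a.
Proof.
rewrite /level => h; have [k ak] : exists k, a k != 0.
  apply/existsP; apply: contraTT h => /existsPn h; rewrite big1 // => k.
  by move=> ak; have := h k; rewrite ak.
have [k' ak' ->] := @eq_bigmax_cond _ (fun k => a k != 0) (fun k : 'I_K => k.+1)
  (introT card_gt0P (ex_intro _ k ak)).
by exists k'.
Qed.

Lemma level_eq a (k : 'I_K) : a k != 0 -> (forall l : 'I_K, (k < l)%N -> a l = 0) -> level a = k.+1.
Proof.
move=> ak h; apply/eqP; rewrite eqn_leq level_gt // andbT; apply/level_le => l; exact: h.
Qed.

Lemma level_eqfun a a' : a =1 a' -> level a = level a'.
Proof. by move=> e'; apply: eq_bigl => k; rewrite e'. Qed.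

Lemma card_level_le n : (n <= K)%N ->
  #|[set a : {ffun 'I_K -> 'rV[F]_e} | (level a <= n)%N]| = (#|F| ^ (n * e))%N.
Proof.
move=> nK.
rewrite (_ : [set a : {ffun 'I_K -> 'rV[F]_e} | _] =
  [set a in family (fun k : 'I_K => if (k < n)%N then predT else pred1 (0 : 'rV[F]_e))]); last first.
  apply/finset.setP => a; rewrite !inE; apply/level_le/familyP => h k.
    by case: ltnP => // nk; rewrite inE h.
  by move=> nk; have := h k; rewrite ltnNge nk /= inE => /eqP.
rewrite cardsE card_family foldrE big_map big_enum /=.
rewrite (eq_bigr (fun k : 'I_K => if (k < n)%N then (#|F| ^ e)%N else 1%N)).
  rewrite -big_mkcond -(big_ord_widen _ (fun=> (#|F| ^ e)%N) nK) prod_nat_const card_ord.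
  by rewrite -expnM mulnC.
move=> k _; case: ltnP => _; last by rewrite card1.
by rewrite cardT -cardT card_mx mul1n.
Qed.

Lemma card_level n : (0 < n <= K)%N ->
  (#|[set a : {ffun 'I_K -> 'rV[F]_e} | level a == n]| + #|F| ^ (n.-1 * e) =
   #|F| ^ (n * e))%N.
Proof.
move=> /andP[n0 nK]; rewrite -(card_level_le nK) -(card_level_le (n := n.-1)); last first.
  exact: leq_trans (leq_pred n) nK.
rewrite -cardsUI [X in (_ + X)%N](_ : _ = 0%N) ?addn0.
  apply: eq_card => a; rewrite !inE; case: (n) n0 => // n' _ /=.
  by rewrite (leq_eqVlt _ n'.+1) ltnS.
apply/eqP; rewrite cards_eq0; apply/eqP/finset.setP => a; rewrite !inE.
by apply/negP => /andP[/eqP -> ]; case: (n) n0 => // n' _ /=; rewrite ltnn.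
Qed.

End level.

Section one_coordinate.
Variables (F : finFieldType) (e K : nat).
Local Notation blk_matrix := {ffun 'I_K * 'I_K -> 'M[F]_e}.
Implicit Types (om : blk_matrix) (a : 'I_K -> 'rV[F]_e).

Definition blk_lower om : bool :=
  [forall k, (om (k, k) \in unitmx) && [forall l : 'I_K, (k < l)%N ==> (om (k, l) == 0)]].

Lemma blk_lowerP om : reflect
  ((forall k, om (k, k) \in unitmx) /\ forall k l : 'I_K, (k < l)%N -> om (k, l) = 0)
  (blk_lower om).
Proof.
apply: (iffP forallP) => [h|[h1 h2] k].
  split=> [k|k l kl]; have /andP[// _ /forallP/(_ l)] := h k.
  by rewrite kl => /eqP.
by rewrite h1; apply/forallP => l; apply/implyP => kl; rewrite h2.
Qed.

(** Row vector times block matrix: this is how the transpose of a scrambling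
    matrix acts on dual vectors. *)
Definition blk_lmul a om (l : 'I_K) : 'rV[F]_e := \sum_k a k *m om (k, l).

(** The last nonzero block is multiplied by an invertible diagonal block. *)
Lemma blk_lmul_level a om : blk_lower om -> level (blk_lmul a om) = level a.
Proof.
move=> /blk_lowerP[omu oml].
have above (l : 'I_K) : (level a <= l)%N -> blk_lmul a om l = 0.
  move=> al; apply: big1 => k _; case: (eqVneq (a k) 0) => [->|ak]; first by rewrite mul0mx.
  by rewrite oml ?mulmx0 // (leq_trans (level_gt ak)).
case: (posnP (level a)) => [a0|/level_top[k [ak /esym aE]]].
  by rewrite a0; apply/eqP; rewrite -leqn0; apply/level_le => l _; rewrite above ?a0.
rewrite aE; apply: level_eq => [|l kl]; last by apply: above; rewrite aE.
rewrite /blk_lmul (bigD1 k) //= big1 ?addr0 => [|k' ne].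
  by apply: contra ak => /eqP h; rewrite -[a k](mulmxK (omu k)) h mul0mx.
have [kk'|k'k|/val_inj kk'] := ltngtP k k'; last by rewrite kk' eqxx in ne.
  have /level_le : (level a <= k.+1)%N by rewrite aE.
  by move=> -> //; rewrite mul0mx.
by rewrite oml // mulmx0.
Qed.

Lemma row_right_inverse (x : 'rV[F]_e) : x != 0 -> exists y : 'cV[F]_e, x *m y = 1%:M.
Proof.
move=> nx; exists (pinvmx x); apply: mulmxVp.
by rewrite /row_free rank_rV nx.
Qed.

Lemma row_transitive (x y : 'rV[F]_e) : x != 0 -> y != 0 ->
  exists2 B : 'M[F]_e, B \in unitmx & x *m B = y.
Proof.
move=> nx ny; have [z xz] := row_right_inverse nx.
have xy : x *m (z *m y) = y by rewrite mulmxA xz mul1mx.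
have [|B uB /esym xB] := @complete_unitmx _ _ _ x (z *m y).
  by rewrite xy !rank_rV nx ny.
by exists B; rewrite // xB xy.
Qed.

(** Right multiplication by an invertible matrix [B] sends the last nonzero block of
    [a] to that of [a'], and a translation in the row of blocks that meets the
    last nonzero block of [kap] then adjusts the earlier blocks.  Since [h] is injective, the images of [kap]
    under a random matrix have equal probabilities on a given level. *)
Lemma blk_lmul_transitive kap a a' : level a = level kap -> level a' = level kap ->
  exists h : blk_matrix -> blk_matrix, [/\ injective h, forall om, blk_lower om -> blk_lower (h om) &
    forall om, blk_lower om -> blk_lmul kap om =1 a -> blk_lmul kap (h om) =1 a'].
Proof.
move=> la la'; case: (posnP (level kap)) => [k0|kpos].
  have z (c : 'I_K -> 'rV[F]_e) : level c = 0%N -> forall k, c k = 0.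
    by move=> c0 k; apply/eqP; apply: contraTT isT => /level_gt; rewrite c0.
  exists id; split=> // om omB omE k; rewrite omE (z a) ?la // (z a') ?la' //.
have [t [kt tE]] := level_top kpos.
have [t1 [at1 /esym]] : exists k, a k != 0 /\ k.+1 = level a by apply: level_top; rewrite la.
rewrite la -tE => -[/val_inj tt1]; subst t1.
have [t1 [a't1 /esym]] : exists k, a' k != 0 /\ k.+1 = level a' by apply: level_top; rewrite la'.
rewrite la' -tE => -[/val_inj tt1]; subst t1.
have [p kp] := row_right_inverse kt.
have [B uB aB] := row_transitive at1 a't1.
pose N (k l : 'I_K) := if (k == t) && (l < t)%N then p *m (a' l - a l *m B) else 0.
exists (fun om => [ffun x => om x *m B + N x.1 x.2]); split.
- move=> om1 om2 /ffunP h; apply/ffunP => x; have := h x; rewrite !ffunE.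
  by move/addIr/(can_inj (mulmxK uB)).
- move=> om /blk_lowerP[omu oml]; apply/blk_lowerP; split=> [k|k l kl].
    rewrite ffunE /N /=; case: andP => [[/eqP -> ]|_]; first by rewrite ltnn.
    by rewrite addr0 unitmx_mul omu.
  rewrite ffunE /N /= oml // mul0mx add0r; case: andP => [[/eqP kE lt]|//].
  by move: kl; rewrite kE ltnNge ltnW.
- move=> om /blk_lowerP[omu oml] omE l; rewrite /blk_lmul.
  under eq_bigr do rewrite ffunE /= mulmxDr mulmxA.
  rewrite big_split /= -mulmx_suml -/(blk_lmul kap om l) omE.
  rewrite (bigD1 t) //= [X in _ + (_ + X)]big1 ?addr0 => [|k ne]; last first.
    by rewrite /N (negbTE ne) mulmx0.
  rewrite /N eqxx /=; have [lt|tl|/val_inj ->] := ltngtP l t.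
  + by rewrite mulmxA kp mul1mx addrC subrK.
  + have /level_le h : (level a <= t.+1)%N by rewrite la tE.
    have /level_le h' : (level a' <= t.+1)%N by rewrite la' tE.
    by rewrite h // h' // mul0mx mulmx0 addr0.
  + by rewrite mulmx0 addr0 aB.
Qed.

End one_coordinate.

Section finite_scrambling.
Variables (F : finFieldType) (s K : nat) (e : 'I_s -> nat).
Local Notation idx := (blk_idx e (fun=> K)).
Local Notation G := {ffun idx -> F}.

(** The leading [K] by [K] blocks of all scrambling matrices, those above the
    diagonal included. *)
Definition blk_matrices := {dffun forall j : 'I_s, {ffun 'I_K * 'I_K -> 'M[F]_(e j)}}.
Implicit Types (om : blk_matrices) (v kap a : G).

Definition scramblers : {set blk_matrices} := [set om : blk_matrices | [forall j, blk_lower (om j)]].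

Definition rows a j (k : 'I_K) : 'rV[F]_(e j) := \row_i a (@blk_mk _ e (fun=> K) j k i).

Definition scramble_act om v : G := [ffun x : idx =>
  \sum_l \sum_i om (tag x) ((tagged x).1, l) (tagged x).2 i * v (@blk_mk _ e (fun=> K) (tag x) l i)].

Definition scramble_dual om kap : G := [ffun x : idx =>
  blk_lmul (rows kap (tag x)) (om (tag x)) (tagged x).1 0 (tagged x).2].

Lemma scramble_actD om v v' : scramble_act om (v + v') = scramble_act om v + scramble_act om v'.
Proof.
apply/ffunP => x; rewrite !ffunE -big_split; apply: eq_bigr => l _.
by rewrite -big_split; apply: eq_bigr => i _; rewrite ffunE mulrDr.
Qed.

Lemma dot_scramble_act om kap v : dot kap (scramble_act om v) = dot (scramble_dual om kap) v.
Proof.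
rewrite /dot !sum_blk; apply: eq_bigr => j _.
transitivity (\sum_k \sum_i \sum_l \sum_i' kap (blk_mk k i) * om j (k, l) i i' *
    v (@blk_mk _ e (fun=> K) j l i')).
  apply: eq_bigr => k _; apply: eq_bigr => i _; rewrite ffunE mulr_sumr.
  by apply: eq_bigr => l _; rewrite mulr_sumr; apply: eq_bigr => i' _; rewrite mulrA.
under eq_bigr do rewrite exchange_big; rewrite exchange_big; apply: eq_bigr => l _ /=.
under eq_bigr do rewrite exchange_big; rewrite exchange_big; apply: eq_bigr => i' _ /=.
rewrite ffunE /= /blk_lmul summxE mulr_suml; apply: eq_bigr => k _.
rewrite mxE mulr_suml; apply: eq_bigr => i _.
by rewrite mxE.
Qed.

Lemma rows_scramble_dual om kap j : rows (scramble_dual om kap) j =1 blk_lmul (rows kap j) (om j).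
Proof. by move=> k; apply/rowP => i; rewrite mxE ffunE. Qed.

Lemma rows_inj a a' : (forall j, rows a j =1 rows a' j) -> a = a'.
Proof.
move=> h; apply/ffunP => -[j [k i]].
by have /rowP/(_ i) := h j k; rewrite !mxE.
Qed.

Variable kap : G.
Let lev j := level (rows kap j).

Definition same_level : {set G} := [set a : G | [forall j, level (rows a j) == lev j]].

Lemma scramble_dual_level om : om \in scramblers -> scramble_dual om kap \in same_level.
Proof.
rewrite !inE => /forallP omB; apply/forallP => j.
by rewrite (level_eqfun (rows_scramble_dual om kap j)) blk_lmul_level.
Qed.

Definition fiber a : {set blk_matrices} := [set om in scramblers | scramble_dual om kap == a].

(** By symmetry all fibers have the same cardinality, so the image of [kap] under
    a uniform scrambler is uniform on [same_level]. *)
Lemma card_fiber_le a a' : a \in same_level -> a' \in same_level ->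
  (#|fiber a| <= #|fiber a'|)%N.
Proof.
rewrite !inE => /forallP la /forallP la'.
have /fin_all_exists[h hP] j := blk_lmul_transitive (eqP (la j)) (eqP (la' j)).
pose H om : blk_matrices := [ffun j => h j (om j)].
have Hinj : injective H.
  move=> om om' /ffunP hE; apply/ffunP => j; have := hE j; rewrite !ffunE.
  by have [hi _ _] := hP j; apply: hi.
rewrite -(card_imset _ Hinj); apply/subset_leq_card/fintype.subsetP => _ /imsetP[om + ->].
rewrite !inE => /andP[/forallP omB /eqP omE]; apply/andP; split.
  by apply/forallP => j; rewrite ffunE; have [_ + _] := hP j; apply.
apply/eqP/rows_inj => j k; rewrite rows_scramble_dual ffunE.
have [_ _ ->] // := hP j.
by move=> k'; rewrite -rows_scramble_dual omE.
Qed.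

Lemma card_scramblers_ge a : a \in same_level ->
  (#|same_level| * #|fiber a| <= #|scramblers|)%N.
Proof.
move=> la; rewrite -[X in (_ <= X)%N]sum1_card.
rewrite (partition_big (fun om => scramble_dual om kap) (mem same_level)) /=;
  last exact: scramble_dual_level.
rewrite -sum_nat_const; apply: leq_sum => a' la'.
rewrite sum1_card (leq_trans (card_fiber_le la la')) //.
by apply/subset_leq_card/fintype.subsetP => om; rewrite /fiber inE => h; exact: h.
Qed.

Lemma card_same_level :
  (\prod_(j | (0 < lev j)%N) (#|F| ^ (lev j * e j) - #|F| ^ ((lev j).-1 * e j)) <=
   #|same_level|)%N.
Proof.
pose D := {dffun forall j : 'I_s, {ffun 'I_K -> 'rV[F]_(e j)}}.
pose f (d : D) : G := [ffun x : idx => d (tag x) (tagged x).1 0 (tagged x).2].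
have fE d j : rows (f d) j =1 d j by move=> k; apply/rowP => i; rewrite mxE ffunE.
have finj : injective f.
  move=> d d' ff; apply/ffunP => j; apply/ffunP => k.
  by rewrite -fE ff fE.
pose Q := [set d : D | d \in family (fun j (c : {ffun 'I_K -> 'rV[F]_(e j)}) => level c == lev j)].
apply: (@leq_trans #|Q|); last first.
  rewrite -(card_imset _ finj); apply/subset_leq_card/fintype.subsetP => _ /imsetP[d + ->].
  rewrite !inE => /familyP dl; apply/forallP => j.
  by rewrite (level_eqfun (fE d j)); apply: dl.
rewrite cardsE card_family foldrE big_map big_enum /= [X in (X <= _)%N]big_mkcond.
apply: leq_prod => j _; case: posnP => [l0|lpos].
  apply/card_gt0P; exists 0; rewrite unfold_in l0 -leqn0.
  by apply/level_le => k _; rewrite ffunE.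
have lK : (0 < lev j <= K)%N by rewrite lpos level_max.
rewrite leq_subLR -(card_level F (e j) lK) addnC leq_add2l.
by apply/subset_leq_card/fintype.subsetP => c; rewrite inE.
Qed.

Variables (m : nat) (c : 'I_s -> nat -> nat -> F).
Hypothesis cker : forall ell : 'I_s -> nat,
  (#|[set a : {ffun blk_idx e ell -> F} |
      [forall r : 'I_m, (\sum_x a x * c (tag x) (blk_row x) r == 0)%R]]| <=
   #|F| ^ (\sum_j ell j * e j - m))%N.

Definition gen_mul (n : {ffun 'I_m -> F}) : G :=
  [ffun x : idx => \sum_(r < m) c (tag x) (blk_row x) r * n r].

Definition gen_mulT a : {ffun 'I_m -> F} :=
  [ffun r : 'I_m => \sum_x a x * c (tag x) (blk_row x) r].

Lemma dot_gen_mul a n : dot a (gen_mul n) = dot (gen_mulT a) n.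
Proof.
rewrite /dot; under eq_bigr do rewrite ffunE mulr_sumr.
rewrite exchange_big; apply: eq_bigr => r _; rewrite ffunE mulr_suml.
by apply: eq_bigr => x _; rewrite mulrA.
Qed.

Let T := (\sum_j lev j * e j)%N.

(* A vector with the levels of [kap] is determined by its first [lev j] blocks. *)
Let sub_row (a : G) : {ffun blk_idx e lev -> F} :=
  [ffun x : blk_idx e lev =>
    a (@blk_mk _ e (fun=> K) (tag x) (widen_ord (level_max (rows kap (tag x))) (tagged x).1)
         (tagged x).2)].

Let sub_row_sum (a : G) r : a \in same_level ->
  \sum_x sub_row a x * c (tag x) (blk_row x) r = \sum_x a x * c (tag x) (blk_row x) r.
Proof.
rewrite inE => /forallP la; rewrite !sum_blk; apply: eq_bigr => j _.
pose f k := if insub k is Some k' then \sum_i a (@blk_mk _ e (fun=> K) j k' i)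
    * c j (k' * e j + i)%N r else 0.
rewrite [RHS](eq_bigr (fun k : 'I_K => f k)) => [|k _]; last by rewrite /f valK.
rewrite (bigID (fun k : 'I_K => (k < lev j)%N)) /= [X in _ + X]big1 ?addr0 => [|k]; last first.
  rewrite -leqNgt /f valK => lk; apply: big1 => i _.
  have /level_le/(_ k lk)/rowP/(_ i) : (level (rows a j) <= lev j)%N by rewrite (eqP (la j)).
  by rewrite !mxE => ->; rewrite mul0r.
rewrite -(big_ord_widen _ f (level_max (rows kap j))); apply: eq_bigr => k _.
rewrite /f insubT; first exact: leq_trans (ltn_ord k) (level_max (rows kap j)).
move=> kK; apply: eq_bigr => i _; rewrite ffunE; congr (a (blk_mk _ _) * _); exact: val_inj.
Qed.

(** For [T <= m] the kernel is trivial and the truncated [T - m] says only that it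
    has at most one element; [kap != 0] then excludes this element, which is
    zero, from the level of [kap]. *)
Lemma card_dual_kernel : kap != 0 ->
  (#|[set a in same_level | (gen_mulT a == 0)%R]| * #|F| ^ m <= #|F| ^ T)%N.
Proof.
move=> k0; set U := [set a in same_level | _].
set Ker := [set a : {ffun blk_idx e lev -> F} |
      [forall r : 'I_m, (\sum_x a x * c (tag x) (blk_row x) r == 0)%R]].
have sub_inj : {in same_level &, injective sub_row}.
  move=> a a'; rewrite !inE => /forallP la /forallP la' /ffunP aa'; apply: rows_inj => j k.
  have [kl|lk] := ltnP k (lev j); last first.
    have /level_le -> // : (level (rows a j) <= lev j)%N by rewrite (eqP (la j)).
    by have /level_le -> // : (level (rows a' j) <= lev j)%N by rewrite (eqP (la' j)).
  apply/rowP => i; rewrite !mxE; have := aa' (@blk_mk _ e lev j (Ordinal kl) i).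
  rewrite !ffunE /= (_ : widen_ord _ _ = k) //; exact: val_inj.
have UK : sub_row @: U \subset Ker.
  apply/fintype.subsetP => _ /imsetP[a + ->]; rewrite !inE => /andP[la /eqP/ffunP a0].
  apply/forallP => r; rewrite sub_row_sum ?inE //.
  by have := a0 r; rewrite !ffunE => ->.
have cU : (#|U| <= #|Ker|)%N.
  rewrite -(card_in_imset (f := sub_row)); first exact: subset_leq_card.
  by move=> a a'; rewrite !inE => /andP[la _] /andP[la' _]; apply: sub_inj; rewrite inE.
have F0 : (0 < #|F|)%N by apply/card_gt0P; exists 0.
have [Tm|mT] := leqP T m; last first.
  apply: (@leq_trans (#|F| ^ (T - m) * #|F| ^ m)).
    by rewrite leq_mul2r (leq_trans cU) ?orbT //; apply: cker.
  by rewrite -expnD subnK // ltnW.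
suff -> : U = finset.set0 by rewrite cards0.
apply/finset.setP => a; rewrite [RHS]inE; apply/negP => aU.
have : sub_row a \in Ker by apply: (fintype.subsetP UK); apply: imset_f.
have z : [ffun=> 0] \in Ker.
  rewrite inE; apply/forallP => r; rewrite big1 // => x _; by rewrite ffunE mul0r.
have /card_le1_eqP h : (#|Ker| <= 1)%N.
  by rewrite (leq_trans (cker _)) // (_ : (_ - m = 0)%N) ?expn0 //; apply/eqP.
move=> /h/(_ z) a0; case/negP: k0; apply/eqP.
move: aU; rewrite !inE => /andP[/forallP la _].
apply: rows_inj => j k; apply/eqP; apply: contraT.
rewrite (_ : rows 0 j k = 0); last by apply/rowP => i; rewrite !mxE ffunE.
move=> /level_gt lk; have lpos : (0 < lev j)%N by apply: leq_ltn_trans lk.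
have [t [at0 tE]] : exists t, rows a j t != 0 /\ t.+1 = level (rows a j).
  by apply: level_top; rewrite (eqP (la j)).
case/negP: at0; apply/eqP/rowP => i; rewrite !mxE.
have tl : (t < lev j)%N by rewrite tE (eqP (la j)).
have /ffunP/(_ (@blk_mk _ e lev j (Ordinal tl) i)) := a0; rewrite !ffunE /=.
by rewrite (_ : widen_ord _ _ = t) //; apply: val_inj.
Qed.

Hypothesis e_gt0 : forall j, (0 < e j)%N.

(** The image of [kap] is uniform on its level, which has at least
    [q ^ T * \prod_j (1 - q ^- e_j)] elements, at most [q ^ (T - m)] of
    which are orthogonal to the code. *)
Lemma dual_probability (R : realFieldType) : kap != 0 ->
  #|[set om in scramblers | (gen_mulT (scramble_dual om kap) == 0)%R]|%:R * #|F|%:R ^+ m <=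
  #|scramblers|%:R * \prod_j (1 - (#|F|%:R ^+ e j)^-1)^-1 :> R.
Proof.
move=> k0; set q : R := #|F|%:R.
set U := [set a in same_level | gen_mulT a == 0].
set N := #|_|.
have F1 : (1 < #|F|)%N by exact: card_finNzRing_gt1.
have q1 : 1 < q by rewrite ltr1n F1.
have q0 : 0 < q by apply: lt_trans q1.
have NU : (#|same_level| * N <= #|U| * #|scramblers|)%N.
  have -> : N = (\sum_(a in U) #|fiber a|)%N.
    rewrite /N -sum1_card (partition_big (fun om => scramble_dual om kap) (mem U)) /=.
      apply: eq_bigr => a aU; rewrite -sum1_card; apply: eq_bigl => om.
      rewrite !inE; case: (scramble_dual om kap =P a) => [->|]; rewrite ?andbF //.
      by move: aU; rewrite inE => /andP[_ ->]; rewrite !andbT.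
    move=> om; rewrite !inE => /andP[omB ->]; rewrite andbT.
    by have := @scramble_dual_level om; rewrite !inE; apply.
  rewrite big_distrr /= -sum_nat_const; apply: leq_sum => a.
  by rewrite inE => /andP[la _]; apply: card_scramblers_ge.
pose pr := \prod_j (1 - (q ^+ e j)^-1).
have fac j : 0 < 1 - (q ^+ e j)^-1 <= 1.
  have qe : 1 < q ^+ e j by rewrite exprn_egt1 // -lt0n.
  have qe0 : 0 < q ^+ e j by apply: lt_trans qe.
  by rewrite subr_gt0 invf_lt1 // qe gerBl invr_ge0 ltW.
have pr0 : 0 < pr by apply: prodr_gt0 => j _; have /andP[] := fac j.
have Ul : q ^+ T * pr <= #|same_level|%:R.
  apply: le_trans (_ : (\prod_(j | (0 < lev j)%N)
      (#|F| ^ (lev j * e j) - #|F| ^ ((lev j).-1 * e j)))%N%:R <= _); last first.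
    by rewrite ler_nat card_same_level.
  rewrite natr_prod /T -prodrXr /pr -big_split /= [X in _ <= X]big_mkcond.
  apply: ler_prod => j _; have /andP[f0 f1] := fac j.
  rewrite mulr_ge0 ?exprn_ge0 ?(ltW f0) ?(ltW q0) //=.
  case: posnP => [->|lpos]; first by rewrite mul0n mul1r.
  rewrite natrB; last first.
    by rewrite leq_exp2l ?leq_mul2r ?leq_pred ?orbT // F1.
  rewrite !natrX -/q mulrBr mulr1 lerB //.
  have -> : (lev j * e j = (lev j).-1 * e j + e j)%N by rewrite -mulSnr prednK.
  rewrite exprD mulfK //.
  by rewrite expf_neq0 // gt_eqF.
have UT : #|U|%:R * q ^+ m <= q ^+ T.
  by have := card_dual_kernel k0; rewrite -(ler_nat R) natrM !natrX.
have NUR : #|same_level|%:R * N%:R <= #|U|%:R * #|scramblers|%:R :> R.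
  by rewrite -!natrM ler_nat.
rewrite prodfV -/pr ler_pdivlMr // mulrAC.
have qT : 0 < q ^+ T by rewrite exprn_gt0.
rewrite -(ler_pM2l qT).
have -> : q ^+ T * (N%:R * pr * q ^+ m) = (q ^+ T * pr * N%:R) * q ^+ m by ring.
have h1 : q ^+ T * pr * N%:R <= #|U|%:R * #|scramblers|%:R.
  by apply: le_trans NUR; rewrite ler_wpM2r.
have h2 := ler_wpM2r (ltW (exprn_gt0 m q0)) h1.
apply: le_trans h2 _; rewrite mulrAC.
by rewrite ler_wpM2r.
Qed.

End finite_scrambling.

Section gain.
Variables (R : realFieldType) (F : finFieldType) (s K m : nat) (e : 'I_s -> nat).
Variable c : 'I_s -> nat -> nat -> F.
Hypothesis cker : forall ell : 'I_s -> nat,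
  (#|[set a : {ffun blk_idx e ell -> F} |
      [forall r : 'I_m, (\sum_x a x * c (tag x) (blk_row x) r == 0)%R]]| <=
   #|F| ^ (\sum_j ell j * e j - m))%N.
Hypothesis e_gt0 : forall j, (0 < e j)%N.
Local Notation G := {ffun blk_idx e (fun=> K) -> F}.
Local Notation q := (#|F|%:R : R).

Lemma gen_mulB (n n' : {ffun 'I_m -> F}) : gen_mul K e c (n - n') = gen_mul K e c n - gen_mul K e c n'.
Proof.
apply/ffunP => x; rewrite !ffunE -sumrB; apply: eq_bigr => r _.
by rewrite !ffunE mulrBr.
Qed.

Lemma scramble_actB (om : blk_matrices F K e) v v' : scramble_act om (v - v') =
  scramble_act om v - scramble_act om v'.
Proof. by apply/(addIr (scramble_act om v')); rewrite -scramble_actD !subrK. Qed.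

(** Poisson summation for each scrambler, averaged over the scramblers: the
    weight of [k != 0] is counted with the probability that [k] becomes dual,
    and the weight of 0 vanishes with the mean of [g]. *)
Lemma finite_gain (g : G -> R) : \sum_x g x = 0 ->
  \sum_(om in scramblers F K e) \sum_(dl : G)
     (\sum_(n : {ffun 'I_m -> F}) g (scramble_act om (gen_mul K e c n) + dl)) ^+ 2 <=
  \prod_j (1 - (q ^+ e j)^-1)^-1 * q ^+ m * #|scramblers F K e|%:R * \sum_x g x ^+ 2.
Proof.
move=> g0; set Cst := \prod_j _.
have q1 : 1 < q by rewrite ltr1n card_finNzRing_gt1.
have q0 : 0 < q by apply: lt_trans q1.
have cV : #|{ffun 'I_m -> F}|%:R = q ^+ m :> R by rewrite card_ffun card_ord natrX.
pose W : R := #|{ffun blk_idx e (fun=> K) -> F}|%:R * (1 - q^-1).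
have W0 : 0 < W.
  rewrite mulr_gt0 ?subr_gt0 ?invf_lt1 // ltr0n.
  by apply/card_gt0P; exists 0.
have inner om : (\sum_(dl : G)
    (\sum_(n : {ffun 'I_m -> F}) g (scramble_act om (gen_mul K e c n) + dl)) ^+ 2) * W =
    q ^+ m * q ^+ m * \sum_(k | gen_mulT m c (scramble_dual om k) == 0) spectral g k.
  transitivity (\sum_(n : {ffun 'I_m -> F}) \sum_(n' : {ffun 'I_m -> F}) \sum_x
      g x * g (x + scramble_act om (gen_mul K e c n')) * W).
    rewrite mulr_suml.
    transitivity (\sum_(n : {ffun 'I_m -> F}) \sum_(n' : {ffun 'I_m -> F}) \sum_dl
        g (scramble_act om (gen_mul K e c n) + dl) * g (scramble_act om (gen_mul K e c n') + dl) * W).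
      under eq_bigr => dl _ do rewrite expr2 mulr_suml mulr_suml.
      rewrite exchange_big; apply: eq_bigr => n _.
      under eq_bigr => dl _ do rewrite mulr_sumr mulr_suml.
      by rewrite exchange_big.
    apply: eq_bigr => n _; rewrite (reindex_inj (addIr n)); apply: eq_bigr => n' _.
    rewrite (reindex_inj (addrI (- scramble_act om (gen_mul K e c n)))); apply: eq_bigr => dl _.
    rewrite addrA subrr add0r; congr (_ * g _ * _).
    have -> : scramble_act om (gen_mul K e c (n' + n)) =
        scramble_act om (gen_mul K e c n') + scramble_act om (gen_mul K e c n).
      by apply/eqP; rewrite -subr_eq -scramble_actB -gen_mulB addrK.
    by rewrite -addrA addNKr addrC.
  rewrite sumr_const -[LHS]mulr_natl cV -mulrA; congr (_ * _).
  have adjP k (n : {ffun 'I_m -> F}) : dot k (scramble_act om (gen_mul K e c n)) =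
    dot (gen_mulT m c (scramble_dual om k)) n.
    by rewrite dot_scramble_act dot_gen_mul.
  rewrite -cV -(real_poisson adjP g0) mulr_suml.
  by apply: eq_bigr => n _; rewrite mulr_suml.
rewrite -(ler_pM2r W0) mulr_suml.
under eq_bigr do rewrite inner.
rewrite -mulr_sumr.
have -> : \sum_(om in scramblers F K e) \sum_(k | gen_mulT m c (scramble_dual om k) == 0) spectral g k =
    \sum_k #|[set om in scramblers F K e | (gen_mulT m c (scramble_dual om k) == 0)%R]|%:R *
        spectral g k.
  under eq_bigr do rewrite big_mkcond.
  rewrite exchange_big; apply: eq_bigr => k _ /=.
  rewrite -big_mkcondr sumr_const mulr_natl; congr (_ *+ _).
  by apply: eq_card => om; rewrite inE.
rewrite -[leRHS]mulrA /W (real_plancherel g0) !mulr_sumr.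
apply: ler_sum => k _.
case: (eqVneq k 0) => [->|k0]; first by rewrite spectral0 // !mulr0.
have := dual_probability cker e_gt0 R k0; rewrite -/Cst => h.
have := ler_wpM2r (mulr_ge0 (exprn_ge0 m (ltW q0)) (spectral_ge0 g k)) h.
by congr (_ <= _); ring.
Qed.

End gain.

Section digit_shift.
Variables (F : finFieldType) (s K : nat) (e : 'I_s -> nat).
Local Notation idx := (blk_idx e (fun=> K)).
Local Notation G := {ffun idx -> F}.

Definition config_point (w : blk_matrices F K e * G) (v : G) : G := scramble_act w.1 v + w.2.

Definition one_digit (x : idx) (t : F) : G := [ffun y => if y == x then t else 0].

Lemma blk_mk_eq j (k k' : 'I_K) (i i' : 'I_(e j)) :
  (@blk_mk _ e (fun=> K) j k i == @blk_mk _ e (fun=> K) j k' i') = (k == k') && (i == i').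
Proof. by rewrite /blk_mk eq_Tagged /= xpair_eqE. Qed.

(** As [h] preserves the uniform distribution on configurations, the digit [x] of
    the first point is uniform given its other digits and the second point.  The
    map adds a constant to one entry of the scrambling matrix below the diagonal
    blocks, in a column where the points differ, and undoes the effect on the
    second point by a change of the shift. *)
Lemma digit_shift_pair (v v' : G) (x : idx) (l : 'I_K) (i : 'I_(e (tag x))) (t : F) :
  (l < (tagged x).1)%N ->
    v (@blk_mk _ e (fun=> K) (tag x) l i) != v' (@blk_mk _ e (fun=> K) (tag x) l i) ->
  exists h : blk_matrices F K e * G -> blk_matrices F K e * G,
    [/\ injective h, forall w, w.1 \in scramblers F K e -> (h w).1 \in scramblers F K e &
     forall w, config_point (h w) v = config_point w v + one_digit x t /\
         config_point (h w) v' = config_point w v'].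
Proof.
case: x i => j [k0 i0] /= i lk; set y := blk_mk l i; set x : idx := existT _ _ _ => vy.
pose r := t / (v y - v' y).
pose N j' (kl : 'I_K * 'I_K) : 'M[F]_(e j') := \matrix_(a, b)
  (if (@blk_mk _ e (fun=> K) j' kl.1 a == x) && (@blk_mk _ e (fun=> K) j' kl.2 b == y) then r else 0).
pose h (w : blk_matrices F K e * G) : blk_matrices F K e * G :=
  (([ffun j' => [ffun kl => w.1 j' kl + N j' kl]] : blk_matrices F K e), w.2 - one_digit x (r * v' y)).
have N0 j' (k l' : 'I_K) : (k <= l')%N -> N j' (k, l') = 0.
  move=> kl; apply/matrixP => a b; rewrite !mxE; case: ifP => // /andP[/eqP kx /eqP ly].
  have := f_equal tag kx => /= jj'; subst j'.
  have := eqxx x; rewrite -{1}kx blk_mk_eq /= => /andP[/eqP kk _].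
  have := eqxx y; rewrite -{1}ly blk_mk_eq /= => /andP[/eqP ll _].
  by move: kl; rewrite kk ll leqNgt lk.
have scramble_actN (om : blk_matrices F K e) u :
    scramble_act ([ffun j' => [ffun kl => om j' kl + N j' kl]] : blk_matrices F K e) u =
    scramble_act om u + one_digit x (r * u y).
  apply/ffunP => -[j' [k a]]; rewrite !ffunE /=.
  transitivity (\sum_l \sum_i (om j' (k, l) a i * u (@blk_mk _ e (fun=> K) j' l i) +
      N j' (k, l) a i * u (@blk_mk _ e (fun=> K) j' l i))).
    by apply: eq_bigr => l' _; apply: eq_bigr => b _; rewrite !ffunE !mxE mulrDl.
  under [LHS]eq_bigr => l' _ do rewrite big_split /=.
  rewrite big_split /=; congr (_ + _).
  case: ifP => [/eqP xE|nx]; last first.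
    rewrite big1 // => l' _; rewrite big1 // => b _; rewrite mxE /=.
    by rewrite {1}/blk_mk /Tagged nx mul0r.
  have := f_equal tag xE => /= jj'; subst j'.
  rewrite (bigD1 l) //= (bigD1 i) //= !big1 ?addr0.
  - by rewrite mxE /= {1}/blk_mk /Tagged xE !eqxx.
  - move=> l' ne; rewrite big1 // => b _; rewrite mxE /= [X in _ && X]blk_mk_eq (negbTE ne) andbF.
    by rewrite mul0r.
  - by move=> b ne; rewrite mxE /= [X in _ && X]blk_mk_eq (negbTE ne) !andbF mul0r.
exists h; split.
- move=> [om dl] [om' dl'] [/ffunP omE /addIr ->]; congr pair; apply/ffunP => j'.
  apply/ffunP => kl; have := omE j'; rewrite !ffunE => /ffunP/(_ kl).
  by rewrite !ffunE => /addIr.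
- move=> w; rewrite !inE => /forallP omB; apply/forallP => j'.
  have /blk_lowerP[omu oml] := omB j'; apply/blk_lowerP; split=> [k|k l' kl].
    by rewrite !ffunE N0 // addr0.
  by rewrite !ffunE N0 ?addr0 ?oml // ltnW.
- move=> w; rewrite /config_point /h /= !scramble_actN.
  have od a b : one_digit x a - one_digit x b = one_digit x (a - b).
    by apply/ffunP => z; rewrite !ffunE; case: ifP => // _; rewrite subr0.
  split; rewrite -!addrA; congr (_ + _); rewrite addrCA od.
    by rewrite -mulrBr /r divfK // subr_eq0.
  by rewrite subrr; apply/ffunP => z; rewrite !ffunE; case: ifP; rewrite addr0.
Qed.

Lemma digit_shift_one (v : G) (x : idx) (t : F) :
  exists h : blk_matrices F K e * G -> blk_matrices F K e * G,
    [/\ injective h, forall w, w.1 \in scramblers F K e -> (h w).1 \in scramblers F K e &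
     forall w, config_point (h w) v = config_point w v + one_digit x t].
Proof.
exists (fun w => (w.1, w.2 + one_digit x t)); split=> //.
  by move=> [om dl] [om' dl'] [-> /addIr ->].
by move=> w; rewrite /config_point addrA.
Qed.

End digit_shift.

(** * The gain constant of a reduced sequence *)

Section gain_constant.
Variable R : realType.

(** The rectangle of height [y ^ -(1 + beta)] on [x, y] lies under the graph of
    [t ^ -(1 + beta)], whose primitive is on the right.  The bound
    [expR t >= 1 + t], used twice, estimates [(y / x) ^ beta] from below. *)
Lemma powR_ln_increment (beta x y : R) : 0 < beta -> 0 < x -> x <= y ->
  (y - x) / y `^ (1 + beta) <= (x `^ (- beta) - y `^ (- beta)) / beta.
Proof.
move=> b0 x0 xy; have y0 : 0 < y by apply: lt_le_trans xy.
have h1 : 1 + beta * (1 - x / y) <= (y / x) `^ beta.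
  rewrite /powR gt_eqF ?divr_gt0 //; apply: le_trans (expR_ge1Dx _).
  rewrite lerD2l ler_pM2l //.
  have := expR_ge1Dx (- ln (y / x)); rewrite expRN lnK ?posrE ?divr_gt0 // invf_div.
  by lra.
have h2 : x `^ (- beta) = y `^ (- beta) * (y / x) `^ beta.
  rewrite powRM ?invr_ge0 ?ltW // -powR_inv1 ?ltW // -powRrM mulN1r.
  rewrite mulrA -powRD ?addNr ?powRr0 ?mul1r //; apply/implyP => _; by rewrite gt_eqF.
have yb : 0 < y `^ (- beta) by apply: powR_gt0.
have h3 : (y - x) / y `^ (1 + beta) = y `^ (- beta) * (1 - x / y).
  rewrite powRD; last by apply/implyP => _; rewrite gt_eqF.
  rewrite powRr1 ?ltW // powRN.
  by field; rewrite !gt_eqF // powR_gt0.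
rewrite h3 ler_pdivlMr // h2.
have -> : y `^ (- beta) * (y / x) `^ beta - y `^ (- beta) =
  y `^ (- beta) * ((y / x) `^ beta - 1) by ring.
rewrite -mulrA ler_pM2l // mulrC; lra.
Qed.

Lemma ln_increment (n : nat) : (0 < n)%N -> n.+1%:R^-1 <= ln n.+1%:R - ln n%:R :> R.
Proof.
move=> n0; have n0' : 0 < n%:R :> R by rewrite ltr0n.
rewrite -ln_div ?posrE ?ltr0n //.
have := expR_ge1Dx (- ln (n.+1%:R / n%:R : R)).
rewrite expRN lnK ?posrE ?divr_gt0 ?ltr0n // invf_div.
have -> : n%:R / n.+1%:R = 1 - n.+1%:R^-1 :> R by rewrite -natr1; field; rewrite natr1 pnatr_eq0.
by move: (ln (n.+1%:R / n%:R)) (n.+1%:R^-1 : R) => u v; lra.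
Qed.

(** Integral test for [1 / (t * (ln t) ^ (1 + beta))], which has the primitive
    [- (ln t) ^ -beta / beta], telescoped from 2; the term of index 2 is left
    over and gives the first summand. *)
Lemma sum_reduced_le (beta : R) n : 0 < beta ->
  \sum_(2 <= i < n) 1 / (i%:R * ln i%:R `^ (1 + beta)) <=
  1 / (2 * (ln 2 `^ (1 + beta))) + 1 / (beta * (ln 2 `^ beta)).
Proof.
move=> b0; have l2 : 0 < ln 2 :> R by apply: ln_gt0; lra.
have B0 : 0 < 1 / (2 * (ln 2 `^ (1 + beta))) :> R.
  by rewrite divr_gt0 // mulr_gt0 ?powR_gt0 //; lra.
suff H k : \sum_(2 <= i < k.+3) 1 / (i%:R * ln i%:R `^ (1 + beta)) <=
    1 / (2 * (ln 2 `^ (1 + beta))) +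
    ((ln 2 `^ (- beta)) - (ln k.+2%:R `^ (- beta))) / beta :> R.
  have [n3|n3] := leqP n 2.
    rewrite big_geq //; apply/ltW/addr_gt0 => //.
    by rewrite divr_gt0 // mulr_gt0 ?powR_gt0.
  case: n n3 => [|[|[|n]]] // _; apply: le_trans (H n) _.
  rewrite lerD2l div1r invfM mulrC ler_pM2l ?invr_gt0 // -powRN gerBl.
  exact: powR_ge0.
elim: k => [|k IH]; first by rewrite big_nat1 subrr mul0r addr0.
rewrite big_nat_recr //=.
pose u : R := ln k.+2%:R; set v := ln k.+3%:R.
have u0 : 0 < u by apply: ln_gt0; rewrite ltr1n.
have uv : k.+3%:R^-1 <= v - u by apply: ln_increment.
have uv' : u <= v by rewrite -subr_ge0; apply: le_trans uv; rewrite invr_ge0.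
have v0 : 0 < v by apply: lt_le_trans uv'.
have step : 1 / (k.+3%:R * v `^ (1 + beta)) <= (v - u) / v `^ (1 + beta).
  by rewrite div1r invfM ler_pM2r // invr_gt0 powR_gt0.
have -> : (ln 2 `^ (- beta) - v `^ (- beta)) / beta =
    (ln 2 `^ (- beta) - u `^ (- beta)) / beta + (u `^ (- beta) - v `^ (- beta)) / beta.
  by rewrite -mulrDl addrA subrK.
rewrite addrA; apply: lerD => //; apply: le_trans step _.
exact: powR_ln_increment.
Qed.

End gain_constant.

Section reduced_constant.
Variables (R : realType) (b s : nat) (S : gns b s) (beta : R).
Hypothesis b_prime : prime b.
Hypothesis beta0 : 0 < beta.
Hypothesis Sred : reduced (fun n => ln n%:R `^ (1 + beta)) S.
Local Notation e := (gns_deg S).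

Lemma gns_base_inj : injective (gns_base S).
Proof.
move=> i j ij; apply/eqP; apply: contraT => ne.
have := @gns_base_coprime _ _ S i j ne; rewrite ij coprimepp => /eqP h.
by have := gns_base_nonconstant S j; rewrite h.
Qed.

Let cnt n := #|[set j | e j == n]|.

Let size_cnt n : size (undup [seq gns_base S j | j <- enum 'I_s & e j == n]) = cnt n.
Proof.
rewrite undup_id; last by rewrite (map_inj_uniq gns_base_inj) filter_uniq ?enum_uniq.
rewrite size_map /cnt cardsE cardE /enum_mem -enumT; congr size.
rewrite -filter_predI; apply: eq_filter => j; by rewrite /= andbT.
Qed.

(** A monic polynomial of degree 1 is determined by its constant coefficient. *)
Lemma card_gns_linear : (cnt 1 <= b)%N.
Proof.
pose f j : 'F_b := (gns_base S j)`_0.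
have finj : {in [set j | e j == 1%N] &, injective f}.
  have lin j : e j == 1%N -> gns_base S j = 'X + (f j)%:P.
    rewrite /gns_deg => /eqP ej; have sz : size (gns_base S j) = 2%N.
      by have := gns_base_nonconstant S j; lia.
    have /monicP := gns_base_monic S j; rewrite lead_coefE sz /= => l1.
    apply/polyP => -[|[|i]]; rewrite coefD coefX coefC /= ?add0r ?addr0 //.
    by rewrite nth_default // sz.
  move=> j j'; rewrite !inE => /lin ej /lin ej' fjj; apply: gns_base_inj.
  by rewrite ej ej' fjj.
rewrite /cnt -(card_in_imset finj) (leq_trans (max_card _)) //.
by rewrite card_Fp.
Qed.

Let cnt_le n : (2 <= n)%N ->
  (cnt n)%:R / (b%:R ^+ n - 1) <= 1 / (n%:R * ln n%:R `^ (1 + beta)) :> R.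
Proof.
move=> n2; have [_ /(_ n n2)] := Sred; rewrite size_cnt => h.
have b1 : 1 < b%:R :> R by rewrite ltr1n prime_gt1.
have bn : 1 < b%:R ^+ n :> R by rewrite exprn_egt1 // -lt0n; lia.
rewrite ler_pdivrMr ?subr_gt0 // div1r [leRHS]mulrC.
by apply: le_trans (floor_le _); rewrite -(ler_int R) in h.
Qed.

(** A factor [(1 - b ^- e)^-1 = 1 + (b ^ e - 1)^-1] is at most
    [expR ((b ^ e - 1)^-1)].  Group the exponents by degree: degree 1 gives at
    most [b / (b - 1) <= 2], and reducedness bounds the higher degrees by the
    terms of [sum_reduced_le]. *)
Lemma gain_constant_le :
  \prod_j (1 - (#|'F_b|%:R ^+ e j)^-1)^-1 <= C_const beta.
Proof.
rewrite card_Fp //.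
have b2 : 2 <= b%:R :> R by rewrite ler_nat prime_gt1.
have b1 : 1 < b%:R :> R by lra.
have fac n : (0 < n)%N -> (1 - (b%:R ^+ n)^-1)^-1 <= expR ((b%:R ^+ n - 1)^-1) :> R.
  move=> n0; have bn : 1 < b%:R ^+ n :> R by rewrite exprn_egt1 // -lt0n.
  apply: le_trans (expR_ge1Dx _); rewrite le_eqVlt; apply/orP; left; apply/eqP.
  by field; rewrite subr_eq0 !gt_eqF //; lra.
have -> : C_const beta = expR 2 * expR (1 / (2 * (ln 2 `^ (1 + beta))) + 1 / (beta * (ln 2 `^ beta))).
  by rewrite /C_const -expRD addrA.
apply: (@le_trans _ _ (expR (\sum_j (b%:R ^+ e j - 1)^-1))).
  rewrite expR_sum; apply: ler_prod => j _; rewrite fac ?gns_deg_gt0 // andbT.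
  rewrite invr_ge0 subr_ge0 invf_le1 ?exprn_ege1 ?exprn_gt0 //; lra.
rewrite -expRD ler_expR.
pose n := (\max_j e j).+1.
have en j : (0 < e j < n)%N by rewrite gns_deg_gt0 ltnS leq_bigmax.
have -> : \sum_j (b%:R ^+ e j - 1)^-1 = \sum_(1 <= i < n) (cnt i)%:R / (b%:R ^+ i - 1) :> R.
  transitivity (\sum_(1 <= i < n) \sum_(j | e j == i) (b%:R ^+ e j - 1)^-1 : R).
    rewrite (exchange_big_dep xpredT) //=; apply: eq_bigr => j _.
    rewrite big_mkcond (bigD1_seq (e j)) ?mem_index_iota ?iota_uniq ?en //=.
    by rewrite eqxx big1 ?addr0 // => i; rewrite eq_sym => /negbTE ->.
  apply: eq_bigr => i _; rewrite (eq_bigr (fun=> (b%:R ^+ i - 1)^-1)) => [|j /eqP -> //].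
  by rewrite sumr_const mulr_natl /cnt cardsE.
have [n2|n2] := leqP n 1.
  rewrite big_geq // addr_ge0 // (le_trans _ (sum_reduced_le 0 beta0)) //.
  by rewrite big_geq.
rewrite big_ltn //; apply: lerD.
  apply: (@le_trans _ _ (b%:R / (b%:R - 1))).
    by rewrite expr1 ler_pM2r ?ler_nat ?card_gns_linear // invr_gt0 subr_gt0.
  by rewrite ler_pdivrMr ?subr_gt0 //; lra.
apply: le_trans (sum_reduced_le n beta0).
rewrite !big_nat; apply: ler_sum => i /andP[i2 _]; exact: cnt_le.
Qed.

End reduced_constant.

Local Open Scope classical_set_scope.
Local Open Scope ring_scope.

(** * The law of a point with uniform digits *)

Section radical_inverse.
Variables (R : realType) (b : nat).
Hypothesis b_prime : prime b.
Implicit Types z : nat -> 'F_b.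

(** The entry [z 0] is the most significant digit, so that
    [radix_prefix z r / b ^ r] is the truncation of [phi z] to [r] digits. *)
Fixpoint radix_prefix z (r : nat) : nat := if r is r'.+1 then (radix_prefix z r' * b + z r')%N else 0%N.

Lemma Fp_lt (a : 'F_b) : (a < b)%N.
Proof. by apply: leq_trans (ltn_ord a) _; rewrite -[X in (_ <= X)%N](Fp_cast b_prime). Qed.

Lemma radix_prefix_lt z r : (radix_prefix z r < b ^ r)%N.
Proof.
elim: r => //= r IH; rewrite expnSr; have := Fp_lt (z r); nia.
Qed.

Let b0 : 0 < b%:R :> R.
Proof. by rewrite ltr0n prime_gt0. Qed.

Let part z : R ^nat := series (fun r => (z r : nat)%:R / b%:R ^+ r.+1 : R).

Lemma phi_partialE z r : part z r = (radix_prefix z r)%:R / b%:R ^+ r.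
Proof.
elim: r => [|r IH]; first by rewrite /part /series /= big_geq // mul0r.
rewrite /part /series /= big_nat_recr //= -[X in X + _]/(part z r) IH.
by rewrite natrD natrM exprSr; field; rewrite expf_neq0 gt_eqF.
Qed.

Lemma phi_partial_le z r k : part z (r + k)%N <= part z r + (b%:R ^+ r)^-1 - (b%:R ^+ (r + k))^-1.
Proof.
elim: k => [|k IH]; first by rewrite addn0 addrK.
rewrite addnS {1}/part /series /= big_nat_recr //= -[X in X + _]/(part z (r + k)%N).
have h : (z (r + k)%N : nat)%:R <= b%:R - 1 :> R.
  by have := Fp_lt (z (r + k)%N); rewrite -(ler_nat R) -natr1; lra.
have B : 0 < b%:R ^+ (r + k).+1 :> R by rewrite exprn_gt0.
have : (z (r + k)%N : nat)%:R / b%:R ^+ (r + k).+1 <=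
  (b%:R ^+ (r + k))^-1 - (b%:R ^+ (r + k).+1)^-1 :> R.
  have -> : (b%:R ^+ (r + k))^-1 - (b%:R ^+ (r + k).+1)^-1 = (b%:R - 1) / b%:R ^+ (r + k).+1 :> R.
    by rewrite exprSr; field; rewrite expf_neq0 gt_eqF.
  by rewrite ler_pM2r ?invr_gt0.
move: IH; lra.
Qed.

Lemma phi_partial_nd z : nondecreasing_seq (part z).
Proof. by apply: nondecreasing_series => n _ _; rewrite divr_ge0 // exprn_ge0. Qed.

Lemma phi_partial_cvg z : cvgn (part z).
Proof.
apply: nondecreasing_is_cvgn; first exact: phi_partial_nd.
exists 1 => _ [r _ <-]; rewrite phi_partialE ler_pdivrMr ?exprn_gt0 // mul1r -natrX ler_nat.
exact/ltnW/radix_prefix_lt.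
Qed.

Lemma phi_ge z r : (radix_prefix z r)%:R / b%:R ^+ r <= phi z :> R.
Proof. by rewrite -phi_partialE; apply: nondecreasing_cvgn_le;
  [exact: phi_partial_nd|exact: phi_partial_cvg]. Qed.

(** Equality occurs when all further digits are [b - 1], which is why the
    interval of a prefix is closed. *)
Lemma phi_le z r : phi z <= (radix_prefix z r).+1%:R / b%:R ^+ r :> R.
Proof.
apply: limr_le; first exact: phi_partial_cvg.
exists r => // k /= rk; rewrite -(subnKC rk).
apply: le_trans (phi_partial_le _ _ _) _; rewrite phi_partialE -natr1 mulrDl mul1r.
by rewrite lerBlDr lerDl invr_ge0 exprn_ge0.
Qed.

(** Self-similarity of the radical inverse: the cell of a prefix is an affine copy
    of the unit interval. *)
Lemma phi_split z t : phi z = ((radix_prefix z t)%:R + phi (fun k => z (t + k)%N)) / b%:R ^+ t :> R.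
Proof.
pose z' k := z (t + k)%N.
have h : (fun k => part z (k + t)%N) = (fun k => ((radix_prefix z t)%:R + part z' k) / b%:R ^+ t).
  apply/funext; elim=> [|k IH].
    by rewrite add0n phi_partialE /part /series /= big_geq // addr0.
  rewrite addSn /part /series /= !big_nat_recr //= -[X in X + _ = _]/(part z (k + t)%N).
  rewrite IH -[X in (_ + (X + _))]/(part z' k) /z' addnC -addnS exprD.
  by field; rewrite !expf_neq0 // gt_eqF.
apply: cvg_lim => //; rewrite -(cvg_shiftn t) h.
apply: cvgMl; apply: cvgD; first exact: cvg_cst.
exact: phi_partial_cvg.
Qed.

Lemma phi_measurable d (W : measurableType d) (Z : nat -> W -> 'F_b) :
  (forall k a, measurable (Z k @^-1` [set a])) ->
  measurable_fun setT (fun w => phi (Z ^~ w) : R).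
Proof.
move=> mZ; apply: (@measurable_fun_cvg _ _ _ _ (fun r w => part (Z ^~ w) r : R)); last first.
  by move=> w _; exact: phi_partial_cvg.
move=> r; rewrite /part /series /=; apply: measurable_sum => k.
apply: measurable_funM; last exact: measurable_cst.
move=> _ B mB; rewrite setTI.
have -> : (fun w => (Z k w : nat)%:R : R) @^-1` B =
   \bigcup_(a in [set a : 'F_b | B (a : nat)%:R]) (Z k @^-1` [set a]).
  apply/seteqP; split => w /=; first by move=> Bw; exists (Z k w).
  by move=> [a Ba /= ->].
by apply: fin_bigcup_measurable; [exact: finite_finset|move=> a _; exact: mZ].
Qed.

End radical_inverse.

Section uniform_digits_theory.
Context d (W : measurableType d) (R : realType) (P : probability W R).
Variable F : finType.
Implicit Types (A B : set W).

(** Cylinder events: [J] lists finitely many indices with prescribed digits. *)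
Definition digit_event (X : eqType) (Z : X -> W -> F) (J : seq (X * F)) : set W :=
  [set w | all (fun p => Z p.1 w == p.2) J].

Definition measurable_digits (X : eqType) (Z : X -> W -> F) : Prop :=
  forall x a, measurable (Z x @^-1` [set a]).

(** Conditionally on [A], the digits are independent and uniform.  Multiplying by
    [P A] instead of dividing allows [A] to be negligible. *)
Definition uniform_digits (X : eqType) A (Z : X -> W -> F) : Prop :=
  forall J : seq (X * F), uniq (map fst J) ->
    P (A `&` digit_event Z J) = (P A * (#|F|%:R ^- size J)%:E)%E.

Lemma digit_event_cat (X : eqType) (Z : X -> W -> F) J J' :
  digit_event Z (J ++ J') = digit_event Z J `&` digit_event Z J'.
Proof. by apply/seteqP; split=> w /=; rewrite /digit_event /= all_cat => /andP. Qed.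

Lemma measurable_digit_event (X : eqType) (Z : X -> W -> F) J :
  measurable_digits Z -> measurable (digit_event Z J).
Proof.
move=> mZ; elim: J => [|[x a] J IH].
  rewrite (_ : digit_event Z [::] = setT); first exact: measurableT.
  by apply/seteqP; split.
rewrite -cat1s digit_event_cat; apply: measurableI => //.
rewrite (_ : digit_event Z _ = Z x @^-1` [set a]) //; apply/seteqP; split=> w.
  by rewrite /digit_event /= andbT => /eqP.
by rewrite /digit_event /= andbT => ->.
Qed.

Lemma digit_event_map (X X' : eqType) (f : X' -> X) (Z : X -> W -> F) (J : seq (X' * F)) :
  digit_event (Z \o f) J = digit_event Z (map (fun p => (f p.1, p.2)) J).
Proof. by apply/seteqP; split=> w; rewrite /digit_event /= all_map. Qed.

Let map_fst (X X' : eqType) (f : X' -> X) (J : seq (X' * F)) :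
  map fst (map (fun p => (f p.1, p.2)) J) = map f (map fst J).
Proof. by rewrite -!map_comp. Qed.

Lemma uniform_digits_reindex (X X' : eqType) (f : X' -> X) A (Z : X -> W -> F) :
  injective f -> uniform_digits A Z -> uniform_digits A (Z \o f).
Proof.
move=> fi h J uJ; rewrite (digit_event_map f Z) h ?size_map //.
by rewrite map_fst map_inj_uniq.
Qed.

(** The product rule for the two lists together, divided by that for [J]. *)
Lemma uniform_digits_condition (X X1 X2 : eqType) (f : X1 -> X) (g : X2 -> X) A
    (Z : X -> W -> F) (J : seq (X1 * F)) :
  injective f -> injective g -> (forall x y, f x <> g y) -> uniq (map fst J) ->
  uniform_digits A Z -> uniform_digits (A `&` digit_event (Z \o f) J) (Z \o g).
Proof.
move=> fi gi fg uJ h J' uJ'.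
have uJf : uniq (map fst (map (fun p : X1 * F => (f p.1, p.2)) J)).
  by rewrite map_fst map_inj_uniq.
rewrite (digit_event_map f Z J) (digit_event_map g Z) -setIA -digit_event_cat h.
  rewrite h // !size_cat !size_map exprD invfM EFinM muleA; congr (_ * _)%E.
rewrite map_cat cat_uniq uJf /= !map_fst map_inj_uniq // uJ' andbT.
by apply/hasPn => _ /mapP[y _ ->]; apply/negP => /mapP[x _ /esym/fg].
Qed.

(** This turns laws of single coordinates into product laws: [E] will be an event
    on the digits [Z1].  Its law is known on every event [B], and taking for [B]
    the cylinder events on [Z2] shows that [E] does not influence [Z2]. *)
Lemma uniform_digits_event (X1 X2 : eqType) A E (c : \bar R)
    (Z : X1 + X2 -> W -> F) :
  measurable A -> measurable_digits Z ->
  (forall B, measurable B -> uniform_digits B (Z \o inl) -> P (B `&` E) = (P B * c)%E) ->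
  uniform_digits A Z -> uniform_digits (A `&` E) (Z \o inr).
Proof.
move=> mA mZ law h J uJ; rewrite setIAC law.
- rewrite law //; last by apply: uniform_digits_reindex h => x y [].
  have := uniform_digits_reindex (@inr_inj _ _) h uJ => ->.
  by rewrite -!muleA; congr (_ * _)%E; rewrite muleC.
- by apply: measurableI => //; apply: measurable_digit_event => x a; exact: mZ.
- apply: uniform_digits_condition => //; first exact: inr_inj.
  exact: inl_inj.
Qed.

End uniform_digits_theory.

Section law_on.
Context d d' (W : measurableType d) (T : measurableType d') (R : realType).
Variables (m : {measure set W -> \bar R}) (f : W -> T) (A : set W).

(** A finite measure of mass [m A], again not normalized because [m A] may be 0. *)
Definition law_on (mA : measurable A) (_ : measurable_fun setT f) : set T -> \bar R :=
  pushforward (mrestr m mA) f.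

Variables (mA : measurable A) (mf : measurable_fun setT f).

Lemma law_onE B : law_on mA mf B = m (A `&` f @^-1` B).
Proof. by rewrite /law_on /pushforward /mrestr setIC. Qed.

HB.instance Definition _ := Measure.copy (law_on mA mf)
  (measure_function_pushforward__canonical__measure_function_Measure (mrestr m mA) mf).

End law_on.

Lemma law_on_probE d d' (W : measurableType d) (T : measurableType d') (R : realType)
  (P : probability W R) (f : W -> T) (A : set W) (mA : measurable A)
  (mf : measurable_fun setT f) B : law_on P mA mf B = P (A `&` f @^-1` B).
Proof. exact: law_onE. Qed.

Section radical_inverse_law.
Context d (W : measurableType d) (R : realType) (P : probability W R).
Variable b : nat.
Hypothesis b_prime : prime b.
Variables (A : set W) (Z : nat -> W -> 'F_b).
Hypotheses (mA : measurable A) (mZ : measurable_digits Z).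
Hypothesis hZ : uniform_digits P A Z.

Let pA := fine (P A).
Let PA : P A = pA%:E. Proof. by rewrite fineK // fin_num_measure. Qed.
Let pA0 : 0 <= pA. Proof. by rewrite fine_ge0. Qed.
Let b0 : 0 < b%:R :> R. Proof. by rewrite ltr0n prime_gt0. Qed.

Let prefix_event r a : set W := [set w | radix_prefix (Z ^~ w) r = a].

Let measurable_prefix_event r a : measurable (prefix_event r a).
Proof.
elim: r a => [|r IH] a.
  case: (eqVneq a 0%N) => [->|na].
    by rewrite (_ : prefix_event _ _ = setT); [exact: measurableT|apply/seteqP; split].
  rewrite (_ : prefix_event _ _ = set0); first exact: measurable0.
  by apply/seteqP; split=> w //= a0; rewrite -a0 eqxx in na.
rewrite (_ : prefix_event _ _ = prefix_event r (a %/ b) `&`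
  \bigcup_(c in [set c : 'F_b | nat_of_ord c = a %% b]%N) (Z r @^-1` [set c])).
  apply: measurableI; first exact: IH.
  by apply: fin_bigcup_measurable; [exact: finite_finset|move=> c _; exact: mZ].
apply/seteqP; split=> w /=; rewrite /prefix_event /=.
  move=> <-; rewrite divnMDl ?prime_gt0 // modnMDl divn_small ?modn_small ?Fp_lt // addn0; split=> //.
  by exists (Z r w).
by move=> [-> [c /= cE ->]]; rewrite cE -divn_eq.
Qed.

Let prefix_prob_digits r a J : (a < b ^ r)%N -> uniq (map fst J) -> all (fun p => r <= p.1)%N J ->
  P (A `&` prefix_event r a `&` digit_event Z J) = (pA / b%:R ^+ (r + size J))%:E.
Proof.
elim: r a J => [|r IH] a J ar uJ Jr.
  have -> : a = 0%N by move: ar; rewrite expn0; case: a.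
  rewrite (_ : prefix_event _ _ = setT); last by apply/seteqP; split.
  by rewrite setIT hZ // card_Fp // PA.
have am : (a %% b < b)%N by rewrite ltn_mod prime_gt0.
pose c : 'F_b := (a %% b)%:R.
have cE : nat_of_ord c = (a %% b)%N by rewrite /c val_Fp_nat // modn_mod.
rewrite (_ : _ `&` _ = A `&` prefix_event r (a %/ b) `&` digit_event Z ((r, c) :: J)).
  rewrite IH /= ?addnS ?addSn //.
  - by rewrite ltn_divLR ?prime_gt0 // -expnSr.
  - rewrite uJ andbT; apply/negP => /mapP[[x y] /(allP Jr) /= rx xE].
    by move: rx; rewrite -xE ltnn.
  - by rewrite leqnn /=; apply: sub_all Jr => p /= /ltnW.
rewrite -!setIA; congr (_ `&` _); apply/seteqP; split=> w; rewrite /prefix_event /digit_event /=.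
  move=> [aE ->]; rewrite andbT -{1}aE divnMDl ?prime_gt0 // divn_small ?Fp_lt // addn0; split=> //.
  by apply/eqP/val_inj; rewrite /= cE -aE modnMDl modn_small // Fp_lt.
move=> [-> /andP[/eqP -> ->]]; rewrite cE -divn_eq; split=> //.
Qed.

Let measurable_prefix_lt r a : measurable [set w | (radix_prefix (Z ^~ w) r < a)%N].
Proof.
rewrite (_ : [set w | _] = \bigcup_(c in [set c | (c < a)%N]) prefix_event r c).
  by apply: bigcup_measurable => c _; exact: measurable_prefix_event.
apply/seteqP; split=> w /=; first by move=> h; exists (radix_prefix (Z ^~ w) r).
by move=> [c /= ca]; rewrite /prefix_event /= => ->.
Qed.

Let prefix_lt_prob r a : (a <= b ^ r)%N ->
  P (A `&` [set w | (radix_prefix (Z ^~ w) r < a)%N]) = (pA * a%:R / b%:R ^+ r)%:E.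
Proof.
elim: a => [|a IH] ar.
  rewrite mulr0 mul0r (_ : [set w | _] = set0); last by apply/seteqP; split.
  by rewrite setI0 measure0.
rewrite (_ : A `&` _ = (A `&` [set w | (radix_prefix (Z ^~ w) r < a)%N]) `|`
    (A `&` prefix_event r a)); last first.
  rewrite -setIUr; congr (_ `&` _); apply/seteqP; split=> w; rewrite /prefix_event /= ltnS.
    by rewrite leq_eqVlt => /orP[/eqP|]; [right|left].
  by case=> [/ltnW|->].
rewrite measureU; first last.
- apply/seteqP; split=> w //= [[_ h1] [_ h2]].
  by move: h1; rewrite h2 ltnn.
- by apply: measurableI.
- by apply: measurableI.
transitivity ((pA * a%:R / b%:R ^+ r)%:E + (pA / b%:R ^+ r)%:E)%E; last first.
  by rewrite -EFinD -natr1; congr EFin; ring.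
congr (_ + _)%E; first exact: (IH (ltnW ar)).
have := @prefix_prob_digits r a [::] ar isT isT.
rewrite (_ : digit_event Z [::] = setT); last by apply/seteqP; split.
by rewrite setIT addn0.
Qed.

Let phi_w w : R := phi (Z ^~ w).

Let mphi : measurable_fun setT phi_w.
Proof. exact: phi_measurable. Qed.

(* The truncation to [r] digits is uniform on the multiples of [b ^- r].  It
   differs from the point by at most [b ^- r], and so does [t] from a multiple:
   hence the two errors in [pow_small]. *)
Let ray_prob t : P (A `&` phi_w @^-1` `]-oo, t[) = (pA * Num.max 0 (Num.min t 1))%:E.
Proof.
have mE : measurable (A `&` phi_w @^-1` `]-oo, t[).
  by apply: measurableI => //; rewrite -[X in measurable X]setTI; apply: mphi.
have pow_small (eps : R) : 0 < eps -> exists r, 2 / b%:R ^+ r < eps.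
  move=> e0; exists (Num.truncn (2 / eps)).+1; rewrite ltr_pdivrMr ?exprn_gt0 // mulrC -ltr_pdivrMr //.
  apply: lt_le_trans (truncnS_gt _) _; rewrite -natrX ler_nat ltnW //.
  by apply: ltn_expl; exact: prime_gt1.
have [t0|t0] := leP t 0.
  rewrite (_ : A `&` _ = set0) ?measure0.
    by rewrite (_ : Num.min t 1 = t) ?max_l ?mulr0 // min_l; lra.
  apply/seteqP; split=> w //= [_]; rewrite in_itv /= => h.
  by have := phi_ge R b_prime (Z ^~ w) 0; rewrite mul0r -/(phi_w w); lra.
rewrite max_r ?le_min ?(ltW t0) ?ler01 //.
pose p := fine (P (A `&` phi_w @^-1` `]-oo, t[)).
have pE : P (A `&` phi_w @^-1` `]-oo, t[) = p%:E by rewrite fineK // fin_num_measure.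
have ple : p <= pA by rewrite -lee_fin -pE -PA le_measure ?inE // => w [].
have lower r a : (a <= b ^ r)%N -> a%:R <= t * b%:R ^+ r -> pA * a%:R / b%:R ^+ r - pA / b%:R ^+ r <= p.
  case: a => [|a] ar at_.
    by rewrite mulr0 mul0r sub0r (le_trans (y := 0)) ?oppr_le0 ?divr_ge0 ?exprn_ge0 ?fine_ge0 // ltW.
  rewrite (_ : pA * _ / _ - _ = pA * a%:R / b%:R ^+ r); last by rewrite -natr1; ring.
  rewrite -lee_fin -pE -prefix_lt_prob ?(ltnW ar) //.
  apply: le_measure; rewrite ?inE //; first exact: measurableI.
  move=> w [Aw /= wa]; split=> //=; rewrite in_itv /=.
  apply: le_lt_trans (phi_le R b_prime (Z ^~ w) r) _.
  rewrite ltr_pdivrMr ?exprn_gt0 //; apply: lt_le_trans at_.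
  by rewrite ltr_nat.
have upper r a : (a < b ^ r)%N -> t * b%:R ^+ r < a.+1%:R -> p <= pA * a%:R / b%:R ^+ r + pA / b%:R ^+ r.
  move=> ar at_; rewrite (_ : pA * _ / _ + _ = pA * a.+1%:R / b%:R ^+ r); last by rewrite -natr1; ring.
  rewrite -lee_fin -pE -prefix_lt_prob //.
  apply: le_measure; rewrite ?inE //; first exact: measurableI.
  move=> w [Aw /=]; rewrite in_itv /= => wt; split=> //=.
  rewrite -(ltr_nat R); apply: le_lt_trans at_; apply/ltW.
  rewrite -ltr_pdivrMr ?exprn_gt0 //; apply: le_lt_trans wt; exact: phi_ge.
have pA1 : pA <= 1 by rewrite -lee_fin -PA probability_le1.
rewrite pE; congr EFin; apply/eqP; rewrite eq_le; apply/andP; split.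
  apply/ler_addgt0Pr => eps e0; have [t1|t1] := leP 1 t.
    by rewrite mulr1; lra.
  have [r hr] := pow_small eps e0.
  pose a := Num.truncn (t * b%:R ^+ r).
  have tb : 0 <= t * b%:R ^+ r by rewrite mulr_ge0 ?exprn_ge0 // ltW.
  have /andP[a1 a2] : a%:R <= t * b%:R ^+ r < a.+1%:R by rewrite truncn_itv.
  have ab : (a < b ^ r)%N.
    rewrite -(ltr_nat R) natrX; apply: le_lt_trans a1 _.
    by rewrite gtr_pMl // exprn_gt0.
  apply: le_trans (upper r a ab a2) _; apply: lerD.
    by rewrite -mulrA ler_wpM2l // ler_pdivrMr ?exprn_gt0.
  apply/ltW; apply: le_lt_trans hr; rewrite ler_pM2r ?invr_gt0 ?exprn_gt0 //; lra.
apply/ler_addgt0Pr => eps e0; have [r hr] := pow_small eps e0.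
have [t1|t1] := leP 1 t.
  rewrite mulr1.
  have := lower r (b ^ r)%N (leqnn _); rewrite natrX mulfK ?expf_neq0 ?gt_eqF // => h.
  have {}h := h (ler_peMl (exprn_ge0 r (ltW b0)) t1).
  have : pA / b%:R ^+ r <= 2 / b%:R ^+ r by rewrite ler_pM2r ?invr_gt0 ?exprn_gt0 //; lra.
  lra.
pose a := Num.truncn (t * b%:R ^+ r).
have tb : 0 <= t * b%:R ^+ r by rewrite mulr_ge0 ?exprn_ge0 // ltW.
have /andP[a1 a2] : a%:R <= t * b%:R ^+ r < a.+1%:R by rewrite truncn_itv.
have ab : (a < b ^ r)%N.
  rewrite -(ltr_nat R) natrX; apply: le_lt_trans a1 _.
  by rewrite gtr_pMl // exprn_gt0.
have := lower r a (ltnW ab) a1.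
have h1 : t <= a%:R / b%:R ^+ r + 1 / b%:R ^+ r.
  by rewrite -mulrDl natr1 ler_pdivlMr ?exprn_gt0 // ltW.
have := ler_wpM2l pA0 h1.
have : pA / b%:R ^+ r <= 1 / b%:R ^+ r by rewrite ler_pM2r ?invr_gt0 ?exprn_gt0.
rewrite mulrDr !mulrA mulr1.
rewrite (_ : 2 / b%:R ^+ r = 1 / b%:R ^+ r + 1 / b%:R ^+ r) in hr; last by ring.
lra.
Qed.

(** Both sides are finite measures in [B], and they agree on all rays. *)
Lemma radical_inverse_law (B : set R) : measurable (B : set (measurableTypeR R)) ->
  P (A `&` (fun w => phi (Z ^~ w)) @^-1` B) =
  (P A * lebesgue_measure (B `&` `]0%R, 1%R[))%E.
Proof.
move=> mB; have m01 : measurable (`]0, 1[ : set (measurableTypeR R)) by exact: measurable_itv.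
have mphi' : measurable_fun setT (phi_w : W -> measurableTypeR R) by exact: mphi.
pose m1 : {measure set (measurableTypeR R) -> \bar R} := law_on P mA mphi'.
pose m2 : {measure set (measurableTypeR R) -> \bar R} :=
  mscale (NngNum pA0) (mrestr (@lebesgue_measure R) m01).
rewrite -[LHS](law_on_probE P mA mphi') -/m1.
transitivity (m2 B); last by rewrite /m2 /mscale /= PA.
have m1E t : m1 `]-oo, t[%classic = (pA * Num.max 0 (Num.min t 1))%:E.
  by apply: etrans (ray_prob t); exact: law_on_probE.
have rayE t : m1 `]-oo, t[%classic = m2 `]-oo, t[%classic.
  rewrite m1E /m2 /mscale /= EFinM; congr (_ * _)%E.
  transitivity (lebesgue_measure (`]0, Num.min t 1[%classic : set (measurableTypeR R))).
    rewrite lebesgue_measure_itv /= lte_fin; case: ltP => h //.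
    by rewrite -EFinD subr0.
  rewrite /mrestr; congr (lebesgue_measure _).
  apply/seteqP; split=> x /=; rewrite !in_itv /= lt_min.
    by move=> /andP[-> /andP[-> ->]].
  by move=> [-> /andP[-> ->]].
have ext := (fun mG setI Gg cover => @measure_unique _ R (measurableTypeR R)
  (@RGenInftyO.G R) (fun n => `]-oo, n%:R[%classic) mG setI Gg cover m1 m2).
refine (ext _ _ _ _ _ _ B mB).
- exact: RGenInftyO.measurableE.
- move=> _ _ [x ->] [y ->]; exists (Num.min x y).
  by apply/seteqP; split=> z /=; rewrite !in_itv /= lt_min; [move=> [-> ->]|move=> /andP[-> ->]].
- by move=> n; exists n%:R.
- apply/seteqP; split=> x // _; exists (Num.truncn `|x|).+1 => //=.
  rewrite in_itv /=; apply: le_lt_trans (ler_norm x) _; exact: truncnS_gt.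
- by move=> _ [t ->]; exact: rayE.
- by move=> k; rewrite m1E ltry.
Qed.

End radical_inverse_law.

(** The rectangles form a pi-system. *)
Lemma product_measure_ext d1 d2 (T1 : measurableType d1) (T2 : measurableType d2)
    (R : realType) (m1 m2 : {measure set (T1 * T2) -> \bar R}) :
  (m1 setT < +oo)%E ->
  (forall A B, measurable A -> measurable B -> m1 (A `*` B) = m2 (A `*` B)) ->
  forall X, measurable X -> m1 X = m2 X.
Proof.
move=> m1oo m12 X mX.
pose C : set (set (T1 * T2)) := [set A `*` B | A in measurable & B in measurable].
apply: (measure_unique C (fun=> setT)) => //.
- by rewrite measurable_prod_measurableType.
- move=> _ _ [A1 mA1 [B1 mB1 <-]] [A2 mA2 [B2 mB2 <-]]; rewrite -setXI.
  by exists (A1 `&` A2); [exact: measurableI|exists (B1 `&` B2) => //; exact: measurableI].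
- by move=> _; exists setT => //; exists setT => //; rewrite setXTT.
- exact: bigcup_const.
- by move=> _ [A mA [B mB <-]]; exact: m12.
Qed.

Section tuple_law.
Variables (R : realType) (b : nat).
Hypothesis b_prime : prime b.

Definition phi_tuple s (W : Type) (Z : 'I_s * nat -> W -> 'F_b) (w : W) : s.-tuple R :=
  [tuple phi (fun k => Z (j, k) w) | j < s].

Lemma measurable_phi_tuple s d (W : measurableType d) (Z : 'I_s * nat -> W -> 'F_b) :
  measurable_digits Z -> measurable_fun setT (phi_tuple Z).
Proof.
move=> mZ; apply/measurable_fun_tnthP => i.
rewrite (_ : _ \o _ = fun w => phi (fun k => Z (i, k) w)).
  by apply: (phi_measurable b_prime) => k a; exact: mZ.
by apply/funext => w; rewrite /= tnth_mktuple.
Qed.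

Lemma measurable_unit_cube s : measurable (@unit_cube R s).
Proof.
rewrite (_ : unit_cube s = \bigcap_(i in [set: 'I_s]) ((@tnth _ R ^~ i) @^-1` `]0, 1[)).
  apply: fin_bigcap_measurable => [|i _]; [exact: finite_finset|rewrite -[X in measurable X]setTI;
  by apply: measurable_tnth => //; exact: measurable_itv].
apply/seteqP; split=> x /=; first by move=> h i _ /=; rewrite in_itv /= h.
by move=> h i; have := h i Logic.I; rewrite /= in_itv.
Qed.

Lemma unit_cube_cons s :
  @tuple_cons R s @^-1` unit_cube s.+1 = `]0%R, 1%R[ `*` unit_cube s.
Proof.
apply/seteqP; split=> -[x t] /=; rewrite /unit_cube /=.
  move=> h; split; first by have := h ord0; rewrite tnth0 in_itv.
  by move=> i; have := h (lift ord0 i); rewrite tnthS.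
rewrite in_itv /= => -[hx ht] i; case: (unliftP ord0 i) => [j ->|->]; first by rewrite tnthS.
by rewrite tnth0.
Qed.

(** Induction on the dimension: the first coordinate has the law of a radical
    inverse, and its event is added to the conditioning of the digits of the
    other coordinates. *)
Lemma phi_tuple_law s d (W : measurableType d) (P : probability W R)
    (A : set W) (Z : 'I_s * nat -> W -> 'F_b) (B : set (s.-tuple R)) :
  measurable A -> measurable_digits Z -> uniform_digits P A Z -> measurable B ->
  P (A `&` phi_tuple Z @^-1` B) = (P A * lebesgue_tuple s (B `&` unit_cube s))%E.
Proof.
elim: s A Z B => [|s IH] A Z B mA mZ hZ mB.
  have t0 (t : 0.-tuple R) : t = [tuple of [::]] by rewrite tuple0.
  rewrite /= /dirac indicE.
  rewrite (_ : unit_cube 0 = setT); last by apply/seteqP; split=> x // _ [].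
  rewrite setIT; have [Bt|nBt] := pselect (B [tuple of [::]]).
    rewrite mem_set // mule1; congr (P _); apply/seteqP; split=> w; first by case.
    by move=> Aw; split=> //=; rewrite (t0 (phi_tuple Z w)).
  rewrite memNset // mule0 (_ : A `&` _ = set0) ?measure0 //.
  by apply/seteqP; split=> w // -[_ /=]; rewrite (t0 (phi_tuple Z w)).
pose Z0 k := Z (ord0, k); pose Zt (x : 'I_s * nat) := Z (lift ord0 x.1, x.2).
pose Y0 w : measurableTypeR R := phi (Z0 ^~ w).
pose Y w := (Y0 w, phi_tuple Zt w).
have mZ0 : measurable_digits Z0 by move=> k a; exact: mZ.
have mZt : measurable_digits Zt by move=> k a; exact: mZ.
have mY0 : measurable_fun setT Y0 by exact: phi_measurable.
have mYt : measurable_fun setT (phi_tuple Zt) by exact: measurable_phi_tuple.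
have mY : measurable_fun setT Y by apply/measurable_fun_pairP; split.
have consE w : phi_tuple Z w = tuple_cons (Y w).
  apply: eq_from_tnth => i; case: (unliftP ord0 i) => [j ->|->].
    by rewrite tnthS !tnth_mktuple.
  by rewrite tnth0 tnth_mktuple.
have mD : measurable ((`]0%R, 1%R[ : set (measurableTypeR R)) `*` @unit_cube R s).
  by apply: measurableX; [exact: measurable_itv|exact: measurable_unit_cube].
have mB' : measurable (@tuple_cons R s @^-1` B).
  by rewrite -[X in measurable X]setTI; exact: measurable_tuple_cons.
pose m1 : {measure set (measurableTypeR R * s.-tuple R) -> \bar R} := law_on P mA mY.
have pA0 : 0 <= fine (P A) by rewrite fine_ge0.
have PA : P A = (fine (P A))%:E by rewrite fineK // fin_num_measure.
pose m2 : {measure set (measurableTypeR R * s.-tuple R) -> \bar R} :=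
  mscale (NngNum pA0) (mrestr (lebesgue_measure \x lebesgue_tuple s)%E mD).
transitivity (m1 (@tuple_cons R s @^-1` B)).
  rewrite [RHS](law_on_probE P mA mY); congr (P (_ `&` _)).
  by apply/seteqP; split=> w /=; rewrite consE.
transitivity (m2 (@tuple_cons R s @^-1` B)); last first.
  rewrite PA /m2 /= /mscale /=; congr (_ * _)%E.
  by rewrite /mrestr /lebesgue_tuple_step /pushforward preimage_setI unit_cube_cons.
apply: product_measure_ext => //.
  rewrite [X in (X < _)%E](law_on_probE P mA mY) setIT.
  by rewrite ltey_eq fin_num_measure.
move=> B0 Bt mB0 mBt; rewrite [LHS](law_on_probE P mA mY).
have m01 : measurable (`]0%R, 1%R[ : set (measurableTypeR R)) by exact: measurable_itv.
have law0 A' : measurable A' -> uniform_digits P A' Z0 ->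
    P (A' `&` Y0 @^-1` B0) = (P A' * lebesgue_measure (B0 `&` `]0%R, 1%R[))%E.
  by move=> mA' hA'; exact: radical_inverse_law.
pose f (x : nat + 'I_s * nat) : 'I_s.+1 * nat :=
  match x with inl k => (ord0, k) | inr y => (lift ord0 y.1, y.2) end.
have fi : injective f.
  move=> [k|[j k]] [k'|[j' k']] /= h.
  - by have /= -> := congr1 snd h.
  - by have /eqP := congr1 fst h; rewrite /= (negbTE (neq_lift _ _)).
  - by have /eqP := congr1 fst h; rewrite /= eq_sym (negbTE (neq_lift _ _)).
  - by have /= -> := congr1 snd h; have /lift_inj -> := congr1 fst h.
have hf := uniform_digits_reindex fi hZ.
have mE : measurable (A `&` Y0 @^-1` B0).
  by apply: measurableI => //; rewrite -[X in measurable X]setTI; exact: mY0.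
transitivity (P ((A `&` Y0 @^-1` B0) `&` phi_tuple Zt @^-1` Bt)).
  by rewrite -setIA; congr (P (_ `&` _)).
rewrite IH //; last first.
  apply: (@uniform_digits_event _ _ _ _ _ _ _ A (Y0 @^-1` B0)
    (lebesgue_measure (B0 `&` `]0%R, 1%R[)) (Z \o f)) => //.
  by move=> x a; exact: mZ.
rewrite law0 //; last first.
  exact: (uniform_digits_reindex (@inl_inj _ _) hf).
rewrite /m2 /= /mscale /= /mrestr -setXI product_measure1E //; last 2 first.
- exact: measurableI.
- by apply: measurableI => //; exact: measurable_unit_cube.
by rewrite PA muleA.
Qed.

End tuple_law.

(** * Integrals of uniform points and of pairs of them *)

Section law_transfer.
Context d d' (W : measurableType d) (T : measurableType d') (R : realType).
Variables (P : {measure set W -> \bar R}) (f : W -> T) (nu : {measure set T -> \bar R}).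
Variables (A : set W) (p : R).
Hypotheses (mA : measurable A) (mf : measurable_fun setT f) (p0 : 0 <= p).
Hypothesis law : forall B, measurable B -> P (A `&` f @^-1` B) = (p%:E * nu B)%E.
Local Open Scope ereal_scope.

(** Change of variables for the restriction of [P] to [A]. *)
Lemma law_transfer_ge0 (h : T -> \bar R) : measurable_fun setT h -> (forall y, 0 <= h y) ->
  \int[P]_(w in A) h (f w) = p%:E * \int[nu]_y h y.
Proof.
move=> mh h0.
have mhf : measurable_fun setT (h \o f) by exact: measurableT_comp.
transitivity (\int[mrestr P mA]_(w in A) h (f w)).
  by apply: eq_measure_integral => B mB BA; rewrite /= /mrestr setIidl.
transitivity (\int[mrestr P mA]_w h (f w)).
  apply/esym; rewrite (@ge0_negligible_integral _ _ _ _ _ (~` A)) //.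
  - by rewrite setTD setCK.
  - exact: measurableC.
  - by rewrite /= /mrestr setICl measure0.
rewrite -(@ge0_integral_pushforward _ _ _ _ _ f mf (mrestr P mA) setT h measurableT mh) //.
rewrite -(@ge0_integral_mscale _ _ _ nu _ measurableT (NngNum p0)) //.
apply: eq_measure_integral => B mB _.
by rewrite /= /pushforward /= /mrestr setIC [LHS]law.
Qed.

Lemma law_transfer_integrable (h : T -> \bar R) : nu.-integrable setT h ->
  P.-integrable A (h \o f).
Proof.
move=> /integrableP[mh hoo]; apply/integrableP; split.
  by apply: measurable_funTS; exact: measurableT_comp.
rewrite (@law_transfer_ge0 (abse \o h)); [|exact: measurableT_comp|by move=> y; exact: abse_ge0].
by rewrite lte_mul_pinfty.
Qed.

Lemma law_transfer_integral (h : T -> \bar R) : nu.-integrable setT h ->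
  \int[P]_(w in A) h (f w) = p%:E * \int[nu]_y h y.
Proof.
move=> ih; have /integrableP[mh _] := ih.
rewrite integralE [X in _ = _ * X]integralE muleBr //; last first.
  exact: integrable_add_def.
rewrite -!law_transfer_ge0 //; [|exact: measurable_funeneg|exact: measurable_funepos].
by congr (_ - _); apply: eq_integral => w _; rewrite ?funeposE ?funenegE.
Qed.

End law_transfer.

Section cube_probability.
Context {R : realType}.
Variable s : nat.

Definition cube_uniform : set (s.-tuple R) -> \bar R :=
  mrestr (lebesgue_tuple s) (@measurable_unit_cube R s).

HB.instance Definition _ := Measure.on cube_uniform.

End cube_probability.

Section cube_probability_mass.
Context {R : realType}.

Lemma lebesgue_unit_cube s : lebesgue_tuple s (@unit_cube R s) = 1%E.
Proof.
elim: s => [|s IH].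
  by rewrite /= /dirac indicE mem_set //; case.
rewrite -[LHS]/((lebesgue_measure \x lebesgue_tuple s)%E (@tuple_cons R s @^-1` unit_cube s.+1)).
have m01 : measurable (`]0%R, 1%R[ : set (measurableTypeR R)) by exact: measurable_itv.
rewrite unit_cube_cons product_measure1E //; last exact: measurable_unit_cube.
rewrite IH mule1; apply: etrans (lebesgue_measure_itv _) _; rewrite /= lte_fin ltr01.
by rewrite -EFinD subr0.
Qed.

Let cube_uniform_setT s : @cube_uniform R s setT = 1%E.
Proof. by rewrite /cube_uniform /mrestr setTI lebesgue_unit_cube. Qed.

HB.instance Definition _ s := Measure_isProbability.Build _ _ _
  (@cube_uniform R s) (cube_uniform_setT s).

End cube_probability_mass.

Section uniform_points.
Variables (R : realType) (b s : nat).
Hypothesis b_prime : prime b.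
Context d (W : measurableType d) (P : probability W R).
Variable A : set W.
Hypothesis mA : measurable A.
Local Notation Q := (@cube_uniform R s).
Let pA := fine (P A).
Let PA : P A = pA%:E. Proof. by rewrite fineK // fin_num_measure. Qed.
Let pA0 : 0 <= pA. Proof. by rewrite fine_ge0. Qed.

Lemma uniform_tuple_law (Z : 'I_s * nat -> W -> 'F_b) (B : set (s.-tuple R)) :
  measurable_digits Z -> uniform_digits P A Z -> measurable B ->
  P (A `&` phi_tuple R Z @^-1` B) = (pA%:E * Q B)%E.
Proof. by move=> mZ hZ mB; rewrite -PA; exact: phi_tuple_law. Qed.

Variable Z : ('I_s * nat) + ('I_s * nat) -> W -> 'F_b.
Hypotheses (mZ : measurable_digits Z) (hZ : uniform_digits P A Z).
Local Notation Y1 := (phi_tuple R (Z \o inl)).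
Local Notation Y2 := (phi_tuple R (Z \o inr)).

Let mY1 : measurable_fun setT Y1.
Proof. by apply: measurable_phi_tuple => // x a; exact: mZ. Qed.
Let mY2 : measurable_fun setT Y2.
Proof. by apply: measurable_phi_tuple => // x a; exact: mZ. Qed.
Let Y w := (Y1 w, Y2 w).
Let mY : measurable_fun setT Y.
Proof. by apply/measurable_fun_pairP; split. Qed.

(** As in [phi_tuple_law], the event of the first point is added to the
    conditioning of the digits of the second one. *)
Lemma uniform_pair_law (C : set (s.-tuple R * s.-tuple R)) : measurable C ->
  P (A `&` Y @^-1` C) = (pA%:E * (Q \x Q) C)%E.
Proof.
move=> mC; rewrite -[LHS](law_on_probE P mA mY).
pose m1 : {measure set (s.-tuple R * s.-tuple R) -> \bar R} := law_on P mA mY.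
pose m2 : {measure set (s.-tuple R * s.-tuple R) -> \bar R} :=
  mscale (NngNum pA0) (Q \x Q)%E.
rewrite -[LHS]/(m1 C) -[RHS]/(m2 C); apply: product_measure_ext => //.
  by rewrite [X in (X < _)%E](law_on_probE P mA mY) setIT ltey_eq fin_num_measure.
move=> B1 B2 mB1 mB2; rewrite [LHS](law_on_probE P mA mY).
have mE : measurable (A `&` Y1 @^-1` B1).
  by apply: measurableI => //; rewrite -[X in measurable X]setTI; exact: mY1.
transitivity (P ((A `&` Y1 @^-1` B1) `&` Y2 @^-1` B2)).
  by rewrite -setIA; congr (P (_ `&` _)).
rewrite (@phi_tuple_law R b b_prime s d W P (A `&` Y1 @^-1` B1)) //; last 2 first.
- by move=> x a; exact: mZ.
- apply: (@uniform_digits_event _ _ _ _ _ _ _ A (Y1 @^-1` B1) (Q B1) Z) => //.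
  move=> B mB hB; apply: phi_tuple_law => // x a; exact: mZ.
rewrite uniform_tuple_law //; last 2 first.
- by move=> x a; exact: mZ.
- by apply: uniform_digits_reindex hZ; exact: inl_inj.
rewrite -muleA /m2 /= /mscale /=; congr (_ * _)%E.
by rewrite product_measure1E.
Qed.

Let integrable_prod (h h' : s.-tuple R -> R) :
  Q.-integrable setT (EFin \o h) -> Q.-integrable setT (EFin \o h') ->
  (Q \x Q)%E.-integrable setT (fun z => (h z.1 * h' z.2)%:E).
Proof.
move=> /[dup] ih /integrableP[mh hoo] /[dup] ih' /integrableP[mh' hoo'].
have mh1 : measurable_fun setT h by exact/measurable_EFinP.
have mh1' : measurable_fun setT h' by exact/measurable_EFinP.
apply/integrable12ltyP.
  apply/measurable_EFinP; apply: measurable_funM.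
    by apply: measurableT_comp => //; exact: measurable_fst.
  by apply: measurableT_comp => //; exact: measurable_snd.
have -> : (\int[Q]_x \int[Q]_y `|(h x * h' y)%:E|)%E =
    ((\int[Q]_x `|(h x)%:E|) * (\int[Q]_y `|(h' y)%:E|))%E.
  rewrite muleC -ge0_integralZl //.
  - apply: eq_integral => x _; rewrite muleC -ge0_integralZl //.
    + by apply: eq_integral => y _; rewrite EFinM abseM.
    + by apply: measurableT_comp.
  - exact: measurableT_comp.
  - exact: integral_ge0.
by rewrite lte_mul_pinfty // ?integral_ge0 // ge0_fin_numE ?integral_ge0.
Qed.

(** Fubini's theorem for the product law of the pair. *)
Lemma uniform_pair_integral (h h' : s.-tuple R -> R) :
  Q.-integrable setT (EFin \o h) -> Q.-integrable setT (EFin \o h') ->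
  P.-integrable A (fun w => (h (Y1 w) * h' (Y2 w))%:E) /\
  (\int[P]_(w in A) (h (Y1 w) * h' (Y2 w))%:E)%E =
  (pA * ((\int[Q]_y h y) * (\int[Q]_y h' y)))%:E.
Proof.
move=> ih ih'; have ip := integrable_prod ih ih'.
split; first exact: (law_transfer_integrable mA mY pA0 uniform_pair_law ip).
rewrite (law_transfer_integral mA mY pA0 uniform_pair_law ip) EFinM; congr (_ * _)%E.
rewrite -integral12_prod_meas1 // /fubini_F /=.
transitivity (\int[Q]_x ((h x)%:E * (\int[Q]_y h' y)%:E))%E.
  apply: eq_integral => x _; under eq_integral do rewrite EFinM.
  by rewrite integralZl // fineK // integrable_fin_num.
under eq_integral do rewrite muleC.
by rewrite integralZl // EFinM muleC; congr (_ * _)%E; rewrite fineK // integrable_fin_num.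
Qed.

End uniform_points.

Section uniform_point.
Variables (R : realType) (b s : nat).
Hypothesis b_prime : prime b.
Context d (W : measurableType d) (P : probability W R).
Variable A : set W.
Hypothesis mA : measurable A.
Local Notation Q := (@cube_uniform R s).
Variable Z : 'I_s * nat -> W -> 'F_b.
Hypotheses (mZ : measurable_digits Z) (hZ : uniform_digits P A Z).

Lemma uniform_point_integral (h : s.-tuple R -> R) :
  Q.-integrable setT (EFin \o h) ->
  P.-integrable A (fun w => (h (phi_tuple R Z w))%:E) /\
  (\int[P]_(w in A) (h (phi_tuple R Z w))%:E)%E = (fine (P A) * (\int[Q]_y h y))%:E.
Proof.
move=> ih.
have mY : measurable_fun setT (phi_tuple R Z) by exact: measurable_phi_tuple.
have pA0 : 0 <= fine (P A) by rewrite fine_ge0.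
have law B := @uniform_tuple_law R b s b_prime d W P A mA Z B mZ hZ.
split; first exact: (law_transfer_integrable mA mY pA0 law ih).
rewrite (law_transfer_integral mA mY pA0 law ih) EFinM; congr (_ * _)%E.
by rewrite fineK // integrable_fin_num.
Qed.

End uniform_point.

(** * The leading entries of a coarse scrambling *)

Section configuration.
Context d (W : measurableType d) (R : realType) (P : probability W R).
Variables (b s N : nat) (e : 'I_s -> nat).
Variables (D : 'I_N -> 'I_s -> W -> nat -> 'F_b)
          (M : 'I_N -> 'I_s -> W -> nat -> nat -> 'F_b).
Hypothesis cs : coarse_scrambling P e D M.
Hypothesis e_gt0 : forall j, (0 < e j)%N.
Variables (q : 'I_N) (K : nat).
Local Notation idx := (blk_idx e (fun=> K)).
Local Notation G := {ffun idx -> 'F_b}.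
Local Notation conf := (blk_matrices 'F_b K e * G)%type.

Lemma blk_row_inj (x y : idx) : tag x = tag y -> blk_row x = blk_row y -> x = y.
Proof.
case: x y => [j [k i]] [j' [k' i']] /= jj'; subst j'; rewrite /blk_row /= => h.
have ii : i = i' :> nat.
  by have := congr1 (modn^~ (e j)) h; rewrite /= !modnMDl !modn_small.
have kk : k = k' :> nat.
  by move: h; rewrite ii => /eqP; rewrite eqn_add2r eqn_pmul2r // => /eqP.
by rewrite (val_inj ii) (val_inj kk).
Qed.

(** The leading [K] blocks of one realization: all the randomness on which the
    digits in these blocks depend, as a point of a finite type. *)
Definition config (w : W) : conf :=
  ([ffun j => [ffun kl : 'I_K * 'I_K => mxblock_of (e j) (M q j w) kl.1 kl.2]] : blk_matrices 'F_b K e,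
   [ffun x : idx => D q (tag x) w (blk_row x)]).

Let atom := ('I_N * 'I_s * (nat + nat * nat))%type.

(* Indices of the independent entries and blocks that determine [config]; the
   blocks above the diagonal are left out, being 0. *)
Let atoms : seq atom :=
  [seq (q, tag x, inl (blk_row x)) | x <- enum {: idx}] ++
  [seq (q, y.1, inr (val y.2.1, val y.2.2)) | y : 'I_s * ('I_K * 'I_K) <-
     enum {: 'I_s * ('I_K * 'I_K)} & (y.2.2 <= y.2.1)%N].

Let uniq_atoms : uniq atoms.
Proof.
rewrite cat_uniq; apply/and3P; split.
- rewrite map_inj_uniq ?enum_uniq // => x y [h1 h2]; exact: blk_row_inj.
- by apply/hasPn => _ /mapP[y _ ->]; apply/negP => /mapP[x _].
- rewrite map_inj_uniq; first by rewrite filter_uniq // enum_uniq.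
  by move=> [j [k l]] [j' [k' l']] /= [-> /val_inj -> /val_inj ->].
Qed.

(* The default values stand for indices beyond [K] blocks, which do not occur in
   [atoms]. *)
Let shift_at (dl : G) (j : 'I_s) (k : nat) : 'F_b :=
  if [pick x : idx | (tag x == j) && (blk_row x == k)] is Some x then dl x else 0.

Let block_at (om : blk_matrices 'F_b K e) (j : 'I_s) (k l : nat) : 'M['F_b]_(e j) :=
  if (insub k, insub l) is (Some k', Some l') then om j (k', l') else 0.

Let atom_event (c : conf) (a : atom) : set W :=
  let: (q, j, x) := a in
  match x with
  | inl k => (fun w => D q j w k) @^-1` [set shift_at c.2 j k]
  | inr (k, l) => (fun w => mxblock_of (e j) (M q j w) k l) @^-1` [set block_at c.1 j k l]
  end.

Let shift_atE dl (x : idx) : shift_at dl (tag x) (blk_row x) = dl x.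
Proof.
rewrite /shift_at; case: pickP => [y /andP[/eqP h1 /eqP h2]|/(_ x)].
  by rewrite (blk_row_inj h1 h2).
by rewrite !eqxx.
Qed.

Let block_atE om j (k l : 'I_K) : block_at om j k l = om j (k, l).
Proof. by rewrite /block_at !valK. Qed.

Let lower (om : blk_matrices 'F_b K e) := forall j (k l : 'I_K), (k < l)%N -> om j (k, l) = 0.

Let scramblers_lower om : om \in scramblers 'F_b K e -> lower om.
Proof. by rewrite inE => /forallP omB j; have /blk_lowerP[] := omB j. Qed.

Let config_events (c : conf) : lower c.1 ->
  config @^-1` [set c] = \bigcap_(a in [set` atoms]) atom_event c a.
Proof.
case: c => om dl /= omB; apply/seteqP; split=> w /=.
  case=> /ffunP omE /ffunP dlE a /=; rewrite mem_cat => /orP[/mapP[x _ ->]|/mapP[[j [k l]] _ ->]] /=.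
    by rewrite shift_atE -dlE ffunE.
  rewrite block_atE; have := omE j; rewrite !ffunE => <-; by rewrite ffunE.
move=> h; congr pair; last first.
  apply/ffunP => x; rewrite ffunE -[RHS]shift_atE.
  by apply: (h (q, tag x, inl (blk_row x))); rewrite /= mem_cat map_f ?mem_enum.
apply/ffunP => j; apply/ffunP => -[k l]; rewrite !ffunE /=.
have [lk|kl] := leqP l k; last first.
  by rewrite omB //; exact: (cs_above cs).
rewrite -[RHS]block_atE; apply: (h (q, j, inr (val k, val l))).
rewrite /= mem_cat; apply/orP; right; apply/mapP; exists (j, (k, l)) => //.
by rewrite mem_filter /= lk mem_enum.
Qed.

Let measurable_atom_event (c : conf) a : a \in atoms -> measurable (atom_event c a).
Proof.
rewrite mem_cat => /orP[/mapP[x _ ->]|/mapP[[j [k l]] + ->]] /=.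
  by have [] := cs_shift cs q (tag x) (blk_row x) (shift_at c.2 (tag x) (blk_row x)).
rewrite mem_filter /= leq_eqVlt => /andP[/orP[/eqP lk|lk] _].
  by rewrite lk; have [] := cs_diag cs q k (block_at c.1 j k k).
by have [] := cs_below cs q lk (block_at c.1 j k l).
Qed.

Let atom_prob (a : atom) : R :=
  let: (q, j, x) := a in
  match x with
  | inl k => #|finset.setT : {set 'F_b}|%:R^-1
  | inr (k, l) => if k == l then #|[set A : 'M['F_b]_(e j) | A \in unitmx]%SET|%:R^-1
                  else #|finset.setT : {set 'M['F_b]_(e j)}|%:R^-1
  end.

Let config_prob_scrambler (c : conf) : c.1 \in scramblers 'F_b K e ->
  P (config @^-1` [set c]) = (\prod_(a <- atoms) atom_prob a)%:E.
Proof.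
move=> cB; rewrite config_events; last exact: scramblers_lower.
rewrite (cs_indep cs) //; last first.
  move=> [[q' j] [k|[k l]]] _ /=; [exists [set shift_at c.2 j k]|exists [set block_at c.1 j k l]] => //.
move: cB; rewrite inE => /forallP omB.
rewrite (big_morph EFin (fun x y => EFinM x y) (erefl 1%:E)).
apply: eq_big_seq => a; rewrite mem_cat => /orP[/mapP[x _ ->]|/mapP[[j [k l]] + ->]] /=.
  have [_ ->] := cs_shift cs q (tag x) (blk_row x) (shift_at c.2 (tag x) (blk_row x)).
  by rewrite inE.
rewrite mem_filter /= leq_eqVlt => /andP[/orP[/eqP lk|lk] _].
  rewrite lk eqxx; have [_ ->] := cs_diag cs q k (block_at c.1 j k k).
  by rewrite inE block_atE; have /blk_lowerP[-> _] := omB j.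
rewrite eq_sym (ltn_eqF lk); have [_ ->] := cs_below cs q lk (block_at c.1 j k l).
by rewrite inE.
Qed.

Let config_upper (c : conf) : ~ lower c.1 -> config @^-1` [set c] = set0.
Proof.
move=> nl; apply/seteqP; split=> w //= cE; case: nl => j k l kl.
by rewrite -cE /= !ffunE /=; exact: (cs_above cs).
Qed.

Lemma measurable_config (c : conf) : measurable (config @^-1` [set c]).
Proof.
have [cl|/config_upper -> //] := pselect (lower c.1).
rewrite config_events //; apply: fin_bigcap_measurable; first exact: finite_seq.
by move=> a /= aJ; exact: measurable_atom_event.
Qed.

Lemma measurable_config_in (B : {set conf}) : measurable [set w | config w \in B].
Proof.
rewrite (_ : [set w | _] = \bigcup_(c in [set c | c \in B]) config @^-1` [set c]).
  by apply: fin_bigcup_measurable; [exact: finite_finset|move=> c _; exact: measurable_config].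
apply/seteqP; split=> w /=; first by move=> h; exists (config w).
by move=> [c /= cB ->].
Qed.

Let config_prob_other (c : conf) : c.1 \notin scramblers 'F_b K e ->
  P (config @^-1` [set c]) = 0%E.
Proof.
move=> cN; have [cl|/config_upper ->] := pselect (lower c.1); last exact: measure0.
have [j [k nu]] : exists j k, c.1 j (k, k) \notin unitmx.
  move: cN; rewrite inE negb_forall => /existsP[j /forallPn[k]].
  rewrite negb_and => /orP[nu|]; first by exists j, k.
  by case/forallPn => l; rewrite negb_imply => /andP[kl]; rewrite cl ?eqxx.
have [mE PE] := cs_diag cs q k (c.1 j (k, k)).
apply/eqP; rewrite eq_le measure_ge0 andbT.
apply: le_trans (_ : P ((fun w => mxblock_of (e j) (M q j w) k k) @^-1` [set c.1 j (k, k)]) <= _)%E.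
  apply: le_measure; rewrite ?inE //; first exact: measurable_config.
  by move=> w /= <-; rewrite /config /= !ffunE.
by rewrite PE inE (negbTE nu).
Qed.

Let Om : {set conf} := [set c | c.1 \in scramblers 'F_b K e]%SET.

Let config_prob_seq (r : seq conf) : uniq r ->
  P [set w | config w \in r] = (\sum_(c <- r) P (config @^-1` [set c]))%E.
Proof.
elim: r => [_|c r IH /= /andP[cr ur]].
  by rewrite big_nil (_ : [set w | _] = set0) ?measure0 //; apply/seteqP; split.
rewrite big_cons -IH // -measureU.
- congr (P _); apply/seteqP; split=> w /=; rewrite inE.
    by move=> /predU1P[|]; [left|right].
  by case=> [->|->]; rewrite ?eqxx ?orbT.
- exact: measurable_config.
- rewrite (_ : [set w | _] = [set w | config w \in [set c | c \in r]%SET]); last first.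
    by apply/seteqP; split=> w /=; rewrite inE.
  exact: measurable_config_in.
- by apply/seteqP; split=> w //= [-> rc]; rewrite rc in cr.
Qed.

Let config_prob_count (B : {set conf}) :
  P [set w | config w \in B] = ((\prod_(a <- atoms) atom_prob a) * #|B :&: Om|%:R)%:E.
Proof.
rewrite (_ : [set w | _] = [set w | config w \in enum B]); last first.
  by apply/seteqP; split=> w /=; rewrite mem_enum.
rewrite config_prob_seq ?enum_uniq // big_enum /=.
transitivity (\sum_(c in B) ((c \in Om)%:R * \prod_(a <- atoms) atom_prob a)%:E)%E.
  apply: eq_bigr => c _; have [cB|cN] := boolP (c \in Om); rewrite inE in cB || rewrite inE in cN.
    by rewrite config_prob_scrambler // mul1r.
  by rewrite config_prob_other // mul0r.
rewrite sumEFin -mulr_suml mulrC; congr (_ * _)%:E.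
rewrite -natr_sum -sum1_card [in RHS]big_mkcond /= [in LHS]big_mkcond /=; congr (_%:R).
by apply: eq_bigr => c _; rewrite finset.in_setI; case: (c \in B); case: (c \in Om).
Qed.

(** All scramblers have the same probability, the product over [atoms], and the
    other values have probability 0; the total mass determines the former. *)
Lemma config_prob (B : {set conf}) :
  P [set w | config w \in B] = (#|B :&: Om|%:R / #|Om|%:R)%:E.
Proof.
have := config_prob_count finset.setT; rewrite finset.setTI.
rewrite (_ : [set w | _] = [set: W]); last by apply/seteqP; split=> w //= _; rewrite inE.
rewrite probability_setT => -[k1]; rewrite config_prob_count; congr EFin.
have Om0 : #|Om|%:R != 0 :> R.
  by apply: contra_eq_neq k1 => ->; rewrite mulr0 oner_neq0.
by rewrite mulrC; congr (_ * _); apply: (mulIf Om0); rewrite -k1 mulVf.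
Qed.

End configuration.

(** * Digits of the unscrambled points, and a criterion of uniformity *)

Section digits.
Variables (b : nat).
Hypothesis b_prime : prime b.

Lemma digits_inj m n n' : (n < b ^ m)%N -> (n' < b ^ m)%N ->
  (forall r, (r < m)%N -> digit b n r = digit b n' r) -> n = n'.
Proof.
have b0 : (0 < b)%N by exact: prime_gt0.
elim: m n n' => [|m IH] n n'; first by rewrite expn0; case: n n' => [|n] [|n'].
move=> nb n'b h; have h0 := h 0%N isT.
have m0 : (n %% b = n' %% b)%N.
  move: h0; rewrite /digit expn0 !divn1 => /(congr1 val).
  by rewrite /= !val_Fp_nat // !modn_mod.
have d0 : (n %/ b = n' %/ b)%N.
  apply: IH => [||r rm]; try by rewrite ltn_divLR // -expnSr.
  by have := h r.+1 rm; rewrite /digit expnS -!divnMA.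
by rewrite (divn_eq n b) (divn_eq n' b) m0 d0.
Qed.

Definition digit_vec m (n : nat) : {ffun 'I_m -> 'F_b} := [ffun r : 'I_m => digit b n r].

Lemma sum_digit_vec (V : nmodType) m (f : {ffun 'I_m -> 'F_b} -> V) :
  \sum_(n < b ^ m) f (digit_vec m n) = \sum_v f v.
Proof.
have inj : injective (fun n : 'I_(b ^ m) => digit_vec m n).
  move=> n n' /ffunP h; apply/val_inj/(@digits_inj m); [exact: ltn_ord|exact: ltn_ord|move=> r rm].
  by have := h (Ordinal rm); rewrite !ffunE.
have bij : bijective (fun n : 'I_(b ^ m) => digit_vec m n).
  by apply: inj_card_bij => //; rewrite card_ffun card_Fp // !card_ord.
by rewrite [RHS](reindex _ (onW_bij _ bij)).
Qed.

End digits.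

Section gns_vectors.
Variables (b s : nat) (S : gns b s).
Hypothesis b_prime : prime b.
Local Notation e := (gns_deg S).

Lemma gns_vecE m n j k : (n < b ^ m)%N ->
  gns_vec S n j k = \sum_(r < m) gns_matrix S j k r * digit_vec b m n r.
Proof.
move=> nm; under [RHS]eq_bigr do rewrite ffunE.
have z r : (n < b ^ r)%N -> digit b n r = 0 by move=> h; rewrite /digit divn_small // mod0n.
have nn : (n < b ^ n)%N by apply: ltn_expl; exact: prime_gt1.
have widen a c : (a <= c)%N -> (n < b ^ a)%N ->
    \sum_(r < a) gns_matrix S j k r * digit b n r = \sum_(r < c) gns_matrix S j k r * digit b n r.
  move=> ac na; rewrite (big_ord_widen c (fun r => gns_matrix S j k r * digit b n r) ac).
  rewrite big_mkcond; apply: eq_bigr => r _; case: ltnP => // ar.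
  by rewrite z ?mulr0 // (leq_trans na) // leq_exp2l ?prime_gt1.
rewrite /gns_vec (widen n (maxn n m)) ?leq_maxl // (widen m (maxn n m)) ?leq_maxr //.
Qed.

Definition point_vec K n : {ffun blk_idx e (fun=> K) -> 'F_b} :=
  [ffun x : blk_idx e (fun=> K) => gns_vec S n (tag x) (blk_row x)].

Lemma point_vecE K m n : (n < b ^ m)%N ->
  point_vec K n = gen_mul K e (gns_matrix S) (digit_vec b m n).
Proof. by move=> nm; apply/ffunP => x; rewrite !ffunE (gns_vecE _ _ nm). Qed.

(** Otherwise the [m * e j] leading rows of coordinate [j] are orthogonal to the
    difference of the digits of [n] and [n'], so their combinations take at most
    [b ^ m.-1] values.  As each value is taken at most [b ^ (m * e j - m)] times by
    [card_gns_kernel], there are fewer than [b ^ (m * e j)] combinations. *)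
Lemma gns_vec_separates m n n' j : (0 < m)%N -> (n < b ^ m)%N -> (n' < b ^ m)%N -> n != n' ->
  exists (l : 'I_m) (i : 'I_(e j)), gns_vec S n j (l * e j + i)%N != gns_vec S n' j (l * e j + i)%N.
Proof.
move=> m0 nm n'm nn'.
apply: contrapT => nex.
have h (l : 'I_m) (i : 'I_(e j)) : gns_vec S n j (l * e j + i)%N = gns_vec S n' j (l * e j + i)%N.
  by apply/eqP; apply: contraT => ne; case: nex; exists l, i.
pose dl := digit_vec b m n - digit_vec b m n'.
have dl0 : dl != 0.
  apply: contra nn' => /eqP/ffunP d0; apply/eqP/(digits_inj b_prime nm n'm) => r rm.
  by have := d0 (Ordinal rm); rewrite !ffunE => /eqP; rewrite subr_eq0 => /eqP.
pose ell (j' : 'I_s) := if j' == j then m else 0%N.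
pose phia (a : {ffun blk_idx e ell -> 'F_b}) : {ffun 'I_m -> 'F_b} :=
  [ffun r : 'I_m => \sum_x a x * gns_matrix_row x r].
pose Ker := [set a : {ffun blk_idx e ell -> 'F_b} |
      [forall r : 'I_m, (\sum_x a x * gns_matrix_row x r == 0)%R]]%SET.
have rowE (x : blk_idx e ell) : \sum_(r < m) gns_matrix_row x r * dl r = 0.
  case: x => j' [l i]; have jj' : j' = j.
    by apply/eqP; apply: contraT => ne; move: (l); rewrite /ell (negbTE ne) => -[].
  subst j'; have lm : (l < m)%N by apply: leq_trans (ltn_ord l) _; rewrite /ell eqxx.
  have := h (Ordinal lm) i; rewrite !(gns_vecE _ _ nm) !(gns_vecE _ _ n'm) => /eqP.
  rewrite -subr_eq0 -sumrB => /eqP h'; rewrite /gns_matrix_row /blk_row /= -[RHS]h'.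
  by apply: eq_bigr => r _; rewrite !ffunE -mulrBr.
have orth a : dot (phia a) dl = 0.
  rewrite /dot; under eq_bigr do rewrite ffunE mulr_suml.
  rewrite exchange_big big1 // => x _ /=.
  by under eq_bigr do rewrite -mulrA; rewrite -mulr_sumr rowE mulr0.
have phiaB a a' : phia (a - a') = phia a - phia a'.
  by apply/ffunP => r; rewrite !ffunE -sumrB; apply: eq_bigr => x _; rewrite !ffunE mulrBl.
have fiber y : (#|[set a | phia a == y]%SET| <= #|Ker|)%N.
  have [->|/finset.set0Pn[a0]] := eqVneq [set a | phia a == y]%SET finset.set0; first by rewrite cards0.
  rewrite inE => /eqP a0y; rewrite -(card_imset _ (addIr (- a0))).
  apply/subset_leq_card/fintype.subsetP => _ /imsetP[a + ->]; rewrite !inE => /eqP ay.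
  apply/forallP => r; have /ffunP/(_ r) := phiaB a a0; rewrite ay a0y subrr !ffunE => ->.
  exact: eqxx.
have T_def : (\sum_j' ell j' * e j' = m * e j)%N.
  by rewrite (bigD1 j) //= /ell eqxx big1 ?addn0 // => j' /negbTE ->.
have ker := card_gns_kernel S ell m b_prime; rewrite T_def -/Ker in ker.
have e0 := gns_deg_gt0 S j; have mT : (m <= m * e j)%N by rewrite leq_pmulr.
have b1 := prime_gt1 b_prime.
have hyp : (#|[set y | (dot y dl == 0)%R]%SET| = b ^ m.-1)%N.
  have := card_hyperplane 0 dl0; rewrite card_ffun card_Fp // card_ord.
  have -> : (b ^ m = b ^ m.-1 * b)%N by rewrite -expnSr prednK.
  by move/eqP; rewrite eqn_pmul2r ?prime_gt0 // => /eqP.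
suff : (b ^ (m * e j) <= b ^ m.-1 * b ^ (m * e j - m))%N.
  rewrite -expnD leq_exp2l //; move: m0 mT; clear; case: m => // m _; move: (m.+1 * e j)%N => T; lia.
have cA : #|{ffun blk_idx e ell -> 'F_b}| = (b ^ (m * e j))%N.
  rewrite card_ffun card_Fp // -T_def; congr (_ ^ _)%N.
  rewrite -sum1_card sum_blk; apply: eq_bigr => j' _.
  by rewrite !sum_nat_const !card_ord muln1.
rewrite -cA -hyp -[X in (X <= _)%N]sum1_card
    (partition_big phia (mem [set y | (dot y dl == 0)%R]%SET)) /=; last first.
  by move=> a _; rewrite inE orth.
rewrite -sum_nat_const; apply: leq_sum => y _; rewrite sum1_card.
apply: leq_trans ker; apply: leq_trans (fiber y).
by apply/subset_leq_card/fintype.subsetP => a; rewrite inE.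
Qed.

End gns_vectors.

Lemma sum_ord_mul (V : nmodType) a e (f : nat -> V) :
  \sum_(l < a * e) f l = \sum_(k < a) \sum_(i < e) f (k * e + i)%N.
Proof.
elim: a => [|a IH]; first by rewrite mul0n !big_ord0.
by rewrite mulSnr big_split_ord /= IH big_ord_recr.
Qed.

Section uniform_criterion.
Context d (W : measurableType d) (R : realType) (P : probability W R).

Lemma measure_fibers (T : finType) (X : W -> T) (A : set W) :
  measurable A -> (forall c, measurable (X @^-1` [set c])) ->
  P A = (\sum_c P (A `&` X @^-1` [set c]))%E.
Proof.
move=> mA mX; have mE c : measurable (A `&` X @^-1` [set c]) by exact: measurableI.
have mr (r : seq T) : measurable (A `&` [set w | X w \in r]).
  apply: measurableI => //; elim: r => [|c r IH].
    by rewrite (_ : [set w | _] = set0) //; apply/seteqP; split.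
  rewrite (_ : [set w | _] = X @^-1` [set c] `|` [set w | X w \in r]); first exact: measurableU.
  apply/seteqP; split=> w /=; rewrite inE; first by move=> /predU1P[|]; [left|right].
  by case=> [->|->]; rewrite ?eqxx ?orbT.
suff h (r : seq T) : uniq r ->
    P (A `&` [set w | X w \in r]) = (\sum_(c <- r) P (A `&` X @^-1` [set c]))%E.
  rewrite -big_enum /= -h ?enum_uniq //; congr (P _); apply/seteqP; split=> w; last by case.
  by move=> Aw; split=> //=; rewrite mem_enum.
elim: r => [_|c r IH /= /andP[cr ur]].
  by rewrite big_nil (_ : A `&` _ = set0) ?measure0 //; apply/seteqP; split=> w // [].
rewrite big_cons -IH // -measureU //.
  congr (P _); rewrite -setIUr; congr (_ `&` _); apply/seteqP; split=> w /=; rewrite inE.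
    by move=> /predU1P[|]; [left|right].
  by case=> [->|->]; rewrite ?eqxx ?orbT.
by apply/seteqP; split=> w //= [[_ ->] [_ rc]]; rewrite rc in cr.
Qed.

Variable F : finFieldType.

(** Applied to a translation and to its inverse, the hypothesis makes the values of
    one digit equally likely given the others, and their probabilities add up.
    An inequality is what an injection between configurations provides. *)
Lemma uniform_digits_translate (X : eqType) (A : set W) (Z : X -> W -> F) :
  measurable A -> measurable_digits Z ->
  (forall (J : seq (X * F)) (x : X) (a t : F), x \notin map fst J ->
    (P (A `&` digit_event Z ((x, a) :: J)) <= P (A `&` digit_event Z ((x, (a + t)%R) :: J)))%E) ->
  uniform_digits P A Z.
Proof.
move=> mA mZ shift; elim=> [_|[x a] J IH /= /andP[xJ uJ]].
  rewrite (_ : digit_event Z [::] = setT) ?setIT; last by apply/seteqP; split.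
  by rewrite expr0 invr1 mule1.
have mE L : measurable (A `&` digit_event Z L).
  by apply: measurableI => //; exact: measurable_digit_event.
have eqP' c : P (A `&` digit_event Z ((x, c) :: J)) = P (A `&` digit_event Z ((x, a) :: J)).
  apply/eqP; rewrite eq_le; apply/andP; split.
    by have := shift J x c (a - c) xJ; rewrite addrC subrK.
  by have := shift J x a (c - a) xJ; rewrite addrC subrK.
have q0 : #|F|%:R != 0 :> R by rewrite pnatr_eq0 -lt0n; apply/card_gt0P; exists 0.
have total : (P (A `&` digit_event Z J) = \sum_(c : F) P (A `&` digit_event Z ((x, a) :: J)))%E.
  rewrite (measure_fibers (mE J) (mZ x)).
  apply: eq_bigr => c _; rewrite -(eqP' c) -setIA; congr (P (_ `&` _)).
  apply/seteqP; split=> w /=; rewrite /digit_event /=; first by move=> [-> ->]; rewrite eqxx.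
  by move=> /andP[/eqP -> ->].
rewrite exprSr invfM EFinM muleA -IH // total.
have [r ->] : exists r, P (A `&` digit_event Z ((x, a) :: J)) = r%:E.
  by exists (fine (P (A `&` digit_event Z ((x, a) :: J)))); rewrite fineK // fin_num_measure.
by rewrite sumEFin sumr_const -EFinM -[_ *+ _]mulr_natr mulfK.
Qed.

End uniform_criterion.

(** * Uniformity of the scrambled digits *)

Section scrambled_digits.
Context d (W : measurableType d) (R : realType) (P : probability W R).
Variables (b s N : nat) (S : gns b s).
Hypothesis b_prime : prime b.
Local Notation e := (gns_deg S).
Variables (D : 'I_N -> 'I_s -> W -> nat -> 'F_b)
          (M : 'I_N -> 'I_s -> W -> nat -> nat -> 'F_b).
Hypothesis cs : coarse_scrambling P e D M.
Variable q : 'I_N.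

Let e_gt0 j : (0 < e j)%N := gns_deg_gt0 S j.

Definition sdigit (n : nat) (x : 'I_s * nat) (w : W) : 'F_b :=
  scramble (e x.1) (M q x.1 w) (D q x.1 w) (gns_vec S n x.1) x.2.

Local Notation conf K := (blk_matrices 'F_b K e * {ffun blk_idx e (fun=> K) -> 'F_b})%type.
Local Notation config K w := (config e D M q K w).

(** The scrambling matrix is block lower triangular, so the digits of the first [K]
    blocks depend on the first [K] blocks only. *)
Lemma sdigit_config K n (x : blk_idx e (fun=> K)) w :
  sdigit n (tag x, blk_row x) w = config_point (config K w) (point_vec S K n) x.
Proof.
case: x => j [k i]; rewrite /sdigit /scramble /config_point /blk_row /= !ffunE /blk_row /=;
  congr (_ + _).
rewrite divnMDl // divn_small // addn0.
rewrite (sum_ord_mul k.+1 (e j) (fun l => M q j w (k * e j + i)%N l * gns_vec S n j l)).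
rewrite (big_ord_widen K (fun l => \sum_(i' < e j) M q j w (k * e j + i)%N (l * e j + i')%N *
  gns_vec S n j (l * e j + i')%N)) // big_mkcond; apply: eq_bigr => l _ /=.
rewrite !ffunE /= ltnS; case: leqP => [lk|kl].
  by apply: eq_bigr => i' _; rewrite mxE ffunE.
by rewrite (cs_above cs) // big1 // => i' _; rewrite mxE mul0r.
Qed.

Lemma blk_ofP K (j : 'I_s) k : (k < K * e j)%N ->
  exists x : blk_idx e (fun=> K), tag x = j /\ blk_row x = k.
Proof.
move=> kK; have k1 : (k %/ e j < K)%N by rewrite ltn_divLR.
have k2 : (k %% e j < e j)%N by rewrite ltn_mod.
exists (@blk_mk _ e (fun=> K) j (Ordinal k1) (Ordinal k2)); split=> //.
by rewrite /blk_row /= -divn_eq.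
Qed.

(* The default value is used only for rows beyond the [K] blocks. *)
Let cdigit K n (x : 'I_s * nat) (c : conf K) : 'F_b :=
  if [pick y : blk_idx e (fun=> K) | (tag y == x.1) && (blk_row y == x.2)] is Some y
  then config_point c (point_vec S K n) y else 0.

Let cdigit_blk K n (y : blk_idx e (fun=> K)) c :
  cdigit n (tag y, blk_row y) c = config_point c (point_vec S K n) y.
Proof.
rewrite /cdigit; case: pickP => [y' /andP[/eqP h1 /eqP h2]|/(_ y)].
  by rewrite (blk_row_inj e_gt0 h1 h2).
by rewrite !eqxx.
Qed.

Let cdigitE K n (x : 'I_s * nat) w : (x.2 < K * e x.1)%N ->
  sdigit n x w = cdigit n x (config K w).
Proof.
case: x => j k /= /blk_ofP[y [<- <-]].
by rewrite cdigit_blk sdigit_config.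
Qed.

Lemma measurable_sdigit n : measurable_digits (sdigit n).
Proof.
move=> [j k] a; have kK : (k < k.+1 * e j)%N by rewrite (leq_trans (ltnSn k)) // leq_pmulr.
rewrite (_ : _ @^-1` _ = [set w | config k.+1 w \in [set c | cdigit n (j, k) c == a]%SET]).
  exact: (measurable_config_in cs e_gt0).
by apply/seteqP; split=> w /=; rewrite inE (@cdigitE k.+1 n (j, k) w kK);
    [move=> ->; rewrite eqxx|move=> /eqP].
Qed.

Let config_le K (B B' : {set conf K}) (h : conf K -> conf K) : injective h ->
  (forall c, c.1 \in scramblers 'F_b K e -> (h c).1 \in scramblers 'F_b K e) ->
  (forall c, c \in B -> h c \in B') ->
  (P [set w | config K w \in B] <= P [set w | config K w \in B'])%E.
Proof.
move=> hi hs hB; rewrite !(config_prob cs e_gt0) lee_fin ler_wpM2r ?invr_ge0 // ler_nat.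
rewrite -(card_imset _ hi); apply/subset_leq_card/fintype.subsetP => _ /imsetP[c + ->].
rewrite finset.in_setI => /andP[/hB hcB]; rewrite [c \in _]inE => /hs hcs.
by rewrite finset.in_setI hcB inE.
Qed.

Let row_bound (X : eqType) (f : X -> nat) (J : seq (X * 'F_b)) :
  exists K, forall p, p \in J -> (f p.1 < K)%N.
Proof.
elim: J => [|p J [K IH]]; first by exists 0%N.
exists (maxn K (f p.1).+1) => p'; rewrite inE => /predU1P[->|/IH h].
  by rewrite leq_max leqnn orbT.
by rewrite leq_max h.
Qed.

Let row_lt (x : 'I_s * nat) K : (x.2 < K)%N -> (x.2 < K * e x.1)%N.
Proof. by move=> h; rewrite (leq_trans h) // leq_pmulr. Qed.

(** The shift alone translates any single digit. *)
Lemma sdigit_uniform n : uniform_digits P setT (sdigit n).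
Proof.
apply: uniform_digits_translate => //; first exact: measurable_sdigit.
move=> J x a t xJ.
have [K0 K0P] := row_bound (fun x : 'I_s * nat => x.2) ((x, a) :: J).
have [y [yx yk]] := blk_ofP (row_lt (K0P (x, a) (mem_head _ _))).
pose B c' := [set c : conf K0 | all (fun p => cdigit n p.1 c == p.2) ((x, c') :: J)]%SET.
have BE c' : setT `&` digit_event (sdigit n) ((x, c') :: J) = [set w | config K0 w \in B c'].
  rewrite setTI; apply/seteqP; split=> w /=; rewrite inE /digit_event /= => /andP[h1 h2].
    rewrite -cdigitE ?h1 ?(row_lt (K0P (x, a) (mem_head _ _))) //=.
    rewrite -(eq_in_all (a1 := fun p => sdigit n p.1 w == p.2)) // => p pJ.
    by rewrite -cdigitE // row_lt // K0P // inE pJ orbT.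
  rewrite (cdigitE _ _ (row_lt (K0P (x, a) (mem_head _ _)))) h1 /=.
  rewrite (eq_in_all (a2 := fun p => cdigit n p.1 (config K0 w) == p.2)) // => p pJ.
  by rewrite -cdigitE // row_lt // K0P // inE pJ orbT.
rewrite !BE; have [h [hi hs hE]] := digit_shift_one (point_vec S K0 n) y t.
apply: (config_le hi hs) => c; rewrite !inE /= => /andP[xa Jc].
have xE c0 : cdigit n x c0 = config_point c0 (point_vec S K0 n) y.
  by rewrite -cdigit_blk yx yk -surjective_pairing.
have hE' c0 z : config_point (h c0) (point_vec S K0 n) z =
    config_point c0 (point_vec S K0 n) z + (if z == y then t else 0).
  by rewrite hE [LHS]ffunE; congr (_ + _); rewrite ffunE.
rewrite xE hE' eqxx; move: xa; rewrite xE => /eqP ->; rewrite eqxx /=.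
apply/allP => p pJ; have [y' [y'x y'k]] := blk_ofP (row_lt (K0P p (mem_behead (s := (x, a) :: J) pJ))).
have pE c0 : cdigit n p.1 c0 = config_point c0 (point_vec S K0 n) y'.
  by rewrite -cdigit_blk y'x y'k -surjective_pairing.
rewrite pE hE'; have := allP Jc p pJ; rewrite pE => /eqP ->.
case: (y' =P y) => [yy|_]; last by rewrite addr0.
case/negP: xJ; apply/mapP; exists p => //.
by rewrite [LHS]surjective_pairing [RHS]surjective_pairing -yx -yk -y'x -y'k yy.
Qed.


Section pair.
Variable m : nat.
Hypothesis m_gt0 : (0 < m)%N.

Let shift_pair K n n' (j : 'I_s) r (t : 'F_b) : (m <= K)%N -> (n < b ^ m)%N -> (n' < b ^ m)%N ->
  n != n' ->
  (r < K * e j)%N -> (m * e j <= r)%N ->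
  exists h : conf K -> conf K, [/\ injective h,
    forall c, c.1 \in scramblers 'F_b K e -> (h c).1 \in scramblers 'F_b K e &
    forall c (z : 'I_s * nat), (z.2 < K * e z.1)%N ->
      cdigit n z (h c) = cdigit n z c + (if z == (j, r) then t else 0) /\
      cdigit n' z (h c) = cdigit n' z c].
Proof.
move=> mK nm n'm nn' rK rm; have [y [yj yr]] := blk_ofP rK.
have [l [i li]] := gns_vec_separates S b_prime (tag y) m_gt0 nm n'm nn'.
have lK : (l < K)%N by rewrite (leq_trans _ mK).
have lev : (Ordinal lK < (tagged y).1)%N.
  apply: leq_trans (ltn_ord l) _; rewrite leqNgt; apply/negP => ym.
  move: rm; rewrite -yr -yj /blk_row leqNgt => /negP[].
  apply: (@leq_trans ((tagged y).1.+1 * e (tag y))); last by rewrite leq_mul2r ym orbT.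
  by rewrite mulSnr ltn_add2l.
have vv : point_vec S K n (@blk_mk _ e (fun=> K) (tag y) (Ordinal lK) i) !=
    point_vec S K n' (@blk_mk _ e (fun=> K) (tag y) (Ordinal lK) i).
  by rewrite !ffunE /blk_row /=.
have [h [hi hs hE]] := digit_shift_pair t lev vv.
exists h; split=> // c z /blk_ofP[y' [y'x y'k]].
rewrite (surjective_pairing z) -y'x -y'k !cdigit_blk; have [-> ->] := hE c; split=> //.
rewrite [LHS]ffunE; congr (_ + _); rewrite ffunE -yj -yr; congr (if _ then _ else _).
apply/eqP/eqP => [->//|[h1 h2]]; exact: (blk_row_inj e_gt0).
Qed.

Variables (n n' : nat).
Hypotheses (nm : (n < b ^ m)%N) (n'm : (n' < b ^ m)%N) (nn' : n != n').
Variables c c' : {ffun blk_idx e (fun=> m) -> 'F_b}.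

Definition prefix_pair_event : set W :=
  [set w | config_point (config m w) (point_vec S m n) = c /\
           config_point (config m w) (point_vec S m n') = c'].

Lemma measurable_prefix_pair_event : measurable prefix_pair_event.
Proof.
rewrite (_ : prefix_pair_event = [set w | config m w \in
  [set cf | (config_point cf (point_vec S m n) == c) &&
      (config_point cf (point_vec S m n') == c')]%SET]).
  exact: (measurable_config_in cs e_gt0).
apply/seteqP; split=> w /=; rewrite inE.
  by move=> [h1 h2]; apply/andP; split; apply/eqP.
by move=> /andP[/eqP h1 /eqP h2]; split.
Qed.

Let loc (x : 'I_s * nat) : 'I_s * nat := (x.1, (m * e x.1 + x.2)%N).

(** Both points share one index type, so that [uniform_digits] states their joint
    uniformity. *)
Definition tail_digits (x : ('I_s * nat) + ('I_s * nat)) : W -> 'F_b :=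
  match x with
  | inl x => sdigit n (x.1, (m * e x.1 + x.2)%N)
  | inr x => sdigit n' (x.1, (m * e x.1 + x.2)%N)
  end.

Lemma measurable_tail_digits : measurable_digits tail_digits.
Proof. by move=> [x|x] a; exact: measurable_sdigit. Qed.

Let ctail K (x : ('I_s * nat) + ('I_s * nat)) (cf : conf K) : 'F_b :=
  match x with inl x => cdigit n (loc x) cf | inr x => cdigit n' (loc x) cf end.

Let base (x : ('I_s * nat) + ('I_s * nat)) : 'I_s * nat := match x with inl x => x | inr x => x end.

Let loc_lt x K : (x.2 < K)%N -> ((loc x).2 < (m + K) * e (loc x).1)%N.
Proof. by move=> h; rewrite /loc /= mulnDl ltn_add2l row_lt. Qed.

Let prefix_in K (cf : conf K) : bool :=
  [forall z : blk_idx e (fun=> m), (cdigit n (tag z, blk_row z) cf == c z) &&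
     (cdigit n' (tag z, blk_row z) cf == c' z)].

Let blk_row_lt (z : blk_idx e (fun=> m)) K : (m <= K)%N -> (blk_row z < K * e (tag z))%N.
Proof.
move=> mK; case: z => j [k i]; rewrite /blk_row /=.
apply: (@leq_trans (k.+1 * e j)); first by rewrite mulSnr ltn_add2l.
by rewrite leq_mul2r (leq_trans _ mK) ?orbT.
Qed.

Let prefix_eventE K w : (m <= K)%N -> prefix_pair_event w <-> prefix_in (config K w).
Proof.
move=> mK; split=> [[h1 h2]|/forallP h].
  apply/forallP => z; rewrite -!cdigitE ?(blk_row_lt z mK) //.
  by rewrite !sdigit_config h1 h2 !eqxx.
split; apply/ffunP => z; have := h z; rewrite -!cdigitE ?(blk_row_lt z mK) //.
  by rewrite -sdigit_config => /andP[/eqP].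
by rewrite -sdigit_config => /andP[_ /eqP].
Qed.

(** A tail digit of either point is translated alone by [digit_shift_pair], applied
    in a block where the two points differ; this block is one of the first [m],
    hence to the left of the row of that digit.  The prefixes are unchanged. *)
Lemma tail_digits_uniform : uniform_digits P prefix_pair_event tail_digits.
Proof.
apply: uniform_digits_translate.
- exact: measurable_prefix_pair_event.
- exact: measurable_tail_digits.
move=> J x a t xJ.
have [K0 K0P] := row_bound (fun x => (base x).2) ((x, a) :: J).
pose K := (m + K0)%N; have mK : (m <= K)%N by exact: leq_addr.
have tailE p w : p \in (x, a) :: J -> tail_digits p.1 w = ctail p.1 (config K w).
  by move=> /K0P; case: p => -[p|p] a' /= h; apply: (@cdigitE K); exact: loc_lt.
pose B c0 := [set cf : conf K | prefix_in cf && all (fun p => ctail p.1 cf == p.2) ((x, c0) :: J)]%SET.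
have BE c0 : prefix_pair_event `&` digit_event tail_digits ((x, c0) :: J) =
    [set w | config K w \in B c0].
  have aE w : all (fun p => tail_digits p.1 w == p.2) J = all (fun p => ctail p.1 (config K w) == p.2) J.
    by apply: eq_in_all => p pJ; rewrite tailE // inE pJ orbT.
  apply/seteqP; split=> w /=; rewrite inE /digit_event /= -(tailE (x, a)) ?mem_head // -aE.
    by move=> [/(prefix_eventE w mK) -> ->].
  by move=> /andP[/(prefix_eventE w mK)].
rewrite !BE.
have [h [hi hs hE1 hE2]] : exists h : conf K -> conf K, [/\ injective h,
    forall c, c.1 \in scramblers 'F_b K e -> (h c).1 \in scramblers 'F_b K e,
    forall cf y, ((base y).2 < K0)%N -> ctail y (h cf) = ctail y cf + (if y == x then t else 0) &
    forall cf, prefix_in cf -> prefix_in (h cf)].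
  have xK0 : ((base x).2 < K0)%N by exact: (K0P (x, a) (mem_head _ _)).
  have loc_eq (y y' : 'I_s * nat) : (loc y == loc y') = (y == y').
    case: y y' => [j k] [j' k']; rewrite /loc /= !xpair_eqE.
    by case: (j =P j') => [->|//]; rewrite eqn_add2l.
  have low (z : blk_idx e (fun=> m)) y : ((tag z, blk_row z) == loc y) = false.
    apply/negP => /eqP zy; have := blk_row_lt z (leqnn m).
    have -> : blk_row z = (loc y).2 by rewrite -zy.
    have -> : tag z = (loc y).1 by rewrite -zy.
    by rewrite /loc /= ltnNge leq_addr.
  case: x xK0 {xJ K0P tailE B BE} => x /= xK0; have xm : (m * e x.1 <= (loc x).2)%N by exact: leq_addr.
    have [h [hi hs hE]] := shift_pair t mK nm n'm nn' (loc_lt xK0) xm.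
    exists h; split=> // [cf [y|y] yK|cf /forallP pcf].
    - by rewrite /=; have [-> _] := hE cf (loc y) (loc_lt yK); rewrite -[(x.1, _)]/(loc x) loc_eq.
    - by rewrite /=; have [_ ->] := hE cf (loc y) (loc_lt yK); rewrite addr0.
    - apply/forallP => z; have [-> ->] := hE cf (tag z, blk_row z) (blk_row_lt z mK).
      by rewrite -[(x.1, _)]/(loc x) low addr0 pcf.
  have n'n : n' != n by rewrite eq_sym.
  have [h [hi hs hE]] := shift_pair t mK n'm nm n'n (loc_lt xK0) xm.
  exists h; split=> // [cf [y|y] yK|cf /forallP pcf].
  - by rewrite /=; have [_ ->] := hE cf (loc y) (loc_lt yK); rewrite addr0.
  - by rewrite /=; have [-> _] := hE cf (loc y) (loc_lt yK); rewrite -[(x.1, _)]/(loc x) loc_eq.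
  - apply/forallP => z; have [-> ->] := hE cf (tag z, blk_row z) (blk_row_lt z mK).
    by rewrite -[(x.1, _)]/(loc x) low addr0 pcf.
apply: (config_le hi hs) => cf; rewrite !inE /= => /andP[/hE2 -> /andP[xa Jc]] /=.
rewrite hE1 ?(K0P (x, a) (mem_head _ _)) // eqxx (eqP xa) eqxx /=.
apply/allP => p pJ; have pK := K0P p (mem_behead (s := (x, a) :: J) pJ).
rewrite hE1 // (eqP (allP Jc p pJ)); case: (p.1 =P x) => [px|_]; last by rewrite addr0.
by case/negP: xJ; apply/mapP; exists p.
Qed.

End pair.

End scrambled_digits.

(** * Integrals over fibers, and medians *)

Section integral_helpers.
Context d (W : measurableType d) (R : realType).

Lemma integral_fibers (P : {measure set W -> \bar R}) (T : finType) (X : W -> T) (f : W -> R) :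
  (forall c, measurable (X @^-1` [set c])) -> measurable_fun setT f ->
  (\int[P]_w (f w)%:E = \sum_c \int[P]_(w in X @^-1` [set c]) (f w)%:E)%E.
Proof.
move=> mX mf.
have DE : \big[setU/set0]_(c <- index_enum T) (X @^-1` [set c]) = setT.
  by rewrite -bigcup_seq; apply/seteqP; split=> w // _; exists (X w) => //=; exact: mem_index_enum.
rewrite -integral_bigsetU_EFin ?DE //; first exact: index_enum_uniq.
  by move=> c c' _ _ [w [/= <- <-]].
exact/measurable_EFinP.
Qed.

(** The integral of a nonnegative function, measurable or not, is the supremum of
    the integrals of the simple functions below it.  This applies to the error of
    the median. *)
Lemma ge0_le_integralT (P : {measure set W -> \bar R}) (f g : W -> \bar R) :
  (forall w, 0 <= f w)%E -> (forall w, f w <= g w)%E ->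
  (\int[P]_w f w <= \int[P]_w g w)%E.
Proof.
move=> f0 fg; have g0 w : (0 <= g w)%E by apply: le_trans (fg w).
rewrite !ge0_integralTE //; apply: le_ereal_sup => _ [h hf <-].
by exists h => // w; apply: le_trans (fg w).
Qed.

End integral_helpers.

Section median.
Variable R : realType.

(** If [a] is at most the median, then the upper half of the values, the median
    included, is at least as far from [a]; otherwise the lower half is. *)
Lemma median_sqr_le (x : seq R) (a : R) : odd (size x) ->
  ((size x)./2.+1)%:R * (median x - a) ^+ 2 <= \sum_(y <- x) (y - a) ^+ 2.
Proof.
move=> ox; set k := (size x)./2.
have sz : size x = k.*2.+1 by rewrite -[LHS]odd_double_half ox.
pose y := sort <=%R x; have sy : size y = k.*2.+1 by rewrite size_sort.
have ys : sorted <=%R y by apply: sort_sorted; exact: le_total.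
rewrite (perm_big y) /=; last by rewrite perm_sym perm_sort.
rewrite (big_nth 0) sy big_mkord -/k.
have medE : median x = nth 0 y k by [].
have mono i j : (i <= j)%N -> (j < k.*2.+1)%N -> nth 0 y i <= nth 0 y j.
  move=> ij jk; apply: (sorted_leq_nth le_trans (fun=> lexx _)) => //; rewrite inE sy //.
  exact: leq_ltn_trans jk.
have half (h : 'I_k.+1 -> 'I_k.*2.+1) : injective h ->
    (forall i, (median x - a) ^+ 2 <= (nth 0 y (h i) - a) ^+ 2) ->
    k.+1%:R * (median x - a) ^+ 2 <= \sum_(i < k.*2.+1) (nth 0 y i - a) ^+ 2.
  move=> hi hle; apply: (@le_trans _ _
      (\sum_(i in [set h i | i in finset.setT]%SET) (nth 0 y i - a) ^+ 2)).
    rewrite big_imset /=; last by move=> i j _ _; exact: hi.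
    rewrite mulr_natl; have -> : (median x - a) ^+ 2 *+ k.+1 =
        \sum_(i in [set: 'I_k.+1]%SET) (median x - a) ^+ 2.
      by rewrite sumr_const cardsT card_ord.
    by apply: ler_sum => i _.
  rewrite [leRHS](bigID (mem [set h i | i in finset.setT]%SET)) /= lerDl.
  by apply: sumr_ge0 => i _; exact: sqr_ge0.
case: (leP a (median x)) => am.
  have hk (i : 'I_k.+1) : (k + i < k.*2.+1)%N by rewrite -addnn ltnS leq_add2l -ltnS.
  apply: (half (fun i => Ordinal (hk i))) => [i j /(congr1 val) /= /eqP|i].
    by rewrite eqn_add2l => /eqP /val_inj.
  rewrite ler_sqr ?nnegrE ?subr_ge0 //.
    by rewrite lerD2r medE mono // leq_addr.
  by apply: le_trans am _; rewrite medE mono // leq_addr.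
have hk (i : 'I_k.+1) : (i < k.*2.+1)%N by rewrite (leq_trans (ltn_ord i)) // ltnS -addnn leq_addr.
apply: (half (fun i => Ordinal (hk i))) => [i j /(congr1 val) /= /val_inj //|i].
have ik : nth 0 y i <= median x by rewrite medE mono // ?ltnS -?addnn ?leq_addr // -ltnS.
rewrite -sqrrN -[leRHS]sqrrN !opprB ler_sqr ?nnegrE ?subr_ge0 //=.
- by rewrite lerD2l lerN2.
- exact: ltW.
- by apply: le_trans ik _; exact: ltW.
Qed.

End median.

(** * The second moment of one scrambled estimate *)

(** By domination: [`|x| <= 1 + x ^+ 2]. *)
Lemma integrable_of_sqr d (T : measurableType d) (R : realType) (Q : probability T R) (h : T -> R) :
  measurable_fun setT h -> Q.-integrable setT (EFin \o (fun y => h y ^+ 2)) ->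
  Q.-integrable setT (EFin \o h).
Proof.
move=> mh ih2.
have i1 : Q.-integrable setT (EFin \o (fun _ => 1 : R)) by exact: finite_measure_integrable_cst.
apply: le_integrable (integrableD measurableT i1 ih2) => //; first exact/measurable_EFinP.
move=> y _; rewrite /= lee_fin [leRHS]ger0_norm ?addr_ge0 ?sqr_ge0 //.
rewrite -[h y ^+ 2]real_normK ?num_real //.
have := sqr_ge0 (`|h y| - 1); have := normr_ge0 (h y); nra.
Qed.

(** Integrate the square of [h] minus its mean. *)
Lemma Rintegral_sqr_le d (T : measurableType d) (R : realType) (Q : probability T R) (h : T -> R) :
  Q.-integrable setT (EFin \o h) -> Q.-integrable setT (EFin \o (fun y => h y ^+ 2)) ->
  (\int[Q]_y h y) ^+ 2 <= \int[Q]_y (h y ^+ 2).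
Proof.
move=> ih ih2; set a := \int[Q]_y h y.
have ih' : Q.-integrable setT (EFin \o (fun y => 2 * a * h y)).
  by apply: eq_integrable (integrableZl measurableT (2 * a) ih).
have ic : Q.-integrable setT (EFin \o (fun _ : T => a ^+ 2)).
  by apply: finite_measure_integrable_cst.
have ihh : Q.-integrable setT (EFin \o (fun y => h y ^+ 2 - 2 * a * h y)).
  by apply: eq_integrable (integrableB measurableT ih2 ih').
have : 0 <= \int[Q]_y (h y ^+ 2 - 2 * a * h y + a ^+ 2).
  apply: Rintegral_ge0 => y _.
  have -> : h y ^+ 2 - 2 * a * h y + a ^+ 2 = (h y - a) ^+ 2 by ring.
  exact: sqr_ge0.
rewrite RintegralD // RintegralB // RintegralZl // -/a Rintegral_cst //.
rewrite [X in fine X]probability_setT mulr1; lra.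
Qed.

Section cells.
Variables (R : realType) (b s : nat) (S : gns b s) (m : nat).
Hypothesis b_prime : prime b.
Local Notation e := (gns_deg S).
Local Notation idx := (blk_idx e (fun=> m)).
Local Notation G := {ffun idx -> 'F_b}.

(** The digit string of the cell [c]; the default is used only beyond [m] blocks. *)
Definition prefix_digit (c : G) (j : 'I_s) (k : nat) : 'F_b :=
  if [pick z : idx | (tag z == j) && (blk_row z == k)] is Some z then c z else 0.

(** The affine map from the cube onto the cell of points with leading digits [c]. *)
Definition cell_map (c : G) (y : s.-tuple R) : s.-tuple R :=
  [tuple ((radix_prefix (prefix_digit c j) (m * e j))%:R + tnth y j) / b%:R ^+ (m * e j) | j < s].

Lemma measurable_cell_map c : measurable_fun setT (cell_map c).
Proof.
apply/measurable_fun_tnthP => j.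
rewrite (_ : _ \o _ = fun y : s.-tuple R =>
  ((radix_prefix (prefix_digit c j) (m * e j))%:R + tnth y j) / b%:R ^+ (m * e j)).
  apply: measurable_funM; last exact: measurable_cst.
  by apply: measurable_funD; [exact: measurable_cst|exact: measurable_tnth].
by apply/funext => y; rewrite /= tnth_mktuple.
Qed.

Lemma radix_prefix_eq (z z' : nat -> 'F_b) r : (forall k, (k < r)%N -> z k = z' k) ->
  radix_prefix z r = radix_prefix z' r.
Proof.
elim: r => //= r IH h; rewrite IH ?h // => k kr; apply: h; exact: ltnW.
Qed.

Lemma phi_tuple_cell (W : Type) (Z : 'I_s * nat -> W -> 'F_b) (c : G) w :
  (forall x : idx, Z (tag x, blk_row x) w = c x) ->
  phi_tuple R Z w = cell_map c (phi_tuple R (fun x => Z (x.1, (m * e x.1 + x.2)%N)) w).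
Proof.
move=> h; apply: eq_from_tnth => j; rewrite !tnth_mktuple (phi_split R b_prime _ (m * e j)).
congr ((_%:R + _) / _); apply: radix_prefix_eq => k km.
rewrite /prefix_digit; case: pickP => [z /andP[/eqP <- /eqP <-]|]; first exact: h.
have [z [zj zk]] := blk_ofP km => /(_ z).
by rewrite zj zk !eqxx.
Qed.

End cells.

Section second_moment.
Context d (W : measurableType d) (R : realType) (P : probability W R).
Variables (b s N m : nat) (S : gns b s).
Hypotheses (b_prime : prime b) (m_gt0 : (0 < m)%N).
Local Notation e := (gns_deg S).
Variables (D : 'I_N -> 'I_s -> W -> nat -> 'F_b)
          (M : 'I_N -> 'I_s -> W -> nat -> nat -> 'F_b).
Hypothesis cs : coarse_scrambling P e D M.
Variable q : 'I_N.
Local Notation idx := (blk_idx e (fun=> m)).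
Local Notation G := {ffun idx -> 'F_b}.
Local Notation Q := (@cube_uniform R s).
Local Notation conf := (blk_matrices 'F_b m e * G)%type.
Local Notation config w := (config e D M q m w).
Local Notation Pt n := (phi_tuple R (sdigit S D M q n)).

Let e_gt0 j : (0 < e j)%N := gns_deg_gt0 S j.

Variable g : s.-tuple R -> R.
Hypotheses (mg : measurable_fun setT g) (ig : Q.-integrable setT (EFin \o g)).
Hypothesis ig2 : Q.-integrable setT (EFin \o (fun y => g y ^+ 2)).
Hypothesis g0 : \int[Q]_y g y = 0.

Let prefix_of n w : G := config_point (config w) (point_vec S m n).

Let prefix_ofE n w x : prefix_of n w x = sdigit S D M q n (tag x, blk_row x) w.
Proof. by rewrite -(sdigit_config cs). Qed.

Let measurable_prefix n c : measurable (prefix_of n @^-1` [set c]).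
Proof.
rewrite (_ : _ @^-1` _ =
  [set w | config w \in [set cf : conf | config_point cf (point_vec S m n) == c]%SET]).
  exact: (measurable_config_in cs e_gt0).
by apply/seteqP; split=> w /=; rewrite inE => /eqP.
Qed.

Let tail n (x : 'I_s * nat) := sdigit S D M q n (x.1, (m * e x.1 + x.2)%N).

Let measurable_tail n : measurable_digits (tail n).
Proof. by move=> x a; exact: (measurable_sdigit cs). Qed.

Let X_cell n c w : prefix_of n w = c -> Pt n w = cell_map c (phi_tuple R (tail n) w).
Proof.
by move=> wc; apply: (phi_tuple_cell R b_prime) => x; rewrite -wc prefix_ofE.
Qed.

Let measurable_X n : measurable_fun setT (Pt n).
Proof. by apply: measurable_phi_tuple => // x a; exact: (measurable_sdigit cs). Qed.

Let Gn : R := #|{ffun idx -> 'F_b}|%:R.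

Let Gn0 : 0 < Gn.
Proof. by rewrite ltr0n; apply/card_gt0P; exists 0. Qed.

Let cell_list (c : G) := [seq (x, c x) | x <- enum {: idx}].

Let cell_listE n c : prefix_of n @^-1` [set c] =
  setT `&` digit_event (sdigit S D M q n \o (fun x : idx => (tag x, blk_row x))) (cell_list c).
Proof.
rewrite setTI; apply/seteqP; split=> w.
  move=> /= wc; rewrite /digit_event /= all_map; apply/allP => x _ /=.
  by rewrite -prefix_ofE wc.
rewrite /digit_event /= all_map => /allP h; apply/ffunP => x.
by rewrite prefix_ofE; apply/eqP; apply: (h x); rewrite mem_enum.
Qed.

Let uniq_cell_list c : uniq (map fst (cell_list c)).
Proof. by rewrite -map_comp map_id enum_uniq. Qed.

Let row_inj : injective (fun x : idx => (tag x, blk_row x)).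
Proof. by move=> x y [h1 h2]; exact: (blk_row_inj e_gt0). Qed.

Let cell_prob n c : P (prefix_of n @^-1` [set c]) = (Gn^-1)%:E.
Proof.
rewrite cell_listE.
have := uniform_digits_reindex row_inj (sdigit_uniform cs q n) => ->; last exact: uniq_cell_list.
rewrite [X in (X * _)%E]probability_setT mul1e size_map -cardE; congr ((_^-1)%:E).
by rewrite /Gn card_ffun natrX.
Qed.

Let tail_uniform n c : uniform_digits P (prefix_of n @^-1` [set c]) (tail n).
Proof.
rewrite cell_listE.
apply: (@uniform_digits_condition _ _ _ P _ _ _ _ (fun x : idx => (tag x, blk_row x))
  (fun x : 'I_s * nat => (x.1, (m * e x.1 + x.2)%N)) setT (sdigit S D M q n) (cell_list c)).
- exact: row_inj.
- by move=> [j k] [j' k'] /= [-> /eqP]; rewrite eqn_add2l => /eqP ->.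
- move=> x [j k] /= [xj xk]; have : (blk_row x < m * e (tag x))%N.
    case: x {xj xk} => j' [l i]; rewrite /blk_row /=.
    apply: (@leq_trans (l.+1 * e j')); first by rewrite mulSnr ltn_add2l.
    by rewrite leq_mul2r ltn_ord orbT.
  by rewrite xk xj ltnNge leq_addr.
- exact: uniq_cell_list.
- exact: sdigit_uniform.
Qed.

(* [gbar c] is the mean of [g] over the cell [c]. *)
Let gcell (c : G) (y : s.-tuple R) : R := g (cell_map c y).
Let gbar c : R := \int[Q]_y gcell c y.

Let mgcell c : measurable_fun setT (gcell c).
Proof. by apply: measurableT_comp => //; exact: measurable_cell_map. Qed.

Let integral_X (h : s.-tuple R -> R) n : Q.-integrable setT (EFin \o h) ->
  P.-integrable setT (fun w => (h (Pt n w))%:E) /\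
  (\int[P]_w (h (Pt n w))%:E = (\int[Q]_y h y)%:E)%E.
Proof.
move=> ih; have := @uniform_point_integral R b s b_prime d W P setT measurableT _
  (measurable_sdigit cs q n) (sdigit_uniform cs q n) h ih.
by move=> [h1 ->]; split=> //; rewrite [X in fine X]probability_setT mul1r.
Qed.

Let tail_law n c : forall B, measurable B ->
  P (prefix_of n @^-1` [set c] `&` phi_tuple R (tail n) @^-1` B) = (Gn^-1%:E * Q B)%E.
Proof.
move=> B mB; rewrite (@phi_tuple_law R b b_prime s d W P (prefix_of n @^-1` [set c])) //.
by rewrite cell_prob.
Qed.

Let mtail n : measurable_fun setT (phi_tuple R (tail n)).
Proof. by apply: measurable_phi_tuple => //; exact: measurable_tail. Qed.

Let Gi0 : 0 <= Gn^-1. Proof. by rewrite invr_ge0 ltW. Qed.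

(* The restriction of [g] to the cell inherits integrability from [g], a cell
   having positive probability. *)
Let igcell2 c : Q.-integrable setT (EFin \o (fun y => gcell c y ^+ 2)).
Proof.
have mh : measurable_fun setT (EFin \o (fun y => gcell c y ^+ 2)).
  by apply/measurable_EFinP; exact: measurable_funX.
apply/integrableP; split=> //.
have -> : (\int[Q]_y `|(EFin \o (fun y => gcell c y ^+ 2)%R) y| = \int[Q]_y (gcell c y ^+ 2)%:E)%E.
  by apply: eq_integral => y _; rewrite gee0_abs // lee_fin sqr_ge0.
have h0 y : (0 <= (gcell c y ^+ 2)%:E)%E by rewrite lee_fin sqr_ge0.
have E := law_transfer_ge0 (measurable_prefix 0 c) (mtail 0) Gi0 (tail_law 0 c) mh h0.
have lt : (\int[P]_(w in prefix_of 0 @^-1` [set c]) (gcell c (phi_tuple R (tail 0) w) ^+ 2)%:E < +oo)%E.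
  apply: (@le_lt_trans _ _ (\int[P]_w (g (Pt 0 w) ^+ 2)%:E)%E); last first.
    by have [_ ->] := integral_X 0 ig2; rewrite ltry.
  rewrite (eq_integral (fun w => (g (Pt 0 w) ^+ 2)%:E)) => [|w /set_mem /= wc].
    apply: ge0_subset_integral => //.
      by apply/measurable_EFinP; apply: measurable_funX; exact: measurableT_comp.
    by move=> w _; rewrite lee_fin sqr_ge0.
  by rewrite (X_cell wc).
rewrite ltey; apply/eqP => Ioo; move: lt.
by rewrite [X in (X < _)%E](_ : _ = +oo%E) ?ltxx // E Ioo gt0_muley // lte_fin invr_gt0.
Qed.

Let igcell c : Q.-integrable setT (EFin \o gcell c).
Proof. exact: integrable_of_sqr (mgcell c) (igcell2 c). Qed.

Let int_cell n c : (\int[P]_(w in prefix_of n @^-1` [set c]) (g (Pt n w))%:E = (Gn^-1 * gbar c)%:E)%E.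
Proof.
rewrite (eq_integral (fun w => (gcell c (phi_tuple R (tail n) w))%:E)); last first.
  by move=> w /set_mem /= wc; rewrite (X_cell wc).
rewrite (law_transfer_integral (measurable_prefix n c) (mtail n) Gi0 (tail_law n c) (igcell c)).
rewrite EFinM; congr (_ * _)%E; rewrite /gbar /Rintegral fineK //.
exact: integrable_fin_num (igcell c).
Qed.

Let int_cell2 n c : (\int[P]_(w in prefix_of n @^-1` [set c]) (g (Pt n w) ^+ 2)%:E =
  (Gn^-1 * \int[Q]_y (gcell c y ^+ 2))%:E)%E.
Proof.
rewrite (eq_integral (fun w => (gcell c (phi_tuple R (tail n) w) ^+ 2)%:E)); last first.
  by move=> w /set_mem /= wc; rewrite (X_cell wc).
rewrite (law_transfer_integral (measurable_prefix n c) (mtail n) Gi0 (tail_law n c) (igcell2 c)).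
rewrite EFinM; congr (_ * _)%E; rewrite /Rintegral fineK //.
exact: integrable_fin_num (igcell2 c).
Qed.

Let mgX n : measurable_fun setT (fun w => g (Pt n w)).
Proof. exact: measurableT_comp. Qed.

Let sum_gbar : \sum_c gbar c = 0.
Proof.
have := integral_fibers P (measurable_prefix 0) (mgX 0).
have [_ ->] := integral_X 0 ig; rewrite g0.
under eq_bigr do rewrite int_cell.
rewrite sumEFin -mulr_sumr => -[/esym/eqP].
by rewrite mulf_eq0 invr_eq0 (gt_eqF Gn0) => /eqP.
Qed.

Let ng : R := \int[Q]_y (g y ^+ 2).

Let sum_gbar2 : Gn^-1 * \sum_c gbar c ^+ 2 <= ng.
Proof.
have := integral_fibers P (measurable_prefix 0) (measurable_funX 2 (mgX 0)).
have [_ ->] := integral_X 0 ig2.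
under eq_bigr do rewrite int_cell2.
rewrite sumEFin -mulr_sumr => -[]; rewrite /ng => ->.
by rewrite ler_pM2l ?invr_gt0 //; apply: ler_sum => c _; exact: Rintegral_sqr_le.
Qed.

Let Om : {set conf} := [set cf : conf | cf.1 \in scramblers 'F_b m e]%SET.
Let nOm : R := #|Om|%:R.

Let nOm0 : 0 < nOm.
Proof.
rewrite lt_neqAle ler0n andbT eq_sym; apply/eqP => n0.
have := config_prob cs e_gt0 q (finset.setT : {set conf}).
rewrite -/Om -/nOm n0 invr0 mulr0 (_ : [set w | _] = [set: W]).
  by rewrite probability_setT => /eqP; rewrite eqe oner_eq0.
by apply/seteqP; split=> w // _ /=; rewrite inE.
Qed.

(* Expectation of a function of the configuration, as a finite mean. *)
Let Ebar (h : conf -> R) : R := (\sum_(cf in Om) h cf) / nOm.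

Let ptv n (cf : conf) : G := config_point cf (point_vec S m n).

(* Split according to the pair of cells: given these, the two tails are
   independent and uniform, so the integral factors into the two cell means. *)
Let pair_integral n n' : (n < b ^ m)%N -> (n' < b ^ m)%N -> n != n' ->
  (\int[P]_w (g (Pt n w) * g (Pt n' w))%:E = (Ebar (fun cf => gbar (ptv n cf) * gbar (ptv n' cf)))%:E)%E.
Proof.
move=> nm n'm nn'.
pose X w : G * G := (prefix_of n w, prefix_of n' w).
have XE cc : X @^-1` [set cc] = prefix_pair_event D M q n n' cc.1 cc.2.
  by case: cc => c c'; apply/seteqP; split=> w /=;
      [case=> <- <-|case=> /= h1 h2; rewrite /X /prefix_of h1 h2].
have mX cc : measurable (X @^-1` [set cc]) by rewrite XE; exact: (measurable_prefix_pair_event cs).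
rewrite (integral_fibers P mX); last exact: measurable_funM.
pose cnt (cc : G * G) : R := #|[set cf : conf | (ptv n cf, ptv n' cf) == cc]%SET :&: Om|%:R.
have PX cc : P (X @^-1` [set cc]) = (cnt cc / nOm)%:E.
  rewrite -[RHS](config_prob cs e_gt0 q); congr (P _).
  by apply/seteqP; split=> w /=; rewrite inE => /eqP.
have fE cc : (\int[P]_(w in X @^-1` [set cc]) (g (Pt n w) * g (Pt n' w))%:E =
    (cnt cc / nOm * (gbar cc.1 * gbar cc.2))%:E)%E.
  have tu := tail_digits_uniform b_prime cs q m_gt0 nm n'm nn' cc.1 cc.2.
  rewrite -XE in tu.
  have [_] := uniform_pair_integral b_prime (mX cc) (measurable_tail_digits cs q m n n') tu
      (igcell cc.1) (igcell cc.2).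
  rewrite PX /= => <-; apply: eq_integral => w /set_mem; rewrite XE => -[/= h1 h2].
  by rewrite (X_cell h1) (X_cell h2).
under eq_bigr do rewrite fE.
rewrite sumEFin; congr EFin; rewrite /Ebar mulr_suml.
rewrite (partition_big (fun cf => (ptv n cf, ptv n' cf)) predT) //=.
apply: eq_bigr => cc _.
rewrite (eq_bigr (fun=> gbar cc.1 * gbar cc.2 / nOm)) => [|cf /andP[_ /eqP <-] //].
rewrite sumr_const -[RHS]mulr_natr.
have -> : cnt cc = #|[pred cf in Om | (ptv n cf, ptv n' cf) == cc]|%:R.
  by congr (_%:R); apply: eq_card => cf; rewrite finset.in_setI andbC; congr (_ && _); rewrite inE.
by field; rewrite gt_eqF.
Qed.

Let sum_Om (h : conf -> R) : \sum_(cf in Om) h cf =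
  \sum_(om in scramblers 'F_b m e) \sum_dl h (om, dl).
Proof.
rewrite pair_big /=; apply: eq_big => [[om dl]|[om dl] //]; by rewrite inE andbT.
Qed.

Let nOmE : nOm = #|scramblers 'F_b m e|%:R * Gn.
Proof.
rewrite /nOm -sum1_card natr_sum (sum_Om (fun=> 1)).
by rewrite (eq_bigr (fun=> Gn)) => [|om _]; rewrite sumr_const // mulr_natl.
Qed.

Let Ebar_point n (h : G -> R) : Ebar (fun cf => h (ptv n cf)) = Gn^-1 * \sum_c h c.
Proof.
rewrite /Ebar sum_Om (eq_bigr (fun=> \sum_c h c)) => [|om _].
  rewrite sumr_const -[X in X / _]mulr_natl nOmE.
  have := gt_eqF nOm0; rewrite nOmE mulf_eq0 => /negbT; rewrite negb_or => /andP[sn _].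
  by field; rewrite sn gt_eqF.
by rewrite [RHS](reindex_inj (addrI (scramble_act om (point_vec S m n)))).
Qed.

Local Notation Cst := (\prod_j (1 - (#|'F_b|%:R ^+ e j)^-1)^-1 : R).

Let Ebar_gain : Ebar (fun cf => (\sum_(n < b ^ m) gbar (ptv n cf)) ^+ 2) <=
  Cst * b%:R ^+ m * (Gn^-1 * \sum_c gbar c ^+ 2).
Proof.
have ker (ell : 'I_s -> nat) : (#|[set a : {ffun blk_idx e ell -> 'F_b} |
      [forall r : 'I_m, (\sum_x a x * gns_matrix S (tag x) (blk_row x) r == 0)%R]]%SET| <=
   #|'F_b| ^ (\sum_j ell j * e j - m))%N.
  by rewrite card_Fp //; exact: card_gns_kernel.
have := finite_gain ker e_gt0 sum_gbar.
rewrite -(sum_Om (fun cf => (\sum_(v : {ffun 'I_m -> 'F_b})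
    gbar (config_point cf (gen_mul m e (gns_matrix S) v))) ^+ 2)).
have sumE cf : \sum_(v : {ffun 'I_m -> 'F_b}) gbar (config_point cf (gen_mul m e (gns_matrix S) v)) =
    \sum_(n < b ^ m) gbar (ptv n cf).
  apply: etrans (esym (sum_digit_vec b_prime
    (fun v : {ffun 'I_m -> 'F_b} => gbar (config_point cf (gen_mul m e (gns_matrix S) v))))) _.
  by apply: eq_bigr => n _; rewrite /ptv (point_vecE S b_prime m (ltn_ord n)).
rewrite (eq_bigr (fun cf => (\sum_(n < b ^ m) gbar (ptv n cf)) ^+ 2)) => [h|cf _]; last first.
  by rewrite sumE.
rewrite /Ebar ler_pdivrMr // nOmE; apply: le_trans h _; rewrite card_Fp //.
rewrite le_eqVlt; apply/orP; left; apply/eqP; field; exact: lt0r_neq0.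
Qed.

Let Cst_ge1 : 1 <= Cst.
Proof.
apply: (big_ind (fun x : R => 1 <= x)) => // [x y|j _]; first exact: mulr_ege1.
rewrite card_Fp //.
have b1 : 1 < b%:R ^+ e j :> R by rewrite exprn_egt1 ?ltr1n ?prime_gt1 // -lt0n.
by rewrite invf_ge1 ?subr_gt0 ?invf_lt1 ?gerBl ?invr_ge0 ?(ltW (lt_trans ltr01 b1)) ?(lt_trans ltr01 b1).
Qed.

Let ig_prod n n' : P.-integrable setT (fun w => (g (Pt n w) * g (Pt n' w))%:E).
Proof.
have [i1 _] := integral_X n ig2; have [i2 _] := integral_X n' ig2.
apply: le_integrable (integrableD measurableT i1 i2) => //.
  by apply/measurable_EFinP; exact: measurable_funM.
move=> w _; rewrite /= lee_fin [leRHS]ger0_norm ?addr_ge0 ?sqr_ge0 //.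
set x := g _; set y := g _; rewrite normrM.
have := sqr_ge0 (`|x| - `|y|); rewrite -(real_normK (num_real x)) -(real_normK (num_real y)).
have := normr_ge0 x; have := normr_ge0 y; nra.
Qed.

(** Expand the square.  Off the diagonal, [g] may be replaced by [gbar]; on the
    diagonal this loses [ng - Gn^-1 * \sum_c gbar c ^+ 2], nonnegative by
    [sum_gbar2].  The finite gain inequality bounds the second moment for [gbar],
    and the loss is absorbed because the constant is at least 1. *)
Lemma second_moment_le :
  (\int[P]_w ((\sum_(n < b ^ m) g (Pt n w)) ^+ 2)%:E <= (Cst * b%:R ^+ m * ng)%:E)%E.
Proof.
have -> : (\int[P]_w ((\sum_(n < b ^ m) g (Pt n w)) ^+ 2)%:E =
    \sum_(n < b ^ m) \sum_(n' < b ^ m) \int[P]_w (g (Pt n w) * g (Pt n' w))%:E)%E.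
  transitivity (\int[P]_w (\sum_(n < b ^ m) \sum_(n' < b ^ m) (g (Pt n w) * g (Pt n' w))%:E))%E.
    apply: eq_integral => w _; rewrite expr2 mulr_suml -sumEFin; apply: eq_bigr => n _.
    by rewrite mulr_sumr -sumEFin.
  rewrite integral_sum // => [|n]; last by apply: integrable_sum => // n' _; exact: ig_prod.
  by apply: eq_bigr => n _; rewrite integral_sum // => n'; exact: ig_prod.
pose T (n n' : 'I_(b ^ m)) : R := Ebar (fun cf => gbar (ptv n cf) * gbar (ptv n' cf)) +
     (if n' == n then ng - Gn^-1 * \sum_c gbar c ^+ 2 else 0).
have TE (n n' : 'I_(b ^ m)) : (\int[P]_w (g (Pt n w) * g (Pt n' w))%:E = (T n n')%:E)%E.
  rewrite /T; case: eqVneq => [->|ne].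
    have [_ nE] := integral_X n ig2.
    under eq_integral do rewrite -expr2.
    rewrite nE -/ng; congr EFin.
    have -> : Ebar (fun cf => gbar (ptv n cf) * gbar (ptv n cf)) = Gn^-1 * \sum_c gbar c ^+ 2.
      by rewrite -(Ebar_point n); congr (_ / _); apply: eq_bigr => cf _; rewrite expr2.
    by rewrite addrC subrK.
  by rewrite addr0 pair_integral // 1?eq_sym.
rewrite (eq_bigr (fun n => (\sum_(n' < b ^ m) T n n')%:E)) => [|n _]; last first.
  by rewrite -sumEFin; apply: eq_bigr => n' _; rewrite TE.
rewrite sumEFin lee_fin.
have -> : \sum_(n < b ^ m) \sum_(n' < b ^ m) T n n' =
  Ebar (fun cf => (\sum_(n < b ^ m) gbar (ptv n cf)) ^+ 2) +
    b%:R ^+ m * (ng - Gn^-1 * \sum_c gbar c ^+ 2).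
  rewrite /T; under eq_bigr do rewrite big_split /= -big_mkcond big_pred1_eq.
  rewrite big_split /= sumr_const card_ord -[X in _ + X = _]mulr_natl natrX; congr (_ + _).
  rewrite /Ebar; under eq_bigr do rewrite -mulr_suml.
  rewrite -mulr_suml; congr (_ / _); under eq_bigr do rewrite exchange_big.
  rewrite exchange_big; apply: eq_bigr => cf _ /=.
  by rewrite expr2 mulr_suml; apply: eq_bigr => n _; rewrite mulr_sumr.
have h1 := Ebar_gain; have h2 := sum_gbar2; have h3 := Cst_ge1.
set u := Gn^-1 * _ in h1 h2 *; set C := \prod_j _ in h1 h3 *.
have bm : 0 < b%:R ^+ m :> R by rewrite exprn_gt0 // ltr0n prime_gt0.
apply: le_trans (lerD h1 (lexx _)) _.
rewrite -subr_ge0.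
have -> : C * b%:R ^+ m * ng - (C * b%:R ^+ m * u + b%:R ^+ m * (ng - u)) =
  (C - 1) * (b%:R ^+ m * (ng - u)) by ring.
by rewrite mulr_ge0 ?subr_ge0 // mulr_ge0 ?subr_ge0 // ltW.
Qed.

End second_moment.

(** * The mean squared error of the median *)

Section square_integrable.
Variables (R : realType) (s : nat) (f : s.-tuple R -> R).
Hypothesis fL2 : cube_L2 f.
Local Notation Q := (@cube_uniform R s).
Local Notation F := (f \_ (@unit_cube R s)).

Let mF : measurable_fun setT F.
Proof. by move: fL2; rewrite /cube_L2 inE => /andP[/[!inE]]. Qed.

Let mcube : measurable (@unit_cube R s) := @measurable_unit_cube R s.

Let law : forall B, measurable B -> lebesgue_tuple s (@unit_cube R s `&` id @^-1` B) = (1%:E * Q B)%E.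
Proof. by move=> B mB; rewrite mul1e preimage_id setIC. Qed.

Let mid : measurable_fun setT (@id (s.-tuple R)).
Proof. exact: measurable_id. Qed.

Lemma cube_L2_integrable_sqr : Q.-integrable setT (EFin \o (fun y => F y ^+ 2)).
Proof.
have /integrableP[m2 h] := Lfun2_integrable_sqr fL2; apply/integrableP; split=> //.
rewrite -[X in (X < _)%E]mul1e.
rewrite -(law_transfer_ge0 mcube mid ler01 law (h := fun y => `|(F y ^+ 2)%:E|%E)) //.
  apply: le_lt_trans h; apply: ge0_subset_integral => //.
  exact: measurableT_comp.
exact: measurableT_comp.
Qed.

Lemma cube_L2_integrable : Q.-integrable setT (EFin \o F).
Proof. exact: integrable_of_sqr mF cube_L2_integrable_sqr. Qed.

Lemma cube_integralE : cube_integral f = \int[Q]_y F y.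
Proof.
rewrite /cube_integral /Rintegral; congr fine.
rewrite -[RHS]mul1e -(law_transfer_integral mcube mid ler01 law cube_L2_integrable).
by apply: eq_integral => y yc; rewrite /= patchE yc.
Qed.

Lemma cube_integral_sqrE : cube_integral (fun x => f x ^+ 2) = \int[Q]_y (F y ^+ 2).
Proof.
rewrite /cube_integral /Rintegral; congr fine.
rewrite -[RHS]mul1e -(law_transfer_integral mcube mid ler01 law cube_L2_integrable_sqr).
by apply: eq_integral => y yc; rewrite /= patchE yc.
Qed.

Local Notation I := (cube_integral f).
Local Notation g := (fun y => F y - I).

Let iI : Q.-integrable setT (EFin \o (fun _ : s.-tuple R => I)).
Proof. exact: finite_measure_integrable_cst. Qed.

Lemma centered_measurable : measurable_fun setT g.
Proof. by apply: measurable_funB => //; exact: measurable_cst. Qed.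

Lemma centered_integrable : Q.-integrable setT (EFin \o g).
Proof. exact: eq_integrable (integrableB measurableT cube_L2_integrable iI). Qed.

Lemma centered_integral : \int[Q]_y (F y - I) = 0.
Proof.
rewrite RintegralB //; last exact: cube_L2_integrable.
by rewrite -cube_integralE Rintegral_cst // [X in fine X]probability_setT mulr1 subrr.
Qed.

Let i2 : Q.-integrable setT (EFin \o (fun y => 2 * I * F y)).
Proof. exact: eq_integrable (integrableZl measurableT (2 * I) cube_L2_integrable). Qed.

Let iI2 : Q.-integrable setT (EFin \o (fun _ : s.-tuple R => I ^+ 2)).
Proof. exact: finite_measure_integrable_cst. Qed.

Let i3 : Q.-integrable setT (EFin \o (fun y => F y ^+ 2 - 2 * I * F y)).
Proof. exact: eq_integrable (integrableB measurableT cube_L2_integrable_sqr i2). Qed.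

Let sqrE : (fun y => (F y - I) ^+ 2) = (fun y => F y ^+ 2 - 2 * I * F y + I ^+ 2).
Proof. by apply/funext => y; ring. Qed.

Lemma centered_integrable_sqr : Q.-integrable setT (EFin \o (fun y => (F y - I) ^+ 2)).
Proof. by rewrite sqrE; exact: eq_integrable (integrableD measurableT i3 iI2). Qed.

Lemma centered_integral_sqr : \int[Q]_y ((F y - I) ^+ 2) = sigma2_MC f.
Proof.
rewrite sqrE RintegralD // RintegralB //; last exact: cube_L2_integrable_sqr.
rewrite RintegralZl //; last exact: cube_L2_integrable.
rewrite Rintegral_cst // [X in fine X]probability_setT mulr1 -cube_integralE -cube_integral_sqrE.
by rewrite /sigma2_MC; ring.
Qed.

End square_integrable.

Theorem theorem3p5 (R : realType) (b s m N : nat) (beta : R) (S : gns b s)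
  (d : measure_display) (W : measurableType d) (P : probability W R)
  (D : 'I_N -> 'I_s -> W -> nat -> 'F_b)
  (M : 'I_N -> 'I_s -> W -> nat -> nat -> 'F_b)
  (f : s.-tuple R -> R) :
  prime b -> (0 < s)%N -> (0 < m)%N -> odd N -> 0 < beta ->
  reduced (fun n => ln n%:R `^ (1 + beta)) S ->
  coarse_scrambling P (gns_deg S) D M ->
  cube_L2 f ->
  ('E_P[fun w => (`|median_estimate S m D M f w - cube_integral f| ^+ 2)%R] <=
   (2 * C_const beta / b%:R ^+ m * sigma2_MC f)%R%:E)%E.
Proof.
move=> bp s0 m0 oN beta0 red cs fL2.
set I := cube_integral f; pose g y := (f \_ (@unit_cube R s)) y - I.
pose Pt q n := phi_tuple R (sdigit S D M q n).
have mg : measurable_fun setT g := centered_measurable fL2.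
have sm q : (\int[P]_w ((\sum_(n < b ^ m) g (Pt q n w)) ^+ 2)%:E <=
    (C_const beta * b%:R ^+ m * sigma2_MC f)%:E)%E.
  have := second_moment_le bp m0 cs q mg (centered_integrable fL2) (centered_integrable_sqr fL2)
    (centered_integral fL2).
  move/le_trans; apply; rewrite lee_fin (centered_integral_sqr fL2).
  rewrite ler_wpM2r //.
    by rewrite -(centered_integral_sqr fL2); apply: Rintegral_ge0 => y _; exact: sqr_ge0.
  by rewrite ler_wpM2r ?exprn_ge0 //; exact: gain_constant_le.
have bm : b%:R ^+ m != 0 :> R by rewrite expf_neq0 // pnatr_eq0 -lt0n prime_gt0.
have estE q w : estimate S m f (M q ^~ w) (D q ^~ w) - I =
    (b%:R ^+ m)^-1 * \sum_(n < b ^ m) g (Pt q n w).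
  rewrite /estimate /g big_split /= sumr_const card_ord -[X in _ = _ * (_ + X)]mulr_natl natrX mulrDr.
  by congr (_ + _); rewrite mulrA mulVf // mul1r.
set k := N./2.
have k0 : 0 < k.+1%:R :> R by rewrite ltr0n.
have NE : N = k.*2.+1 by rewrite -[LHS]odd_double_half oN.
pose c : R := k.+1%:R^-1 * (b%:R ^+ m)^-1 ^+ 2.
have c0 : 0 <= c by rewrite mulr_ge0 ?invr_ge0 ?sqr_ge0.
have medle w : `|median_estimate S m D M f w - I| ^+ 2 <=
    c * \sum_(q < N) (\sum_(n < b ^ m) g (Pt q n w)) ^+ 2.
  rewrite real_normK ?num_real //.
  have := median_sqr_le (x := [seq estimate S m f (M q ^~ w) (D q ^~ w) | q : 'I_N]) I.
  rewrite size_map size_enum_ord -/k => /(_ oN).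
  rewrite big_map big_enum /= => h.
  rewrite /c -mulrA ler_pdivlMl //; apply: le_trans h _; rewrite mulr_sumr.
  by apply: ler_sum => q _; rewrite estE exprMn.
rewrite unlock.
apply: (@le_trans _ _ (\int[P]_w (c%:E * \sum_(q < N) ((\sum_(n < b ^ m) g (Pt q n w)) ^+ 2)%:E))%E).
  apply: ge0_le_integralT => w; first by rewrite lee_fin sqr_ge0.
  by rewrite sumEFin -EFinM lee_fin.
have mPt q n : measurable_fun setT (Pt q n).
  by apply: measurable_phi_tuple => // x a; exact: (measurable_sdigit cs).
have msq q : measurable_fun setT (fun w => ((\sum_(n < b ^ m) g (Pt q n w)) ^+ 2)%:E).
  apply/measurable_EFinP; apply: measurable_funX; apply: measurable_sum => n.
  exact: measurableT_comp.
rewrite ge0_integralZl //; last 2 first.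
- exact: emeasurable_sum.
- by move=> w _; apply: sume_ge0 => q _; rewrite lee_fin sqr_ge0.
rewrite ge0_integral_sum //; last by move=> q w _; rewrite lee_fin sqr_ge0.
apply: (@le_trans _ _ (c%:E * \sum_(q < N) (C_const beta * b%:R ^+ m * sigma2_MC f)%:E)%E).
  by apply: lee_wpmul2l; [rewrite lee_fin|apply: lee_sum => q _; exact: sm].
have s2 : 0 <= sigma2_MC f.
  by rewrite -(centered_integral_sqr fL2); apply: Rintegral_ge0 => y _; exact: sqr_ge0.
rewrite sumEFin -EFinM lee_fin sumr_const card_ord -[_ *+ _]mulr_natl.
have -> : c * (N%:R * (C_const beta * b%:R ^+ m * sigma2_MC f)) =
    (N%:R / k.+1%:R) * (C_const beta / b%:R ^+ m * sigma2_MC f).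
  by rewrite /c; field; rewrite bm gt_eqF.
have -> : 2 * C_const beta / b%:R ^+ m * sigma2_MC f =
  2 * (C_const beta / b%:R ^+ m * sigma2_MC f) by ring.
apply: ler_wpM2r.
  by rewrite mulr_ge0 // mulr_ge0 ?expR_ge0 // invr_ge0 exprn_ge0.
by rewrite ler_pdivrMr // -natrM ler_nat NE -muln2 mulnC; lia.
Qed.
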